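(* For every integer $n\geq 1$, the full arc complex $\mathcal{A}(\mathcal{P}_n^{\times})$ of the orientable crown $\mathcal{P}_n^{\times}$ with $n$ boundary vertices is a combinatorial ball of dimension $n-1$.
   Context: Surface. For $n\ge 1$, the (orientable) crown $\mathcal{P}_n^{\times}$ is a closed disk with $n$ distinct marked points on its boundary, labeled $1,\dots,n$ in cyclic order, and one marked point in its interior labeled $0$. The marked points are called vertices; the portion of the boundary between two consecutive boundary vertices is an edge (for $n=1$, the single edge is the whole boundary circle). Arcs. A simple arc is an arc in the surface whose two endpoints are vertices (possibly the same vertex), which is embedded except that its endpoints may coincide, and whose interior avoids the boundary of the surface and all vertices. Homotopies of arcs are relative to endpoints, with the interior of the arc avoiding the vertices (in particular the interior marked point $0$). An arc is trivial if it is homotopic, relative to its endpoints, to a vertex or to an edge. Only simple non-trivial arcs are considered. Two homotopy classes are disjoint if they have representatives that are disjoint (except possibly at endpoints). Arc complex. The full arc complex $\mathcal{A}(S)$ of a surface $S$ is the simplicial complex whose 0-simplices are the homotopy classes of all simple non-trivial arcs, and whose $k$-simplices ($k\ge1$) are the sets of $k+1$ pairwise disjoint and distinct homotopy classes. A combinatorial $d$-ball is a simplicial complex that is PL homeomorphic to the $d$-simplex. *)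

(* Defs.v *)
From mathcomp Require Import all_boot all_order all_algebra finmap.
From mathcomp Require Import all_classical all_reals all_analysis.

Set Implicit Arguments.
Unset Strict Implicit.
Unset Printing Implicit Defensive.

Import Order.TTheory GRing.Theory Num.Theory.
Import numFieldNormedType.Exports.

Local Open Scope classical_set_scope.
Local Open Scope ring_scope.

(** * Simplicial complexes and PL homeomorphisms *)

(* Not every point of [V] has to be a vertex: the vertices are the [v] such
   that [[fset v]] is a face. *)
Record simplicial_complex (V : choiceType) := SimplicialComplex {
  faces : set {fset V};
  faces_neq0 : forall s, faces s -> s != fset0;
  faces_sub : forall s t,
    faces s -> t != fset0 -> (t `<=` s)%fset -> faces t }.

Section geometric_complexes.
Variables (R : realType) (E : lmodType R).

Definition convex_hull (s : {fset E}) : set E :=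
  [set x | exists w : E -> R,
     [/\ forall p, p \in s -> 0 <= w p,
         \sum_(p <- s) w p = 1
       & x = \sum_(p <- s) w p *: p]].

Definition affinely_independent (s : {fset E}) : Prop :=
  forall w : E -> R,
    \sum_(p <- s) w p = 0 -> \sum_(p <- s) w p *: p = 0 ->
    forall p, p \in s -> w p = 0.

(* A geometric simplex is represented by the set of its vertices.
   [convex_hull fset0] is empty, so the last clause also covers simplices
   which do not meet. *)
Definition geometric_complex (G : simplicial_complex E) : Prop :=
  (forall s, faces G s -> affinely_independent s) /\
  (forall s t, faces G s -> faces G t ->
     convex_hull s `&` convex_hull t = convex_hull (s `&` t)%fset).

Definition polyhedron (G : set {fset E}) : set E :=
  \bigcup_(s in G) convex_hull s.

Definition subdivides (G' : simplicial_complex E) (G : set {fset E}) : Prop :=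
  [/\ geometric_complex G',
      forall t, faces G' t -> exists2 s, G s & convex_hull t `<=` convex_hull s
    & forall s, G s -> exists F : {fset {fset E}},
        (forall t, t \in F -> faces G' t) /\
        convex_hull s = polyhedron [set` F]].

Definition affine_on (E' : lmodType R) (A : set E) (f : E -> E') : Prop :=
  forall x y (a : R), A x -> A y -> 0 <= a <= 1 ->
    f (a *: x + (1 - a) *: y) = a *: f x + (1 - a) *: f y.

End geometric_complexes.

Section realization.
Variable R : realType.

Definition vertex_point (V : choiceType) (v : V) : V -> R^o :=
  fun u => (u == v)%:R.

Definition realization (V : choiceType) (K : simplicial_complex V) :
    set {fset (V -> R^o)} :=
  [set [fset vertex_point v | v in s]%fset | s in faces K].

Definition underlying_space (V : choiceType) (K : simplicial_complex V) : set (V -> R^o) :=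
  polyhedron (realization K).

(* Continuity needs no separate clause: a map which is affine on the simplices
   of a subdivision is continuous. *)
Definition pl_map (V W : choiceType) (K : simplicial_complex V)
    (L : simplicial_complex W) (f : (V -> R^o) -> (W -> R^o)) : Prop :=
  (forall x, underlying_space K x -> underlying_space L (f x)) /\
  exists G, subdivides G (realization K) /\
    forall t, faces G t -> affine_on (convex_hull t) f.

Definition pl_homeomorphic (V W : choiceType) (K : simplicial_complex V)
    (L : simplicial_complex W) : Prop :=
  exists f g,
    [/\ pl_map K L f, pl_map L K g,
        forall x, underlying_space K x -> g (f x) = x
      & forall y, underlying_space L y -> f (g y) = y].

End realization.

Lemma simplex_sub (d : nat) (s t : {fset 'I_d.+1}) :
  s != fset0 -> t != fset0 -> (t `<=` s)%fset -> t != fset0.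
Proof. by []. Qed.

Definition simplex (d : nat) : simplicial_complex 'I_d.+1 :=
  @SimplicialComplex _ [set s | s != fset0] (fun _ h => h) (@simplex_sub d).

Definition combinatorial_ball (R : realType) (d : nat) (V : choiceType)
    (K : simplicial_complex V) : Prop :=
  pl_homeomorphic R K (simplex d).

(** * Crowns *)

Section crowns.
Variable R : realType.

Local Notation plane := (R * R)%type.

Definition closed_disk : set plane := [set z | z.1 ^+ 2 + z.2 ^+ 2 <= 1].
Definition open_disk : set plane := [set z | z.1 ^+ 2 + z.2 ^+ 2 < 1].

Definition circle_point (a : R) : plane := (cos a, sin a).

(* The surface is the closed unit disk.  The boundary vertex with label [k] sits
   at angle [angle k]; labels are read modulo [n], and [angle] lifts the cyclic
   order of the vertices to the real line.  The interior vertex, labelled 0 in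
   the usual convention, is [puncture]. *)
Record crown (n : nat) := Crown {
  angle : nat -> R;
  puncture : plane;
  angle_lt : forall k, angle k < angle k.+1;
  angle_period : forall k, angle (k + n)%N = angle k + 2 * pi;
  puncture_interior : open_disk puncture }.

Section arcs.
Variables (n : nat) (C : crown n).

Definition boundary_vertex (k : nat) : plane := circle_point (angle C k).

Definition vertices : set plane := puncture C |` range boundary_vertex.

(* The edge from the [k]-th boundary vertex to the next one. *)
Definition edge (k : nat) (t : R) : plane :=
  circle_point ((1 - t) * angle C k + t * angle C k.+1).

(* Arcs are parametrized by [0, 1]; values outside [0, 1] are irrelevant. *)
Definition simple_arc (g : R -> plane) : Prop :=
  [/\ {within `[0, 1], continuous g},
      vertices (g 0) /\ vertices (g 1),
      forall t : R, 0 < t < 1 -> open_disk (g t) /\ ~ vertices (g t)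
    & forall s t : R, 0 <= s -> s < t -> t <= 1 -> g s = g t -> s = 0 /\ t = 1].

(* The final stage [s = 1] is exempted from avoiding the vertices so that [h] may
   be constant at a vertex; when [h] is an arc or an edge its interior avoids
   the vertices anyway. *)
Definition homotopic (g h : R -> plane) : Prop :=
  exists H : R * R -> plane,
    [/\ {within `[0, 1] `*` `[0, 1], continuous H},
        forall t : R, 0 <= t <= 1 -> H (0, t) = g t /\ H (1, t) = h t,
        forall s : R, 0 <= s <= 1 -> H (s, 0) = g 0 /\ H (s, 1) = g 1,
        forall s t : R, 0 <= s <= 1 -> 0 <= t <= 1 -> closed_disk (H (s, t))
      & forall s t : R, 0 <= s < 1 -> 0 < t < 1 -> ~ vertices (H (s, t))].

Definition reverse (g : R -> plane) : R -> plane := fun t => g (1 - t).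

(* Arcs are unoriented. *)
Definition arc_homotopic (g h : R -> plane) : Prop :=
  homotopic g h \/ homotopic g (reverse h).

Definition trivial_arc (g : R -> plane) : Prop :=
  (exists2 v, vertices v & arc_homotopic g (fun=> v)) \/
  (exists k, arc_homotopic g (edge k)).

Definition arc (g : R -> plane) : Prop := simple_arc g /\ ~ trivial_arc g.

Definition arc_class (g : R -> plane) : set (R -> plane) :=
  [set h | arc h /\ arc_homotopic g h].

Definition arc_classes : set (set (R -> plane)) := [set arc_class g | g in arc].

(* The interiors of arcs avoid the vertices, so two arcs are disjoint except
   possibly at endpoints iff their interiors are disjoint. *)
Definition disjoint_classes (c d : set (R -> plane)) : Prop :=
  exists g h, [/\ c g, d h &
    forall s t : R, 0 < s < 1 -> 0 < t < 1 -> g s <> h t].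

Definition arc_faces : set {fset (set (R -> plane))} :=
  [set s | [/\ s != fset0,
     forall c, c \in s -> arc_classes c
   & forall c d, c \in s -> d \in s -> c <> d -> disjoint_classes c d]].

Lemma arc_faces_neq0 s : arc_faces s -> s != fset0.
Proof. by case. Qed.

Lemma arc_faces_sub s t :
  arc_faces s -> t != fset0 -> (t `<=` s)%fset -> arc_faces t.
Proof.
move=> [_ sc sd] t0 /fsubsetP ts; split=> // [c /ts|c d /ts cs /ts ds].
  exact: sc.
exact: sd.
Qed.

Definition arc_complex : simplicial_complex (set (R -> plane)) :=
  SimplicialComplex arc_faces_neq0 arc_faces_sub.

End arcs.
End crowns.

(* Main.v *)
Require Import Defs.
From mathcomp Require Import all_boot all_order all_algebra finmap.
From mathcomp Require Import all_classical all_reals all_analysis.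
From mathcomp Require Import ring lra zify.

(** Homotopy classes of arcs are replaced by finitely many combinatorial codes,
    and the flag complex on these codes is then seen to triangulate a simplex.

    Arcs.  Every point of the disk is [polar p a l], the point at fraction [l]
    of the segment from the puncture [p] to the boundary point at angle [a].  A
    path or a homotopy that avoids [p] lifts to the strip of pairs [(a, l)]
    ([polar_lift]).  The strip is convex, so paths whose lifts have the same
    ends are homotopic ([strip_homotopic]), and the total turn of the angle is a
    homotopy invariant ([homotopic_turn]).  Hence an arc between two boundary
    vertices is determined by the lifted indices [a < b] of its ends, up to a
    common multiple of [n] and up to reversal.  A simple arc cannot cross its
    own translate by a full turn, which gives [b <= a + n]
    ([simple_chord_length]); it is trivial when [b <= a + 1].  An arc from the
    puncture to a boundary vertex is homotopic to the segment
    ([radial_homotopic]), and a loop at the puncture is trivial.  This leaves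
    [n] radial arcs and [n (n - 1)] chords.  If the ends of two lifts interlace,
    a winding number argument ([square_zero]) forces the arcs to cross.  If they
    do not, suitable standard arcs are disjoint: take segments for the radial
    arcs, and for a chord from angle [A] to angle [B] the radius
    [1 - (x - A) (B - x) / (2 pi)^2] as a function of the angle [x]; two such
    radii differ by a linear function of [x] ([std_chord_disjoint_lift]).

    Triangulation.  To a chord assign the indicator function of the boundary
    vertices that it separates from the puncture, and to the radial arc at [j]
    the function [2 - e_j], where [e_j] is the indicator function of [j].  Every
    function [h >= 0] on the [n] boundary vertices is a nonnegative combination
    of the functions of pairwise disjoint arcs, in a unique way ([clique_exists],
    [clique_unique]).  The total weight [t] of the radial arcs solves
    [sum_i (2 t - h_i)^+ = t], which has exactly one admissible solution; the
    radial weights are then [(2 t - h_i)^+].  The remaining function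
    [(h - 2 t)^+] vanishes somewhere, and it is a unique combination of the
    indicator functions of a nested family of cyclic intervals, which are
    obtained from its level sets ([nested_exists], [nested_unique]).  Rescaled
    to total mass 1, the functions of the arcs are points of the standard
    simplex of dimension [n - 1], and the simplices that they span triangulate
    it ([triangulation_pl_homeomorphic]). *)

Set Implicit Arguments.
Unset Strict Implicit.
Unset Printing Implicit Defensive.

Import Order.TTheory GRing.Theory Num.Theory.
Import numFieldNormedType.Exports.

Local Open Scope classical_set_scope.
Local Open Scope ring_scope.

(** * Triangulations of the simplex *)

Section weights.
Variables (R : realType) (B : finType).

(** Barycentric coordinates on the simplex [A], extended by zero to all of
    [B], so that coordinates on different simplices can be compared. *)
Definition weights_on (A : {set B}) (w : B -> R) : Prop :=
  [/\ forall b, 0 <= w b, forall b, b \notin A -> w b = 0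
    & \sum_b w b = 1].

Lemma weights_on_sub (A A' : {set B}) w :
  A \subset A' -> weights_on A w -> weights_on A' w.
Proof.
move=> /fintype.subsetP sAA' [w0 wA w1]; split=> // b bA'; apply: wA.
by apply: contra bA' => /sAA'.
Qed.

Lemma weights_on_supp (A A' : {set B}) w :
  weights_on A w -> (forall b, w b != 0 -> b \in A') -> weights_on A' w.
Proof.
move=> [w0 wA w1] h; split=> // b bA'; apply/eqP.
by apply: contraNT bA' => /h.
Qed.

Lemma weights_on_neq0 (A : {set B}) w : weights_on A w -> A != finset.set0.
Proof.
move=> [_ wA w1]; apply: contraPneq w1 => A0.
rewrite big1 => [/esym/eqP|b _]; first by rewrite oner_eq0.
by apply: wA; rewrite A0 inE.
Qed.

Lemma weights_on_convex (A : {set B}) (w w' : B -> R) (a : R) : 0 <= a <= 1 ->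
  weights_on A w -> weights_on A w' ->
  weights_on A (fun b => a * w b + (1 - a) * w' b).
Proof.
move=> /andP[a0 a1] [w0 wA w1] [w'0 w'A w'1]; split=> [b|b bA|].
- by rewrite addr_ge0 ?mulr_ge0 ?subr_ge0.
- by rewrite wA ?w'A ?mulr0 ?addr0.
- by rewrite big_split/= -!mulr_sumr w1 w'1 !mulr1 subrKC.
Qed.

End weights.

Section vertex_maps.
Variables (R : realType) (B : finType) (E : lmodType R).
Variables (F : {set B} -> Prop) (p : B -> E).
Hypothesis F_sub : forall A A' : {set B}, A \subset A' -> F A' -> F A.

Definition bary (w : B -> R) : E := \sum_b w b *: p b.

(** This contains both conditions on a geometric complex: each image simplex
    is affinely independent, and two of them meet in the image of their common
    face. *)
Definition unique_weights : Prop := forall A A' w w', F A -> F A' ->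
  weights_on A w -> weights_on A' w' -> bary w = bary w' -> w =1 w'.

Definition image_face (A : {set B}) : {fset E} := [fset p b | b in A]%fset.

Lemma image_face_in (A : {set B}) e :
  reflect (exists2 b, b \in A & e = p b) (e \in image_face A).
Proof. exact: imfsetP. Qed.

Lemma bary_convex (w w' : B -> R) a :
  bary (fun b => a * w b + (1 - a) * w' b) = a *: bary w + (1 - a) *: bary w'.
Proof.
rewrite /bary !scaler_sumr -big_split/=; apply: eq_bigr => b _.
by rewrite scalerDl !scalerA.
Qed.

Hypothesis p_inj : injective p.

Lemma mem_image_face (A : {set B}) b : (p b \in image_face A) = (b \in A).
Proof.
by apply/image_face_in/idP => [[b' b'A /p_inj ->//]|bA]; exists b.
Qed.

Lemma image_face_sum (M : nmodType) (A : {set B}) (f : E -> M) :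
  \sum_(e <- image_face A) f e = \sum_(b in A) f (p b).
Proof.
rewrite /image_face big_imfset/=; last by move=> x y _ _; apply: p_inj.
by rewrite big_enum.
Qed.

Lemma hull_image_face (A : {set B}) :
  convex_hull (image_face A) = [set bary w | w in weights_on A].
Proof.
apply/seteqP; split=> [x [w [w0 w1 ->]]|_ [w [w0 wA w1] <-]].
  exists (fun b => if b \in A then w (p b) else 0).
    split=> [b|b /negbTE->//|].
    - by case: ifP => // bA; apply: w0; rewrite mem_image_face.
    - by rewrite -big_mkcond/= -w1 image_face_sum.
  rewrite image_face_sum /bary [RHS]big_mkcond/=; apply: eq_bigr => b _.
  by case: ifP; rewrite // scale0r.
have wA' b : b \notin A -> w b *: p b = 0 by move=> /wA ->; rewrite scale0r.
pose v e := \sum_(b | p b == e) w b.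
have vp b : v (p b) = w b.
  by rewrite /v (big_pred1 b) // => b'; rewrite /= inj_eq.
exists v; split.
- by move=> e _; apply: sumr_ge0.
- rewrite image_face_sum -w1 [LHS]big_mkcond/=; apply: eq_bigr => b _.
  by rewrite vp; case: ifPn => // /wA.
- rewrite image_face_sum /bary [RHS]big_mkcond/=; apply: eq_bigr => b _.
  by rewrite vp; case: ifPn => // /wA'.
Qed.

Hypothesis p_uniq : unique_weights.

(** The positive and negative parts of an affine dependency, rescaled to
    total weight 1, are two systems of weights for the same point. *)
Lemma image_face_free (A : {set B}) : F A -> affinely_independent (image_face A).
Proof.
move=> FA w; rewrite !image_face_sum => w0 wp0.
pose c b := if b \in A then w (p b) else 0.
have c0 : \sum_b c b = 0 by rewrite -big_mkcond.
have cp0 : bary c = 0.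
  rewrite /bary -[RHS]wp0 [RHS]big_mkcond/=; apply: eq_bigr => b _.
  by rewrite /c; case: ifP; rewrite // scale0r.
suff c_eq0 b : c b = 0.
  by move=> e /image_face_in[b bA ->]; have := c_eq0 b; rewrite /c bA.
(* the positive and the negative part of the dependency *)
pose cp b := Num.max (c b) 0; pose cm b := Num.max (- c b) 0.
have cpm b' : c b' = cp b' - cm b'.
  rewrite /cp /cm; case: (leP (c b') 0) => h; case: (leP (- c b') 0) => h'; lra.
have cp_ge0 b' : 0 <= cp b' by rewrite le_max lexx orbT.
have cm_ge0 b' : 0 <= cm b' by rewrite le_max lexx orbT.
pose M := \sum_b cp b.
have M' : \sum_b cm b = M.
  apply/esym/eqP; rewrite -subr_eq0 /M -sumrB -[X in _ == X]c0; apply/eqP.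
  by apply: eq_bigr => b' _; rewrite cpm.
have [M0|M0] := eqVneq M 0.
  have h0 : cp b = 0 by apply: (psumr_eq0P (P := xpredT)) => //.
  have h1 : cm b = 0 by apply: (psumr_eq0P (P := xpredT)) => //; rewrite M' M0.
  by rewrite cpm h0 h1 subr0.
have Mp : 0 < M by rewrite lt_def M0 sumr_ge0.
have wts (f : B -> R) : (forall b, 0 <= f b) -> (forall b, b \notin A -> f b = 0) ->
    \sum_b f b = M -> weights_on A (fun b => f b / M).
  move=> f0 fA fM; split=> [b'|b' b'A|]; first by rewrite divr_ge0 // ltW.
    by rewrite fA // mul0r.
  by rewrite -mulr_suml fM divff.
have cA b' : b' \notin A -> c b' = 0 by rewrite /c => /negbTE ->.
have wcp : weights_on A (fun b => cp b / M).
  by apply: wts => // b' /cA; rewrite /cp => ->; rewrite maxxx.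
have wcm : weights_on A (fun b => cm b / M).
  by apply: wts => // b' /cA; rewrite /cm => ->; rewrite oppr0 maxxx.
have e : (fun b => cp b / M) =1 (fun b => cm b / M).
  apply: (p_uniq FA FA wcp wcm).
  apply/eqP; rewrite -subr_eq0 /bary -sumrB; apply/eqP.
  transitivity (M^-1 *: bary c); last by rewrite cp0 scaler0.
  rewrite /bary scaler_sumr; apply: eq_bigr => b' _.
  by rewrite -scalerBl -mulrBl -cpm scalerA mulrC.
by rewrite cpm; have /(mulIf (invr_neq0 M0)) -> := e b; rewrite subrr.
Qed.

(** A common point has the same weights in both simplices, so the support of
    these weights lies in both. *)
Lemma image_face_cap (A A' : {set B}) : F A -> F A' ->
  convex_hull (image_face A) `&` convex_hull (image_face A') =
  convex_hull (image_face A `&` image_face A')%fset.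
Proof.
move=> FA FA'.
have -> : (image_face A `&` image_face A')%fset = image_face (A :&: A').
  apply/fsetP => e; rewrite in_fsetI; apply/andP/idP.
    case=> /image_face_in[b bA ->]; rewrite !mem_image_face => bA'.
    by rewrite !inE bA.
  by case/image_face_in => b; rewrite !inE => /andP[bA bA'] ->; rewrite !mem_image_face.
rewrite !hull_image_face; apply/seteqP; split.
  move=> _ [[w wA <-]] [w' wA' e].
  have ww' : w' =1 w := p_uniq FA' FA wA' wA e.
  exists w => //; apply: (weights_on_supp wA) => b wb0; rewrite inE.
  apply/andP; split; apply: contraT => h; case/eqP: wb0.
    by case: wA => _ + _; apply.
  by rewrite -ww'; case: wA' => _ + _; apply.
by move=> _ [w wA <-]; split; exists w => //; apply: weights_on_sub wA;
  rewrite ?subsetIl ?subsetIr.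
Qed.

Definition image_faces : set {fset E} :=
  [set s | exists A, [/\ A != finset.set0, F A & s = image_face A]].

Lemma image_faces_neq0 s : image_faces s -> s != fset0.
Proof.
move=> [A [/finset.set0Pn[b bA] _ ->]].
by apply/fset0Pn; exists (p b); rewrite mem_image_face.
Qed.

Lemma image_faces_sub s t :
  image_faces s -> t != fset0 -> (t `<=` s)%fset -> image_faces t.
Proof.
move=> [A [A0 FA ->]] t0 /fsubsetP ts.
have te : t = image_face [set b in A | p b \in t].
  apply/fsetP => e; apply/idP/image_face_in.
    move=> et; have /image_face_in[b bA eE] := ts _ et.
    by exists b => //; rewrite inE bA -eE.
  by case=> b; rewrite inE => /andP[_ bt] ->.
exists [set b in A | p b \in t]; split => //.
  case/fset0Pn: t0 => e; rewrite {1}te => /image_face_in[b bA _].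
  by apply/finset.set0Pn; exists b.
by apply: F_sub FA; apply/fintype.subsetP => b; rewrite inE => /andP[].
Qed.

Definition image_complex : simplicial_complex E :=
  SimplicialComplex image_faces_neq0 image_faces_sub.

Lemma image_complex_geometric : geometric_complex image_complex.
Proof.
split=> [_ [A [_ FA ->]]|_ _ [A [_ FA ->]] [A' [_ FA' ->]]].
  exact: image_face_free.
exact: image_face_cap.
Qed.

End vertex_maps.

(** A vertex is the image of the weight concentrated on it. *)
Lemma unique_inj (R : realType) (B : finType) (E : lmodType R)
    (F : {set B} -> Prop) (p : B -> E) :
  (forall b, F [set b]%SET) -> unique_weights F p -> injective p.
Proof.
move=> F1 pu b b' pbb'.
pose dl (c : B) : B -> R := fun x => (x == c)%:R.
have dlw c : weights_on [set c]%SET (dl c).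
  split=> [x|x|]; first by rewrite ler0n.
    by rewrite inE /dl => /negbTE ->.
  rewrite /dl (bigD1 c)//= eqxx big1 ?addr0 // => x xc.
  by rewrite (negbTE xc).
have dlp c : bary p (dl c) = p c.
  rewrite /bary (bigD1 c)//= /dl eqxx scale1r big1 ?addr0 // => x xc.
  by rewrite (negbTE xc) scale0r.
have := pu _ _ _ _ (F1 b) (F1 b') (dlw b) (dlw b').
rewrite !dlp => /(_ pbb' b); rewrite /dl eqxx.
by case: eqVneq => // _ /eqP; rewrite oner_eq0.
Qed.

Lemma bary_eval (R : realType) (B : finType) (T : Type) (p : B -> (T -> R^o))
    w t :
  bary p w t = \sum_b w b * p b t.
Proof. by rewrite /bary fct_sumE. Qed.

Lemma subdivides_faces (R : realType) (E : lmodType R)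
    (G : simplicial_complex E) :
  geometric_complex G -> subdivides G (faces G).
Proof.
move=> gG; split=> // [t Gt|s Gs]; first by exists t.
exists [fset s]%fset; split=> [t|]; first by rewrite inE => /eqP ->.
apply/seteqP; split=> [x sx|x [t]]; first by exists s => //=; rewrite inE.
by rewrite /= inE => /eqP ->.
Qed.

Section labelled_complex.
Variables (R : realType) (V : choiceType) (K : simplicial_complex V).
Variables (B : finType) (F : {set B} -> Prop) (cls : B -> V).
Hypothesis F_sub : forall A A' : {set B}, A \subset A' -> F A' -> F A.
Hypothesis cls_inj : injective cls.
Hypothesis K_faces : forall s, faces K s <->
  exists A, [/\ A != finset.set0, F A & s = [fset cls b | b in A]%fset].

Definition vtx (b : B) : V -> R^o := vertex_point R (cls b).

Lemma bary_vtx w b : bary vtx w (cls b) = w b.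
Proof.
rewrite bary_eval (bigD1 b)//= big1 ?addr0 => [|b' b'b].
  by rewrite /vtx /vertex_point eqxx mulr1.
by rewrite /vtx /vertex_point inj_eq // eq_sym (negbTE b'b) mulr0.
Qed.

Lemma vtx_uniq : unique_weights F vtx.
Proof. by move=> A A' w w' _ _ _ _ E b; rewrite -(bary_vtx w) E bary_vtx. Qed.

Lemma vtx_inj : injective vtx.
Proof.
move=> b b' /(congr1 (fun f => f (cls b))); rewrite /vtx /vertex_point eqxx.
by case: eqVneq => [/cls_inj //|_ /eqP]; rewrite oner_eq0.
Qed.

Lemma realizationE : realization K = image_faces F vtx.
Proof.
have cE (A : {set B}) : [fset vertex_point R v | v in [fset cls b | b in A]]%fset =
    image_face vtx A.
  apply/fsetP => x; apply/imfsetP/image_face_in.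
    by case=> /= v /imfsetP[/= b bA ->] ->; exists b.
  by case=> b bA ->; exists (cls b) => //; apply/imfsetP; exists b.
apply/seteqP; split=> [_ [s /K_faces[A [A0 FA ->]] <-]|_ [A [A0 FA ->]]].
  by exists A; split=> //; rewrite cE.
exists ([fset cls b | b in A]%fset); last by rewrite cE.
by apply/K_faces; exists A.
Qed.

Lemma underlyingE x : underlying_space (R := R) K x <->
  exists A w, [/\ F A, weights_on A w & bary vtx w = x].
Proof.
have vi := vtx_inj; rewrite /underlying_space realizationE; split.
  move=> [_ [A [_ FA ->]]]; rewrite hull_image_face // => -[w wA <-].
  by exists A, w.
move=> [A [w [FA wA <-]]]; exists (image_face vtx A).
  by exists A; split=> //; apply: weights_on_neq0 wA.
by rewrite hull_image_face //; exists w.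
Qed.

End labelled_complex.

Section triangulated_simplex.
Variables (R : realType) (V : choiceType) (K : simplicial_complex V).
Variables (B : finType) (F : {set B} -> Prop) (cls : B -> V) (d : nat).
Variable (phi : B -> ('I_d.+1 -> R^o)).
Hypothesis F_sub : forall A A' : {set B}, A \subset A' -> F A' -> F A.
Hypothesis F1 : forall b, F [set b]%SET.
Hypothesis cls_inj : injective cls.
Hypothesis K_faces : forall s, faces K s <->
  exists A, [/\ A != finset.set0, F A & s = [fset cls b | b in A]%fset].
Hypothesis phi_ge0 : forall b i, 0 <= phi b i.
Hypothesis phi_sum : forall b, \sum_i phi b i = 1.
Hypothesis phi_uniq : unique_weights F phi.
Hypothesis phi_onto : forall y : 'I_d.+1 -> R, (forall i, 0 <= y i) ->
  \sum_i y i = 1 -> exists A w, [/\ F A, weights_on A w & bary phi w = y].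

Let e : B -> V -> R^o := vtx R cls.
Let D (A : {set 'I_d.+1}) : Prop := True.
Let u : 'I_d.+1 -> 'I_d.+1 -> R^o := vtx R id.

Let simplex_faces s : faces (simplex d) s <->
  exists A, [/\ A != finset.set0, D A & s = [fset id b | b in A]%fset].
Proof.
split=> [s0|[A [/finset.set0Pn[b bA] _ ->]]].
  exists [set b in s]%SET; split=> //.
    by case/fset0Pn: s0 => b bs; apply/finset.set0Pn; exists b; rewrite inE.
  apply/fsetP => b; apply/idP/imfsetP => [bs|[/= b' + ->]].
    by exists b; rewrite //= inE.
  by rewrite inE.
by apply/fset0Pn; exists b; apply/imfsetP; exists b.
Qed.

Let bary_u w : bary u w = w.
Proof. by apply/funext => i; rewrite (bary_vtx (cls := id)). Qed.

Let simplexE y : underlying_space (R := R) (simplex d) y <->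
  (forall i, 0 <= y i) /\ \sum_i y i = 1.
Proof.
rewrite (underlyingE (@inj_id _) simplex_faces); split.
  move=> [A [w [_ [w0 _ w1] E]]].
  by have <- : w = y by rewrite -E; exact (esym (bary_u w)).
move=> [y0 y1]; exists finset.setT, y; split=> //.
by split=> // b; rewrite inE.
Qed.

Let bary_phi_simplex A w : weights_on A w ->
  underlying_space (R := R) (simplex d) (bary phi w).
Proof.
move=> [w0 _ w1]; apply/simplexE; split=> [i|].
  by rewrite bary_eval sumr_ge0 // => b _; rewrite mulr_ge0.
rewrite (eq_bigr (fun i => \sum_b w b * phi b i)); last first.
  by move=> i _; rewrite bary_eval.
rewrite exchange_big/= -[RHS]w1; apply: eq_bigr => b _.
by rewrite -mulr_sumr phi_sum mulr1.
Qed.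

Let e_inj : injective e := vtx_inj cls_inj.
Let phi_inj : injective phi := unique_inj F1 phi_uniq.
Let e_uniq : unique_weights F e := vtx_uniq (F := F) cls_inj.
Let KE x := underlyingE (R := R) cls_inj K_faces x.

Let f (x : V -> R^o) : 'I_d.+1 -> R^o := bary phi (fun b => x (cls b)).

Let decomp (y : 'I_d.+1 -> R^o) (w : B -> R) : Prop :=
  exists2 A, F A & weights_on A w /\ bary phi w = y.

Let wt (y : 'I_d.+1 -> R^o) : B -> R := xget (fun=> 0) [set w | decomp y w].

Let wtP y : underlying_space (R := R) (simplex d) y -> decomp y (wt y).
Proof.
move=> /simplexE[y0 y1]; have [A [w [FA wA wy]]] := phi_onto y0 y1.
by rewrite /wt; case: xgetP => [z _//|/(_ w) /=]; case; exists A.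
Qed.

Let wt_uniq A w : F A -> weights_on A w -> wt (bary phi w) =1 w.
Proof.
move=> FA wA; have [A' FA' [wA' E]] := wtP (bary_phi_simplex wA).
exact: phi_uniq FA' FA wA' wA E.
Qed.

Let g (y : 'I_d.+1 -> R^o) : V -> R^o := bary e (wt y).

Let bary_ext (E : lmodType R) (p : B -> E) w w' : w =1 w' -> bary p w = bary p w'.
Proof. by move=> h; apply: eq_bigr => b _; rewrite h. Qed.

Let f_bary w : f (bary e w) = bary phi w.
Proof. by apply: bary_ext => b; rewrite (bary_vtx cls_inj). Qed.

Let g_bary A w : F A -> weights_on A w -> g (bary phi w) = bary e w.
Proof. by move=> FA wA; apply: bary_ext => b; rewrite (wt_uniq FA wA). Qed.

Let f_pl : pl_map K (simplex d) f.
Proof.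
split=> [x /KE[A [w [FA wA <-]]]|].
  by rewrite -/e f_bary; apply: bary_phi_simplex wA.
exists (image_complex F_sub e_inj); split.
  rewrite (realizationE R K_faces).
  exact/subdivides_faces/image_complex_geometric.
move=> _ [A [_ FA ->]] x y a; rewrite hull_image_face //.
move=> [w wA <-] [w' wA' <-] a01.
by rewrite -bary_convex !f_bary bary_convex.
Qed.

Let g_pl : pl_map (simplex d) K g.
Proof.
split=> [y /wtP[A FA [wA _]]|]; first by apply/KE; exists A, (wt y).
exists (image_complex F_sub phi_inj); split; last first.
  move=> _ [A [_ FA ->]] x y a; rewrite hull_image_face //.
  move=> [w wA <-] [w' wA' <-] a01; rewrite -bary_convex.
  rewrite !(g_bary (A := A)) ?bary_convex //.
  exact: weights_on_convex.
have rE := realizationE R simplex_faces.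
have hull_u (S : {set 'I_d.+1}) :
    convex_hull (image_face u S) = [set y | weights_on S y].
  rewrite hull_image_face; last exact: vtx_inj.
  apply/seteqP; split=> [y [w wS <-]|y yS]; first by rewrite bary_u.
  by exists y; rewrite ?bary_u.
split; first exact: image_complex_geometric.
  move=> _ [A [A0 FA ->]]; exists (image_face u finset.setT).
    rewrite rE; exists finset.setT; split=> //.
    by apply/finset.set0Pn; exists ord0; rewrite inE.
  rewrite hull_image_face // => _ [w wA <-]; rewrite hull_u.
  have [w0 w1] := (simplexE _).1 (bary_phi_simplex wA).
  by split=> // b; rewrite inE.
move=> s; rewrite rE => -[S [S0 _ ->]].
pose inS b := [forall i, (phi b i != 0) ==> (i \in S)].
pose good (A : {set B}) := [&& A != finset.set0, `[< F A >] & [forall b in A, inS b]].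
exists [fset image_face phi A | A in [set A | good A]%SET]%fset; split.
  move=> _ /imfsetP[/= A + ->]; rewrite inE => /and3P[A0 /asboolP FA _].
  by exists A.
apply/seteqP; split=> [y|y [t]].
  rewrite hull_u => -[y0 yS y1].
  have [A FA [wA wy]] := wtP ((simplexE y).2 (conj y0 y1)).
  pose A' := [set b | wt y b != 0]%SET.
  have wA' : weights_on A' (wt y).
    by apply: weights_on_supp wA _ => b; rewrite inE.
  exists (image_face phi A').
    apply/imfsetP; exists A' => //; rewrite inE; apply/and3P; split.
    - exact: weights_on_neq0 wA'.
    - apply/asboolP; apply: F_sub FA; apply/fintype.subsetP => b.
      by rewrite inE; apply: contraR; case: wA => _ h _ /h ->.
    - apply/forall_inP => b; rewrite inE => wb; apply/forallP => i.
      apply/implyP; apply: contraR => iS.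
      have := yS _ iS; rewrite -wy bary_eval => /psumr_eq0P h.
      have [wt0 _ _] := wA.
      have /eqP := h (fun b' _ => mulr_ge0 (wt0 b') (phi_ge0 b' i)) b isT.
      by rewrite mulf_eq0 (negbTE wb).
  by rewrite hull_image_face //; exists (wt y).
move=> /imfsetP[/= A + ->]; rewrite inE => /and3P[A0 /asboolP FA /forall_inP AS].
rewrite hull_image_face // => -[w wA <-]; rewrite hull_u.
have [y0 y1] := (simplexE _).1 (bary_phi_simplex wA).
split=> // i iS; rewrite bary_eval big1 // => b _.
have [bA|/(match wA with And3 _ h _ => h b end) ->] := boolP (b \in A); last first.
  by rewrite mul0r.
have /forallP/(_ i)/implyP/contraNeq -> := AS _ bA; first by rewrite mulr0.
by [].
Qed.

(** The homeomorphism is the linear extension of [phi].  Its inverse reads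
    off the weights, and it is affine on the simplices of the image complex.
    That complex subdivides the standard simplex: since coordinates are
    nonnegative, a face of the standard simplex is covered by the image
    simplices all of whose vertices lie on it. *)
Theorem triangulation_pl_homeomorphic : pl_homeomorphic R K (simplex d).
Proof.
exists f, g; split=> //.
  by move=> x /KE[A [w [FA wA <-]]]; rewrite -/e f_bary (g_bary FA wA).
by move=> y /wtP[A FA [wA E]]; rewrite -/e f_bary.
Qed.

End triangulated_simplex.

(** * Decomposition of functions into nested tubes *)

(** Tubes stand for the proper connected vertex sets of a graph, and [bd I] for
    the set of neighbours of [tube I].  Connectedness enters only through
    [tube_connected]: a tube that meets another one and avoids its boundary lies
    in it. *)
Section tubes.
Variables (R : realType) (T B : finType).
Variables (tube bd : B -> {set T}) (compat : rel B).
Hypothesis tube_inj : injective tube.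
Hypothesis tube_neq0 : forall I, exists x, x \in tube I.
Hypothesis bd_neq0 : forall I, exists x, x \in bd I.
Hypothesis bd_tube : forall I x, x \in bd I -> x \notin tube I.
Hypothesis tube_connected : forall I J x, x \in tube I -> x \in tube J ->
  (forall y, y \in bd J -> y \notin tube I) -> tube I \subset tube J.
Hypothesis compat_sym : symmetric compat.
Hypothesis compat_nested : forall I J x, compat I J ->
  x \in tube I -> x \in tube J -> (tube I \subset tube J) || (tube J \subset tube I).
Hypothesis compat_bd : forall I J x, compat I J ->
  x \in bd I -> x \in tube J -> tube I \subset tube J.
Hypothesis ncompat_bd : forall I J, ~~ compat I J ->
  exists2 x, x \in bd I & x \in tube J.
Hypothesis component : forall (S : {set T}) x z, x \in S -> z \notin S ->
  exists I, [/\ x \in tube I, tube I \subset S & forall y, y \in bd I -> y \notin S].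

(** Consider a largest member of [N] inside [tube I] through a given point.
    If it is not [I], then by connectedness [tube I] contains a boundary point
    of it, and the member of [N] through that boundary point is larger. *)
Lemma nested_cover (N : pred B) I :
  {in N &, forall J K, compat J K} ->
  (forall i, i \in tube I -> exists J, [/\ N J, tube J \subset tube I & i \in tube J]) ->
  N I.
Proof.
move=> Nc cov; have [i0 i0I] := tube_neq0 I.
have [J0 [NJ0 J0I i0J0]] := cov _ i0I.
pose P J := [&& N J, tube J \subset tube I & i0 \in tube J].
have PJ0 : P J0 by rewrite /P NJ0 J0I.
case: (arg_maxnP (fun J => #|tube J|) PJ0) => J /and3P[NJ JI i0J] Jmax.
have [->//|IJ] := eqVneq I J.
suff : tube I \subset tube J.
  move=> sIJ; case/eqP: IJ; apply: tube_inj; apply/eqP.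
  by rewrite finset.eqEsubset sIJ.
apply: (tube_connected i0I i0J) => x xJ; apply/negP => xI.
have [K [NK KI xK]] := cov _ xI.
have JK := compat_bd (Nc _ _ NJ NK) xJ xK.
have PK : P K by rewrite /P NK KI (fintype.subsetP JK _ i0J).
have : tube J == tube K by rewrite eqEcard JK; apply: Jmax.
by move=> /eqP JKe; move: (bd_tube xJ); rewrite JKe xK.
Qed.

Definition cover (w : B -> R) (i : T) : R := \sum_I w I * (i \in tube I)%:R.

Definition nested (w : B -> R) : Prop :=
  (forall I, 0 <= w I) /\
  forall I J, w I != 0 -> w J != 0 -> compat I J.

Definition peak (u : T -> R) (I : B) : bool :=
  [forall i in tube I, [forall x in bd I, u x < u i]].

Lemma peakP u I :
  reflect (forall i x, i \in tube I -> x \in bd I -> u x < u i) (peak u I).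
Proof.
apply: (iffP forall_inP) => [h i x iI xI|h i iI].
  by have /forall_inP := h _ iI; apply.
by apply/forall_inP => x xI; apply: h.
Qed.

(** The tubes of positive weight can be recovered from the sum: they are
    those on which it is larger than everywhere on their boundary. *)
Lemma nested_peak w I : nested w -> (w I != 0) = peak (cover w) I.
Proof.
move=> [w0 wc]; apply/idP/peakP => [wI i x iI xI|pk].
  rewrite /cover (bigD1 I)//= [ltRHS](bigD1 I)//= iI (negbTE (bd_tube xI)).
  rewrite mulr0 add0r mulr1 ltr_pwDl ?lt_def ?wI ?w0 //.
  apply: ler_sum => J JI.
  have [->|wJ] := eqVneq (w J) 0; first by rewrite !mul0r.
  apply: ler_wpM2l => //; rewrite ler_nat.
  have [xJ|//] := boolP (x \in tube J).
  by rewrite (fintype.subsetP (compat_bd (wc _ _ wI wJ) xI xJ)).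
pose N := [pred J | w J != 0].
have Nc : {in N &, forall J K, compat J K} by move=> J K; rewrite !inE; apply: wc.
have sep i x : cover w x < cover w i ->
    exists J, [/\ N J, i \in tube J & x \notin tube J].
  move=> lt.
  have [/existsP[J /and3P[]]|] :=
    boolP [exists J, [&& N J, i \in tube J & x \notin tube J]]; first by exists J.
  rewrite negb_exists => /forallP no; move: lt; rewrite ltNge => /negP; case.
  apply: ler_sum => J _.
  have [->|wJ] := eqVneq (w J) 0; first by rewrite !mul0r.
  apply: ler_wpM2l => //; rewrite ler_nat.
  have [iJ|//] := boolP (i \in tube J); have [//|xJ] := boolP (x \in tube J).
  by have := no J; rewrite /N /= wJ iJ xJ.
apply: (nested_cover Nc) => i iI.
pose P J := N J && (i \in tube J).
have [x0 x0I] := bd_neq0 I.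
have [J0 [NJ0 iJ0 _]] := sep _ _ (pk _ _ iI x0I).
have PJ0 : P J0 by rewrite /P NJ0 iJ0.
case: (arg_minnP (fun J => #|tube J|) PJ0) => J /andP[NJ iJ] Jmin.
exists J; split=> //; apply: (tube_connected iJ iI) => x xI.
have [K [NK iK xK]] := sep _ _ (pk _ _ iI xI).
suff /fintype.subsetP JK : tube J \subset tube K by apply: contra xK => /JK.
have /orP[//|KJ] := compat_nested (wc _ _ NJ NK) iJ iK.
have PK : P K by rewrite /P NK iK.
have /eqP <- // : tube K == tube J by rewrite eqEcard KJ; apply: Jmin.
Qed.

(** The supports agree by [nested_peak].  By [nested_cover] every tube of the
    support has a point outside the smaller ones; the value of the sum at that
    point determines the weight of the tube from those of the larger tubes. *)
Lemma nested_unique w w' : nested w -> nested w' -> cover w =1 cover w' -> w =1 w'.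
Proof.
move=> nw nw' cE I.
have pkE J : (w J != 0) = (w' J != 0).
  rewrite !nested_peak // /peak; apply: eq_forallb_in => i _.
  by apply: eq_forallb_in => x _; rewrite !cE.
have [m] := ubnP (#|T| - #|tube I|)%N; elim: m I => // m IH I mI.
have [wI|wI] := eqVneq (w I) 0.
  by move: (pkE I); rewrite wI eqxx => /esym/negbFE/eqP ->.
pose N := [pred J | (w J != 0) && (J != I)].
have Nc : {in N &, forall J K, compat J K}.
  by move=> J K; rewrite !inE => /andP[wJ _] /andP[wK _]; apply: nw.2.
have : ~~ N I by rewrite /N /= eqxx andbF.
have [/forall_inP all|] := boolP [forall i in tube I,
    [exists J, [&& N J, tube J \subset tube I & i \in tube J]]].
  case/negP; apply: (nested_cover Nc) => i /all /existsP[J /and3P[]].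
  by move=> *; exists J.
rewrite negb_forall_in => /exists_inP[i iI]; rewrite negb_exists => /forallP no _.
have up J : J != I -> i \in tube J -> w J = w' J.
  move=> JI iJ; have [wJ|wJ] := eqVneq (w J) 0.
    by move: (pkE J); rewrite wJ eqxx => /esym/negbFE/eqP ->.
  apply: IH.
  have nJI : ~~ (tube J \subset tube I).
    by have := no J; rewrite /N /= wJ JI iJ /= andbT.
  have := compat_nested (nw.2 _ _ wJ wI) iJ iI; rewrite (negbTE nJI) /= => IJ.
  have : (#|tube I| < #|tube J|)%N by apply: proper_card; rewrite properE IJ.
  have : (#|tube J| <= #|T|)%N := max_card _.
  by move: mI; move: #|T| #|tube I| #|tube J| => a b c; lia.
have := cE i; rewrite /cover (bigD1 I)//= [in RHS](bigD1 I)//= iI !mulr1.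
rewrite (eq_bigr (fun J => w' J * (i \in tube J)%:R)) => [/addIr //|J JI].
by have [iJ|] := boolP (i \in tube J); rewrite ?mulr0 // up.
Qed.

(** Induction on the support of [u]: a component of the support receives as
    its weight the minimum of [u] on it, and this is subtracted.  No tube of the
    remaining function crosses the component, because [u] vanishes on its
    boundary. *)
Lemma nested_exists (u : T -> R) : (forall i, 0 <= u i) -> (exists z, u z = 0) ->
  exists2 w, nested w & cover w =1 u.
Proof.
move=> u0 uz; have [m] := ubnP #|[set i | u i != 0]%SET|.
elim: m u u0 uz => // m IH u u0 [z uz] mu.
pose S := [set i | u i != 0]%SET.
have [S0|[x xS]] := set_0Vmem S.
  exists (fun=> 0) => [|i]; first by split=> // I J; rewrite eqxx.
  rewrite /cover big1 => [|J _]; last by rewrite mul0r.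
  have : i \notin S by rewrite S0 inE.
  by rewrite inE negbK => /eqP ->.
have zS : z \notin S by rewrite inE uz eqxx.
have [I [xI IS bdS]] := component xS zS.
case: (arg_minP u xI) => x0 x0I' x0min.
have x0I : x0 \in tube I := x0I'.
have ux0 : 0 < u x0.
  by have := fintype.subsetP IS _ x0I; rewrite inE lt_def u0 andbT.
pose u' i := u i - u x0 * (i \in tube I)%:R.
have u'0 i : 0 <= u' i.
  by rewrite /u'; have [iI|_] := boolP (i \in tube I); rewrite ?mulr1 ?mulr0 subr_ge0 // x0min.
have u'S i : u' i != 0 -> i \in S.
  rewrite /u'; have [iI|_] := boolP (i \in tube I); first by move: (fintype.subsetP IS _ iI).
  by rewrite mulr0 subr0 inE.
have zI : z \notin tube I by apply: contra zS; apply: (fintype.subsetP IS).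
have [||w [w0 wc] wu] := IH _ u'0.
- by exists z; rewrite /u' uz (negbTE zI) mulr0 subrr.
- apply: leq_trans (_ : #|S| <= _)%N; last by rewrite -ltnS.
  apply: proper_card; rewrite properE; apply/andP; split.
    by apply/fintype.subsetP => i; rewrite inE; apply: u'S.
  apply/fintype.subsetPn; exists x0; first exact: (fintype.subsetP IS).
  by rewrite inE /u' x0I mulr1 subrr eqxx.
have wI J : w J != 0 -> compat I J.
  move=> wJ; apply: contraT => /ncompat_bd[y yI yJ].
  have : y \in S.
    apply: u'S; rewrite -wu; apply: lt0r_neq0; rewrite /cover (bigD1 J)//= yJ mulr1.
    rewrite ltr_pwDl ?lt_def ?wJ ?w0 // sumr_ge0 // => K _.
    by rewrite mulr_ge0.
  by rewrite (negbTE (bdS _ yI)).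
exists (fun J => w J + u x0 * (J == I)%:R); first split=> [J|J K].
- by rewrite addr_ge0 // mulr_ge0 // ltW.
- have cII : compat I I.
    by apply: contraT => /ncompat_bd[y /bd_tube /negP].
  have [->|JI] := eqVneq J I; have [->|KI] := eqVneq K I => //;
    rewrite ?mulr0 ?addr0 // => wJ wK.
  + exact: wI.
  + by rewrite compat_sym; apply: wI.
  + exact: wc.
move=> i; rewrite /cover.
under eq_bigr do rewrite mulrDl.
rewrite big_split/= [X in X + _]wu (bigD1 I)//= eqxx mulr1 big1 => [|J JI].
  by rewrite addr0 /u' subrK.
by rewrite (negbTE JI) mulr0 mul0r.
Qed.

Variable t0 : T.

Definition rcompat (c c' : T + B) : bool :=
  match c, c' with
  | inl _, inl _ => true
  | inl j, inr K => j \notin tube K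
  | inr K, inl j => j \notin tube K
  | inr K, inr J => compat K J
  end.

(** With 1 in place of 2, the radial arc at [j] and the loop based at [j] would
    get the same vector. *)
Definition vec (c : T + B) (i : T) : R :=
  match c with
  | inl j => 2 - (i == j)%:R
  | inr K => (i \in tube K)%:R
  end.

Definition comb (w : T + B -> R) (i : T) : R := \sum_c w c * vec c i.

Definition clique (w : T + B -> R) : Prop :=
  (forall c, 0 <= w c) /\
  forall c c', w c != 0 -> w c' != 0 -> rcompat c c'.

(** The sum of all radial weights enters every coordinate, with the factor 2
    of [vec]. *)
Lemma comb_split w i : comb w i =
  2 * \sum_j w (inl j) - w (inl i) + cover (w \o inr) i.
Proof.
rewrite /comb big_sumType/= /cover; congr (_ + _).
rewrite (eq_bigr (fun j => 2 * w (inl j) - w (inl j) * (i == j)%:R)); last first.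
  by move=> j _; ring.
rewrite sumrB -mulr_sumr; congr (_ - _).
rewrite (bigD1 i)//= eqxx mulr1 big1 ?addr0 // => j ji.
by rewrite eq_sym (negbTE ji) mulr0.
Qed.

Lemma clique_nested w : clique w -> nested (w \o inr).
Proof. by move=> [w0 wc]; split=> [I|I J] /=; [|apply: wc]. Qed.

Lemma cover_ge0 v i : (forall I, 0 <= v I) -> 0 <= cover v i.
Proof. by move=> v0; apply: sumr_ge0 => I _; rewrite mulr_ge0. Qed.

Lemma cover_gt0 v I i : (forall I, 0 <= v I) -> v I != 0 -> i \in tube I ->
  0 < cover v i.
Proof.
move=> v0 vI iI; rewrite /cover (bigD1 I)//= iI mulr1.
by rewrite ltr_pwDl ?lt_def ?vI ?v0 // sumr_ge0 // => K _; rewrite mulr_ge0.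
Qed.

(** A boundary point of a largest tube of positive weight lies in no
    tube of positive weight. *)
Lemma nested_uncovered v : nested v -> exists j, cover v j = 0.
Proof.
move=> [v0 vc]; have [/existsP[I0 vI0]|] := boolP [exists I, v I != 0]; last first.
  rewrite negb_exists => /forallP all0; exists t0.
  by rewrite /cover big1 // => I _; move/negPn/eqP: (all0 I) => ->; rewrite mul0r.
case: (arg_maxnP (P := fun I => v I != 0) (fun I => #|tube I|) vI0) => I vI Imax.
have [x xI] := bd_neq0 I; exists x; rewrite /cover big1 // => J _.
have [->|vJ] := eqVneq (v J) 0; first by rewrite mul0r.
have [xJ|] := boolP (x \in tube J); last by rewrite mulr0.
have IJ := compat_bd (vc _ _ vI vJ) xI xJ.
have : tube I == tube J by rewrite eqEcard IJ; apply: Imax.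
by move=> /eqP IJe; move: (bd_tube xI); rewrite IJe xJ.
Qed.

(** The total radial weight which is needed to reach [h] from the level [2 * t]
    where [h] is smaller; see [clique_parts]. *)
Definition excess (h : T -> R) (t : R) : R := \sum_i Num.max (2 * t - h i) 0.

(** No tube of positive weight contains a point with positive radial weight,
    so the radial weights and the tubes account for the negative and the
    positive part of the same difference. *)
Lemma clique_parts w : clique w ->
  let t := \sum_j w (inl j) in
  (forall i, w (inl i) = Num.max (2 * t - comb w i) 0) /\
  (forall i, cover (w \o inr) i = Num.max (comb w i - 2 * t) 0).
Proof.
move=> cw t; have [w0 wc] := cw.
have cov0 i : 0 <= cover (w \o inr) i by apply: cover_ge0 => I /=.
have dis i : w (inl i) != 0 -> cover (w \o inr) i = 0.
  move=> wi; rewrite /cover big1 // => I _ /=.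
  have [->|wI] := eqVneq (w (inr I)) 0; first by rewrite mul0r.
  by rewrite (negbTE (wc _ _ wi wI)) mulr0.
have E i := comb_split w i.
split=> i; have := E i; rewrite -/t; have := cov0 i; have := w0 (inl i);
  have [->|/dis ->] := eqVneq (w (inl i)) 0 => // ? ? ->;
  by case: leP => ?; lra.
Qed.

(** When [t] grows, the term at [j] grows twice as fast, and no term
    decreases. *)
Lemma excess_unique (h : T -> R) t t' j : t < t' -> 0 <= 2 * t - h j ->
  excess h t = t -> excess h t' = t' -> False.
Proof.
move=> tt' hj; rewrite /excess !(bigD1 j (P := xpredT))//=.
rewrite (max_l hj) max_l; last lra.
have : \sum_(i | i != j) Num.max (2 * t - h i) 0 <=
       \sum_(i | i != j) Num.max (2 * t' - h i) 0.
  apply: ler_sum => i _; rewrite ge_max !le_max lexx orbT andbT; apply/orP; left.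
  lra.
lra.
Qed.

(** Intermediate values: the excess is 0 at half the minimum of [h], and it
    is at least [h t0] at [h t0], where the term at [t0] alone has that size. *)
Lemma excess_exists (h : T -> R) : (forall i, 0 <= h i) ->
  exists t, [/\ 0 <= t, excess h t = t & exists j, 0 <= 2 * t - h j].
Proof.
move=> h0; case: (arg_minP (P := xpredT) (i0 := t0) h isT) => j _ jmin.
have exS : excess h (h j / 2) = 0.
  rewrite /excess big1 // => i _; apply: max_r.
  by have := jmin i isT; lra.
have ext : h t0 <= excess h (h t0).
  rewrite /excess (bigD1 t0)//= -[leLHS]addr0 lerD //.
    by rewrite le_max; apply/orP; left; lra.
  by apply: sumr_ge0 => i _; rewrite le_max lexx orbT.
have hjt : h j / 2 <= h t0 by have := jmin t0 isT; have := h0 t0; have := h0 j; lra.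
have [||t] := @IVT R (fun t => excess h t - t) _ _ 0 hjt.
- apply: continuous_subspaceT => t; rewrite /excess.
  apply: cvgB; last exact: cvg_id.
  apply: cvg_big => [|i _]; first exact: add_continuous.
  have -> : (fun x => Num.max (2 * x - h i) 0) =
      (fun x => (2 * x - h i + `|2 * x - h i|) / 2).
    by apply/funext => x; case: leP; case: ler0P; lra.
  have -> : Num.max (2 * t - h i) 0 = (2 * t - h i + `|2 * t - h i|) / 2.
    by case: leP; case: ler0P; lra.
  apply: cvgMl; apply: cvgD; last apply: cvg_norm.
    by apply: cvgB; [apply: cvgMr; exact: cvg_id|exact: cvg_cst].
  by apply: cvgB; [apply: cvgMr; exact: cvg_id|exact: cvg_cst].
- rewrite exS ge_min le_max; apply/andP; split.
    by apply/orP; left; have := h0 j; lra.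
  by apply/orP; right; lra.
rewrite in_itv/= => /andP[tj _] tE; exists t; split; last exists j; last lra.
  by have := h0 j; lra.
lra.
Qed.

Lemma clique_unique w w' : clique w -> clique w' -> comb w =1 comb w' -> w =1 w'.
Proof.
move=> cw cw' E.
pose t := \sum_j w (inl j); pose t' := \sum_j w' (inl j).
have [wl wr] := clique_parts cw; have [w'l w'r] := clique_parts cw'.
have ex v (cv : clique v) : excess (comb v) (\sum_j v (inl j)) = \sum_j v (inl j).
  by rewrite /excess; apply: eq_bigr => i _; rewrite -(clique_parts cv).1.
have un v (cv : clique v) : exists j, 0 <= 2 * (\sum_j v (inl j)) - comb v j.
  have [j jE] := nested_uncovered (clique_nested cv); exists j.
  by rewrite comb_split jE; have := cv.1 (inl j); lra.
have exE s : excess (comb w') s = excess (comb w) s.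
  by apply: eq_bigr => i _; rewrite E.
have tt' : t = t'.
  apply/eqP; case: ltgtP => // lt.
    have [j jw] := un _ cw.
    by case: (excess_unique lt jw (ex _ cw)); rewrite -exE; apply: ex.
  have [j jw] := un _ cw'.
  by case: (excess_unique lt jw (ex _ cw')); rewrite exE; apply: ex.
have wr' : w \o inr =1 w' \o inr.
  apply: nested_unique; [exact: clique_nested..|].
  by move=> i; rewrite wr w'r E -/t -/t' tt'.
case=> [i|I]; last exact: wr'.
by rewrite wl w'l E -/t -/t' tt'.
Qed.

Lemma clique_exists (h : T -> R) : (forall i, 0 <= h i) ->
  exists2 w, clique w & comb w =1 h.
Proof.
move=> h0; have [t [tge0 tE [j jt]]] := excess_exists h0.
have [||v nv vE] := nested_exists (u := fun i => Num.max (h i - 2 * t) 0).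
- by move=> i; rewrite le_max lexx orbT.
- by exists j; apply: max_r; lra.
pose w c := match c with inl i => Num.max (2 * t - h i) 0 | inr K => v K end.
have dis i I : w (inl i) != 0 -> v I != 0 -> i \notin tube I.
  move=> wi vI; apply: contra_neqN wi => /(cover_gt0 nv.1 vI).
  rewrite vE => hp; apply: max_r; move: hp.
  by case: (leP (h i - _)); rewrite ?ltxx //; lra.
exists w; first split=> [[i|I]|[i|I] [i'|I']] //=.
- by rewrite le_max lexx orbT.
- exact: nv.1.
- exact: dis.
- by move=> vI wi; apply: dis.
- exact: nv.2.
move=> i; rewrite comb_split (_ : cover _ _ = cover v i) // vE /=.
by rewrite -/(excess h t) tE; case: (leP (2 * t - _)); case: (leP (h i - _)); lra.
Qed.

Definition mass (c : T + B) : R := \sum_i vec c i.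

Definition ray (c : T + B) : T -> R^o := fun i => vec c i / mass c.

Lemma vec_ge0 c i : 0 <= vec c i.
Proof. by case: c => [j|I] /=; [case: (_ == _)|case: (_ \in _)] => /=; lra. Qed.

Lemma mass_gt0 c : 0 < mass c.
Proof.
rewrite lt_def sumr_ge0 => [|i _]; last exact: vec_ge0.
rewrite andbT; apply/negP => /eqP/psumr_eq0P/= h.
have {}h i : vec c i = 0 by apply: h => // j _; apply: vec_ge0.
case: c h => [j|I] /= h; first by have := h j; rewrite eqxx /=; lra.
by have [x xI] := tube_neq0 I; have := h x; rewrite xI /=; lra.
Qed.

Lemma ray_ge0 c i : 0 <= ray c i.
Proof. by rewrite divr_ge0 ?vec_ge0 // ltW // mass_gt0. Qed.

Lemma ray_sum c : \sum_i ray c i = 1.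
Proof. by rewrite -mulr_suml divff // gt_eqF // mass_gt0. Qed.

Definition face (A : {set T + B}) : Prop :=
  forall c c', c \in A -> c' \in A -> rcompat c c'.

Lemma weights_clique A (w : T + B -> R) : face A -> weights_on A w ->
  clique (fun c => w c / mass c).
Proof.
move=> FA [w0 wA _]; split=> [c|c c'].
  by rewrite divr_ge0 // ltW // mass_gt0.
rewrite !mulf_eq0 !negb_or => /andP[wc _] /andP[wc' _]; apply: FA.
  by apply: contraNT wc => /wA ->.
by apply: contraNT wc' => /wA ->.
Qed.

Lemma bary_ray w i : bary ray w i = comb (fun c => w c / mass c) i.
Proof. by rewrite bary_eval; apply: eq_bigr => c _; rewrite /ray mulrA mulrAC. Qed.

Lemma ray_uniq : unique_weights face ray.
Proof.
move=> A A' w w' FA FA' wA wA' E c.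
have := clique_unique (weights_clique FA wA) (weights_clique FA' wA').
have EE : comb (fun c => w c / mass c) =1 comb (fun c => w' c / mass c).
  by move=> i; rewrite -!bary_ray E.
by move=> /(_ EE c)/(mulIf (invr_neq0 (lt0r_neq0 (mass_gt0 c)))).
Qed.

Lemma ray_onto (y : T -> R) : (forall i, 0 <= y i) -> \sum_i y i = 1 ->
  exists A w, [/\ face A, weights_on A w & bary ray w = y].
Proof.
move=> y0 y1; have [W [W0 Wc] WE] := clique_exists y0.
have m0 c : mass c != 0 by rewrite lt0r_neq0 // mass_gt0.
exists [set c | W c != 0]%SET, (fun c => W c * mass c); split.
- by move=> c c'; rewrite !inE; apply: Wc.
- split=> [c|c|]; first by rewrite mulr_ge0 // ltW // mass_gt0.
    by rewrite inE negbK => /eqP ->; rewrite mul0r.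
  rewrite -y1; under [RHS]eq_bigr do rewrite -WE.
  rewrite exchange_big/=; apply: eq_bigr => c _.
  by rewrite mulr_sumr.
- apply/funext => i; rewrite bary_ray -WE; apply: eq_bigr => c _.
  by rewrite mulfK.
Qed.

Lemma face_sub (A A' : {set T + B}) : A \subset A' -> face A' -> face A.
Proof. by move=> /fintype.subsetP AA' FA' c c' /AA' ? /AA' ?; apply: FA'. Qed.

Lemma face1 c : face [set c]%SET.
Proof.
move=> b b'; rewrite !inE => /eqP -> /eqP ->; case: c => //= I.
by apply: contraT => /ncompat_bd[y /bd_tube /negP].
Qed.

End tubes.

(** * Intervals of a cycle *)

Section cyclic_intervals.
Variable d : nat.
Local Notation n := d.+1.
Local Open Scope nat_scope.

Local Notation chord_code := ('I_n * 'I_d)%type.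

(** A code stands for the chord that runs counterclockwise from the vertex
    [from c] to the vertex [upto c].  The latter is not reduced modulo [n].  The
    difference is at least 2, because it would be 1 for an edge, and it is [n]
    for a loop around the puncture. *)
Definition from (c : chord_code) : nat := c.1.
Definition upto (c : chord_code) : nat := c.1 + c.2.+2.

Definition interlaced (a b c e : nat) : bool := (a < c) && (c < b) && (b < e).

Definition inside (c : chord_code) : {set 'I_n} :=
  [set i : 'I_n | (from c < i < upto c) || (from c < i + n < upto c)]%SET.

Definition ends (c : chord_code) : {set 'I_n} :=
  [set i : 'I_n | [|| i == from c :> nat, i == upto c :> nat | i + n == upto c]]%SET.

(** All lifts of two chords to the line are compared.  Both start in [0, n)
    and have length at most [n], so shifts by more than [n] cannot interlace. *)
Definition noncrossing (x y : chord_code) : bool :=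
  ~~ [|| interlaced (from x) (upto x) (from y) (upto y),
         interlaced (from y) (upto y) (from x) (upto x),
         interlaced (from x + n) (upto x + n) (from y) (upto y),
         interlaced (from y) (upto y) (from x + n) (upto x + n),
         interlaced (from x) (upto x) (from y + n) (upto y + n)
       | interlaced (from y + n) (upto y + n) (from x) (upto x)].

Lemma code_bounds c : from c < n /\ (from c).+2 <= upto c <= from c + n.
Proof. by rewrite /from /upto; have := ltn_ord c.1; have := ltn_ord c.2; lia. Qed.

Lemma upto_ord c : exists i : 'I_n, (i == upto c :> nat) || (i + n == upto c).
Proof.
have [h1 h2] := code_bounds c.
have [lt|ge] := ltnP (upto c) n; first by exists (Ordinal lt); rewrite /= eqxx.
have lt : upto c - n < n by lia.
by exists (Ordinal lt) => /=; rewrite subnK // eqxx orbT.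
Qed.

Lemma inside_neq0 c : exists x, x \in inside c.
Proof.
have [h1 h2] := code_bounds c.
have [lt|ge] := ltnP (from c).+1 n.
  by exists (Ordinal lt); rewrite inE /=; lia.
by exists ord0; rewrite inE /=; lia.
Qed.

Lemma ends_neq0 c : exists x, x \in ends c.
Proof. by exists c.1; rewrite inE eqxx. Qed.

Lemma ends_inside c x : x \in ends c -> x \notin inside c.
Proof.
by rewrite !inE; have := code_bounds c; have := ltn_ord x; lia.
Qed.

Lemma inside_inj : injective inside.
Proof.
move=> c c' /setP E.
have [h1 h2] := code_bounds c; have [h1' h2'] := code_bounds c'.
have [x xc] := inside_neq0 c; have lx := ltn_ord x.
have xc' : x \in inside c' by rewrite -E.
have e1 : from c = from c'.
  have := E c'.1; have := ends_inside (x := c'.1) (c := c').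
  have := E c.1; have := ends_inside (x := c.1) (c := c).
  move: xc xc'; rewrite !inE -/(from c) -/(from c') !eqxx /=.
  case/orP=> hx; case/orP => hx' /(_ isT)/negbTE -> /esym/negbT u;
  by move=> /(_ isT)/negbTE -> /negbT v; lia.
have e2 : upto c = upto c'.
  have [b bE] := upto_ord c; have [b' bE'] := upto_ord c'.
  have := E b'; have := ends_inside (x := b') (c := c').
  have := E b; have := ends_inside (x := b) (c := c).
  have := ltn_ord b; have := ltn_ord b' => lb lb'.
  rewrite !inE bE bE' !orbT => /(_ isT)/negbTE -> /esym/negbT u.
  move=> /(_ isT)/negbTE -> /negbT v; move: xc xc'; rewrite !inE.
  by case/orP: bE => /eqP bE; case/orP: bE' => /eqP bE';
    case/orP=> hx; case/orP => hx'; lia.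
move: e1 e2; rewrite /from /upto; case: (c) (c') => [j m] [j' m'] /= /val_inj ->.
by move=> /addnI [] /val_inj ->.
Qed.

(** An interval that contains a point of [inside e] and none of its two
    ends cannot leave it. *)
Lemma inside_connected c e x : x \in inside c -> x \in inside e ->
  (forall y, y \in ends e -> y \notin inside c) -> inside c \subset inside e.
Proof.
move=> xc xe h; have [b bE] := upto_ord e.
have := h b; have := h e.1; rewrite !inE eqxx bE !orbT => /(_ isT) h1 /(_ isT) h2.
have [h3 h4] := code_bounds c; have [h5 h6] := code_bounds e.
have lb := ltn_ord b; have lx := ltn_ord x.
move: h1 h2 xc xe; rewrite !inE -/(from e) => h1 h2 xc xe.
apply/fintype.subsetP => y; rewrite !inE => yc; have ly := ltn_ord y.
move: xc xe yc; case/orP: bE => /eqP bE;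
  case/orP => hx; case/orP => hx'; case/orP => hy; apply/orP;
  lia.
Qed.

Lemma noncrossing_sym : symmetric noncrossing.
Proof. by move=> x y; rewrite /noncrossing; do 6?case: (interlaced _ _ _ _). Qed.

Lemma noncrossing_ends c e x : noncrossing c e ->
  x \in ends c -> x \in inside e -> inside c \subset inside e.
Proof.
rewrite /noncrossing /interlaced !inE => nc xc xe.
have [h3 h4] := code_bounds c; have [h5 h6] := code_bounds e.
have lx := ltn_ord x.
apply/fintype.subsetP => y; rewrite !inE => yc; have ly := ltn_ord y.
move: nc; rewrite !negb_or => /and5P[n1 n2 n3 n4 /andP[n5 n6]].
move: xc xe yc; case/or3P => hx; case/orP => hx'; case/orP => hy; apply/orP; lia.
Qed.

Lemma noncrossing_nested c e x : noncrossing c e ->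
  x \in inside c -> x \in inside e ->
  (inside c \subset inside e) || (inside e \subset inside c).
Proof.
move=> nc xc xe.
have [/existsP[y /andP[yc ye]]|] := boolP [exists y, (y \in ends c) && (y \in inside e)].
  by rewrite (noncrossing_ends nc yc ye).
rewrite negb_exists => /forallP h; rewrite (inside_connected xe xc) ?orbT // => y yc.
by have := h y; rewrite yc.
Qed.

Lemma crossing_ends c e : ~~ noncrossing c e ->
  exists2 x, x \in ends c & x \in inside e.
Proof.
have [b bE] := upto_ord c.
have [h3 h4] := code_bounds c; have [h5 h6] := code_bounds e.
have [? _|h1] := boolP (c.1 \in inside e); first by exists c.1; rewrite // inE eqxx.
have [? _|h2] := boolP (b \in inside e); first by exists b; rewrite // inE bE orbT.
move: h1 h2; rewrite /noncrossing /interlaced !inE -/(from c).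
have := ltn_ord b; lia.
Qed.

(** Walk from [x] in both directions up to the first points outside [S]. *)
Lemma inside_component (S : {set 'I_n}) x z : x \in S -> z \notin S ->
  exists c, [/\ x \in inside c, inside c \subset S
    & forall y, y \in ends c -> y \notin S].
Proof.
move=> xS zS.
(* Starting from [x + n] leaves room for the search to the left. *)
pose out i := (inord (i %% n) : 'I_n) \notin S.
have outP (y : 'I_n) k : out (y + k * n) = (y \notin S).
  by rewrite /out addnC modnMDl modn_small // inord_val.
have lx := ltn_ord x; have lz := ltn_ord z.
have xz : x != z :> nat by apply: contraNneq zS => /val_inj <-.
have exa : exists i, (i < x + n) && out i.
  exists (z + 0 * n); rewrite outP zS andbT; lia.
have bda i : (i < x + n) && out i -> i <= x + n by move=> /andP[/ltnW].
case: (ex_maxnP exa bda) => a /andP[ax aout] amax.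
have exb : exists i, (x + n < i) && out i.
  exists (z + 2 * n); rewrite outP zS andbT; lia.
case: (ex_minnP exb) => b /andP[bx bout] bmin.
have xa : x < a.
  have [zx|zx] := ltnP z x.
    have := amax (z + 1 * n); rewrite outP zS andbT; lia.
  have := amax (z + 0 * n); rewrite outP zS andbT; lia.
have ba : b <= a + n.
  by apply: bmin; rewrite /out modnDr -/(out a) aout andbT; lia.
have lj : a - (n <= a) * n < n by case: (leqP n a); lia.
have lm : b - a - 2 < d by lia.
(* [a] may lie beyond [n], whereas a code starts before [n]. *)
pose c : chord_code := (Ordinal lj, Ordinal lm).
have aE : a = from c + (n <= a) * n by rewrite /c /from /=; case: (leqP n a); lia.
have bE : b = upto c + (n <= a) * n by rewrite /c /upto /=; case: (leqP n a); lia.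
have inS (y : 'I_n) k : a < y + k * n < b -> y \in S.
  move=> yk; apply: contraT; rewrite -(outP _ k) => yo.
  have [lt|gt|eq] := ltngtP (y + k * n) (x + n).
  - by have := amax (y + k * n); rewrite yo lt; lia.
  - by have := bmin (y + k * n); rewrite yo gt; lia.
  - by move: yo; rewrite eq -[n in x + n]mul1n outP xS.
have onS (y : 'I_n) k : (y + k * n == a) || (y + k * n == b) -> y \notin S.
  by rewrite -(outP _ k) => /orP[/eqP ->|/eqP ->].
exists c; split.
- by rewrite inE; case: (leqP n a) aE bE => ? /=; lia.
- apply/fintype.subsetP => y; rewrite inE; case: (leqP n a) aE bE => ? /= aE bE.
    by case/orP => h; [apply: (inS _ 1)|apply: (inS _ 2)]; lia.
  by case/orP => h; [apply: (inS _ 0)|apply: (inS _ 1)]; lia.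
- move=> y; rewrite inE; case: (leqP n a) aE bE => ? /= aE bE.
    by case/or3P => h; [apply: (onS _ 1)|apply: (onS _ 1)|apply: (onS _ 2)]; lia.
  by case/or3P => h; [apply: (onS _ 0)|apply: (onS _ 0)|apply: (onS _ 1)]; lia.
Qed.

End cyclic_intervals.

(** * Continuity, and lifting of maps to the circle *)

(** A constant, and not a notation, so that the tactic [continuity] below can
    match on the function. *)
Definition cont_at (T U : topologicalType) (f : T -> U) (x : T) : Prop :=
  f z @[z --> x] --> f x.

Section continuity.
Variables (R : realType) (T : topologicalType).
Implicit Types (f g : T -> R) (x : T).

Lemma cont_at_cst (U : topologicalType) (c : U) x : cont_at (fun _ : T => c) x.
Proof. exact: cvg_cst. Qed.

Lemma cont_at_ext (U : topologicalType) (f g : T -> U) x : f =1 g ->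
  cont_at f x -> cont_at g x.
Proof. by move=> /funext ->. Qed.

Lemma cont_atP (U : topologicalType) (f : T -> U) :
  (forall x, cont_at f x) -> continuous f.
Proof. by []. Qed.

Lemma cont_at_id x : cont_at (fun z : T => z) x.
Proof. exact: cvg_id. Qed.

Lemma cont_at_add f g x : cont_at f x -> cont_at g x ->
  cont_at (fun z => f z + g z) x.
Proof. exact: cvgD. Qed.

Lemma cont_at_opp f x : cont_at f x -> cont_at (fun z => - f z) x.
Proof. exact: cvgN. Qed.

Lemma cont_at_mul f g x : cont_at f x -> cont_at g x ->
  cont_at (fun z => f z * g z) x.
Proof. exact: cvgM. Qed.

Lemma cont_at_exp f k x : cont_at f x -> cont_at (fun z => f z ^+ k) x.
Proof.
move=> cf; elim: k => [|k IH].
  by apply: (cont_at_ext (U := R) (f := fun=> 1)) => [z|]; rewrite ?expr0 //; apply: cont_at_cst.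
apply: (cont_at_ext (U := R) (f := fun z => f z * f z ^+ k)) => [z|].
  by rewrite exprS.
exact: cont_at_mul.
Qed.

Lemma cont_at_inv f x : f x != 0 -> cont_at f x ->
  cont_at (fun z => (f z)^-1) x.
Proof. exact: cvgV. Qed.

Lemma cont_at_max f g x : cont_at f x -> cont_at g x ->
  cont_at (fun z => Num.max (f z) (g z)) x.
Proof. exact: continuous_max. Qed.

Lemma cont_at_min f g x : cont_at f x -> cont_at g x ->
  cont_at (fun z => Num.min (f z) (g z)) x.
Proof. exact: continuous_min. Qed.

Lemma cont_at_comp (U V : topologicalType) (h : U -> V) (f : T -> U) x :
  cont_at h (f x) -> cont_at f x ->
  cont_at (fun z => h (f z)) x.
Proof. by move=> ch cf; exact: (@continuous_comp _ _ _ f h). Qed.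

Lemma cont_at_pair (U V : topologicalType) (f : T -> U) (g : T -> V) x :
  cont_at f x -> cont_at g x ->
  cont_at (fun z => (f z, g z)) x.
Proof. exact: cvg_pair. Qed.

Lemma cont_at_fst (U V : topologicalType) (f : T -> U * V) x : cont_at f x ->
  cont_at (fun z => (f z).1) x.
Proof. by move=> cf; apply: (cont_at_comp (h := fst)) => //; apply: cvg_fst. Qed.

Lemma cont_at_snd (U V : topologicalType) (f : T -> U * V) x : cont_at f x ->
  cont_at (fun z => (f z).2) x.
Proof. by move=> cf; apply: (cont_at_comp (h := snd)) => //; apply: cvg_snd. Qed.

Lemma cont_at_cos f x : cont_at f x -> cont_at (fun z => cos (f z)) x.
Proof. by move=> cf; apply: (cont_at_comp (h := @cos R)) => //; apply: continuous_cos. Qed.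

Lemma cont_at_sin f x : cont_at f x -> cont_at (fun z => sin (f z)) x.
Proof. by move=> cf; apply: (cont_at_comp (h := @sin R)) => //; apply: continuous_sin. Qed.

Lemma cont_at_sqrt f x : cont_at f x -> cont_at (fun z => Num.sqrt (f z)) x.
Proof. by move=> cf; apply: (cont_at_comp (h := @Num.sqrt R)) => //; apply: sqrt_continuous. Qed.

End continuity.

Ltac continuity_step :=
  lazymatch goal with
  | |- cont_at (fun _ => ?c) _ => exact: cont_at_cst
  | |- cont_at (fun z => z) _ => exact: cont_at_id
  | |- cont_at (fun z => (@?f z, @?g z)) _ => apply: cont_at_pair
  | |- cont_at (fun z => @?f z + @?g z) _ => apply: cont_at_add
  | |- cont_at (fun z => - @?f z) _ => apply: cont_at_opp
  | |- cont_at (fun z => @?f z * @?g z) _ => apply: cont_at_mul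
  | |- cont_at (fun z => @?f z ^+ ?k) _ => apply: cont_at_exp
  | |- cont_at (fun z => Num.max (@?f z) (@?g z)) _ => apply: cont_at_max
  | |- cont_at (fun z => Num.min (@?f z) (@?g z)) _ => apply: cont_at_min
  | |- cont_at (fun z => cos (@?f z)) _ => apply: cont_at_cos
  | |- cont_at (fun z => sin (@?f z)) _ => apply: cont_at_sin
  | |- cont_at (fun z => Num.sqrt (@?f z)) _ => apply: cont_at_sqrt
  | |- cont_at (fun z => (@?f z).1) _ => apply: cont_at_fst
  | |- cont_at (fun z => (@?f z).2) _ => apply: cont_at_snd
  | |- cont_at -%R _ => exact: opp_continuous
  | |- cont_at fst _ => exact: cvg_fst
  | |- cont_at snd _ => exact: cvg_snd
  | H : continuous ?f |- cont_at ?f _ => exact: (H _)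
  | H : continuous ?f |- cont_at (fun z => ?f (@?g z)) ?x =>
      apply: (@cont_at_comp _ _ _ f g x); first exact: (H _)
  end.
Ltac continuity := repeat continuity_step.

Section clamp.
Variable R : realType.
Local Notation plane := (R * R)%type.

(** The retraction of the line onto [0, 1].  Composition with it turns a map
    that is continuous on the interval or on the square into one that is
    continuous everywhere. *)
Definition clamp (t : R) : R := Num.max 0 (Num.min t 1).
Definition clamp2 (z : plane) : plane := (clamp z.1, clamp z.2).

Lemma clamp_id t : 0 <= t <= 1 -> clamp t = t.
Proof. by move=> /andP[t0 t1]; rewrite /clamp min_l // max_r. Qed.

Lemma clamp_itv t : 0 <= clamp t <= 1.
Proof. by rewrite /clamp le_max lexx /= ge_max ler01 ge_min lexx orbT. Qed.

Lemma clamp2_id z : 0 <= z.1 <= 1 -> 0 <= z.2 <= 1 -> clamp2 z = z.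
Proof. by case: z => s t /= hs ht; rewrite /clamp2 !clamp_id. Qed.

Lemma clamp_continuous : continuous clamp.
Proof. by rewrite /clamp; apply: cont_atP => t; continuity. Qed.

Lemma clamp2_continuous : continuous clamp2.
Proof. by have cc := clamp_continuous; rewrite /clamp2; apply: cont_atP => z; continuity. Qed.

Lemma within_comp (T U V : topologicalType) (A : set T) (g : T -> U) (c : V -> T) :
  continuous c -> (forall v, A (c v)) -> {within A, continuous g} ->
  continuous (fun v => g (c v)).
Proof.
move=> cc cA /subspace_continuousP cg v W gW.
have h : nbhs v [set w | A (c w) -> W (g (c w))] := cc v _ (cg _ (cA v) W gW).
suff : nbhs v [set w | W (g (c w))] by [].
by apply: filterS h => w /= h; apply: h.
Qed.

Lemma eq_within (T U : topologicalType) (A : set T) (g h : T -> U) :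
  continuous g -> {in A, g =1 h} -> {within A, continuous h}.
Proof.
move=> cg gh; apply/subspace_continuousP => x Ax.
have gh' y : A y -> g y = h y by move=> Ay; apply: gh; rewrite inE.
rewrite /from_subspace => W; rewrite -(gh' _ Ax) => gW0.
have gW : nbhs x [set y | W (g y)] := cg x _ gW0.
suff : nbhs x [set y | A y -> W (h y)] by [].
by apply: filterS gW => y /= Wy Ay; rewrite -(gh' _ Ay).
Qed.

Lemma within_clamp (U : topologicalType) (g : R -> U) :
  {within `[0, 1], continuous g} -> continuous (fun t => g (clamp t)).
Proof.
apply: within_comp; first exact: clamp_continuous.
by move=> t; rewrite /= in_itv /= clamp_itv.
Qed.

Lemma within_clamp2 (U : topologicalType) (g : plane -> U) :
  {within `[0, 1] `*` `[0, 1], continuous g} -> continuous (fun z => g (clamp2 z)).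
Proof.
apply: within_comp; first exact: clamp2_continuous.
by move=> t; split; rewrite /= in_itv /= clamp_itv.
Qed.

End clamp.

Section circle.
Variable R : realType.
Local Notation plane := (R * R)%type.
Implicit Types a b t : R.

Lemma cos_eq1_small a : `|a| < 2 * pi -> cos a = 1 -> a = 0.
Proof.
wlog a0 : a / 0 <= a.
  move=> h; have [/h//|a0 ha ca] := leP 0 a.
  by apply/eqP; rewrite -oppr_eq0 (h (- a)) ?oppr_ge0 ?normrN ?cosN // ltW.
rewrite ger0_norm // => a2 ca; apply/eqP; case: eqVneq => // an0.
have s0 : 0 < sin (a / 2).
  by apply: sin_gt0_pi; rewrite divr_gt0 ?lt_def ?an0 //=; lra.
have : cos (a / 2 *+ 2) = 1 by rewrite -mulr_natr divfK.
rewrite cos_mulr2n cos2sin2 => h.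
have : 0 < sin (a / 2) ^+ 2 by rewrite exprn_gt0.
lra.
Qed.

Lemma cosD2pin a k : cos (a + 2 * pi * k%:R) = cos a.
Proof.
elim: k => [|k IH]; first by rewrite mulr0 addr0.
rewrite (_ : _ + _ = a + 2 * pi * k%:R + pi *+ 2) ?cosD2pi //.
by rewrite -addn1 natrD mulr2n; ring.
Qed.

Lemma sinD2pin a k : sin (a + 2 * pi * k%:R) = sin a.
Proof.
elim: k => [|k IH]; first by rewrite mulr0 addr0.
rewrite (_ : _ + _ = a + 2 * pi * k%:R + pi *+ 2) ?sinD2pi //.
by rewrite -addn1 natrD mulr2n; ring.
Qed.

Lemma cos_eq1_ge0 a : 0 <= a -> cos a = 1 -> exists k, a = 2 * pi * k%:R.
Proof.
move=> a0 ca; have p0 := pi_gt0 R.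
have pp : 0 < 2 * pi :> R by rewrite mulr_gt0.
exists (Num.truncn (a / (2 * pi))).
have := truncn_itv (divr_ge0 a0 (ltW pp)).
set k := Num.truncn _; rewrite ler_pdivlMr // ltr_pdivrMr // -(addn1 k) natrD => /andP[h1 h2].
apply/eqP; rewrite -subr_eq0; apply/eqP/cos_eq1_small.
  by rewrite ger0_norm; lra.
by rewrite -[LHS](cosD2pin _ k) subrK.
Qed.

Lemma cosB1 a b : cos a = cos b -> sin a = sin b -> cos (a - b) = 1.
Proof. by move=> c s; rewrite cosB c s -!expr2 cos2Dsin2. Qed.

Lemma cosB1P a b : cos (a - b) = 1 -> cos a = cos b /\ sin a = sin b.
Proof.
move=> c; have s : sin (a - b) = 0 by apply: cos1sin0; rewrite c normr1.
have -> : cos a = cos (a - b + b) by rewrite subrK.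
have -> : sin a = sin (a - b + b) by rewrite subrK.
by rewrite (cosD (a - b)) (sinD (a - b)) c s; split; lra.
Qed.

(** The values of [f] are multiples of [2 * pi], hence isolated. *)
Lemma cos1_constant (f : R -> R) : continuous f ->
  (forall t, 0 <= t <= 1 -> cos (f t) = 1) -> f 1 = f 0.
Proof.
move=> cf f1; have p0 := pi_gt0 R; apply/eqP; case: eqVneq => // ne.
have sm t : 0 <= t <= 1 -> `|f t - f 0| < 2 * pi -> f t = f 0.
  move=> t01 lt; apply/eqP; rewrite -subr_eq0; apply/eqP/cos_eq1_small => //.
  have c0 : cos (f 0) = 1 by rewrite f1 // lexx ler01.
  have ft := f1 _ t01.
  apply: cosB1; rewrite ?ft ?c0 //.
  by rewrite !cos1sin0 ?ft ?c0 ?normr1.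
have far : 2 * pi <= `|f 1 - f 0|.
  by rewrite leNgt; apply/negP => /sm h; rewrite h ?eqxx ?lexx ?ler01 // in ne.
have h (e : R) : `|e| = pi ->
    Num.min (f 0) (f 1) <= f 0 + e <= Num.max (f 0) (f 1) -> False.
  move=> ee he; have [t] := IVT ler01 (continuous_subspaceT cf) he.
  rewrite in_itv /= => t01 ft; have e0 : e = 0.
    have : f 0 + e = f 0; last lra.
    rewrite -ft; apply: sm => //; rewrite ft (_ : f 0 + e - f 0 = e) ?ee; last ring.
    lra.
  by move: ee; rewrite e0 normr0; lra.
exfalso; have [lt|gt] := leP (f 0) (f 1).
  apply: (h pi); first by rewrite gtr0_norm.
  by move: far; rewrite ger0_norm ?subr_ge0 // min_l // max_r //; lra.
apply: (h (- pi)); first by rewrite normrN gtr0_norm.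
have le := ltW gt; move: far.
by rewrite ler0_norm ?subr_le0 // min_r // max_l //; lra.
Qed.


Definition dot (u v : plane) : R := u.1 * v.1 + u.2 * v.2.
Definition cross (u v : plane) : R := u.1 * v.2 - u.2 * v.1.

Lemma dot_cross u v : dot u u = 1 -> dot v v = 1 ->
  dot u v ^+ 2 + cross u v ^+ 2 = 1.
Proof.
move=> uu vv; transitivity (dot u u * dot v v); last by rewrite uu vv mulr1.
by rewrite /dot /cross; ring.
Qed.

Lemma cross_lt1 u v : dot u u = 1 -> dot v v = 1 -> 0 < dot u v ->
  -1 < cross u v < 1.
Proof.
move=> uu vv d0; have := dot_cross uu vv.
have : 0 < dot u v ^+ 2 by rewrite exprn_gt0.
move: (dot u v ^+ 2) => D D0 E.
have : cross u v ^+ 2 < 1 ^+ 2 by rewrite expr1n; lra.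
by rewrite -ltr_norml -[ltLHS]real_normK ?num_real // ltr_pXn2r ?nnegrE.
Qed.

(** If the turn from one unit vector to another is less than a right angle,
    it is the arcsine of their cross product. *)
Lemma circle_point_turn (a : R) (v : plane) : dot v v = 1 ->
  0 < dot (circle_point a) v ->
  circle_point (a + asin (cross (circle_point a) v)) = v.
Proof.
move=> vv; set u := circle_point a => d0.
have uu : dot u u = 1 by rewrite /dot /u /= -!expr2 cos2Dsin2.
have /andP[c1 c2] := cross_lt1 uu vv d0.
have sa : sin (asin (cross u v)) = cross u v.
  by apply: asinK; rewrite in_itv /= !ltW.
have ca : cos (asin (cross u v)) = dot u v.
  rewrite cos_asin ?ltW // -(dot_cross uu vv) addrK sqrtr_sqr ger0_norm //.
  exact: ltW.
have [uv1 uv2] : u.1 * dot u v - u.2 * cross u v = v.1 /\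
    u.2 * dot u v + u.1 * cross u v = v.2.
  by split; [rewrite -[RHS]mul1r -uu|rewrite -[RHS]mul1r -uu]; rewrite /dot /cross; ring.
by rewrite [RHS]surjective_pairing -uv1 -uv2 {1}/circle_point cosD sinD sa ca.
Qed.

Definition square : set plane := `[0, 1] `*` `[0, 1].

(** Compactness of the square. *)
Lemma uniform_dot (F : plane -> plane) : continuous F ->
  (forall z, dot (F z) (F z) = 1) ->
  exists N : nat, forall x y, square x ->
    `|x.1 - y.1| <= N.+1%:R^-1 -> `|x.2 - y.2| <= N.+1%:R^-1 ->
    0 < dot (F x) (F y).
Proof.
move=> cF F1.
pose P (N : nat) (x : plane) := forall y : plane, `|x.1 - y.1| <= N.+1%:R^-1 ->
  `|x.2 - y.2| <= N.+1%:R^-1 -> 0 < dot (F x) (F y).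
have /compact_near_coveringP/(_ nat \oo P) : compact square.
  by apply: compact_setX; apply: segment_compact.
case=> [x Kx|N _ h]; last first.
  by exists N => x y sx; apply: (h N (leqnn N) x sx).
pose G (w : plane * plane) := dot (F w.1) (F w.2).
have cG : continuous G.
  by rewrite /G /dot; apply: cont_atP => w; continuity.
have G0 : 0 < G (x, x) by rewrite /G F1.
have /cG : nbhs (G (x, x)) [set r | 0 < r].
  by apply: open_nbhs_nbhs; split=> //; apply: open_gt.
move=> [[A B] [/= xA xB] AB].
have [e1 /= e10 e1A] := (nbhs_ballP _ _).1 xA.
have [e2 /= e20 e2B] := (nbhs_ballP _ _).1 xB.
have e0 : 0 < Num.min e1 e2 / 2 by rewrite divr_gt0 // lt_min e10.
have e12 : Num.min e1 e2 <= e1 /\ Num.min e1 e2 <= e2.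
  by rewrite !ge_min !lexx orbT.
move: (Num.min e1 e2) e0 e12 => e e0 [ee1 ee2].
exists (ball x (e / 2), [set N : nat | N.+1%:R^-1 < e / 2]).
  split=> /=; first exact: nbhsx_ballx.
  exact: (near_infty_natSinv_lt (PosNum e0)).
case=> x' N /= [[b1 b2] Ne] y y1 y2; apply: (AB (x', y)); split=> /=.
  by apply: e1A; split; rewrite /ball /=; [move: b1|move: b2]; rewrite /ball /=; lra.
apply: e2B; split; rewrite /ball /=.
  apply: (le_lt_trans (ler_distD x'.1 _ _)); apply: lt_le_trans ee2.
  by rewrite (splitr e) ltrD //; apply: le_lt_trans Ne.
apply: (le_lt_trans (ler_distD x'.2 _ _)); apply: lt_le_trans ee2.
by rewrite (splitr e) ltrD //; apply: le_lt_trans Ne.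
Qed.

(** For large [N], [F] turns by less than a right angle between the
    consecutive points [k / (N + 1) * z], so the angle at [z] is the sum of the
    turns along the segment from the origin to [z].  This sum is visibly
    continuous in [z]. *)
Theorem circle_lift (F : plane -> plane) (a0 : R) : continuous F ->
  (forall z, dot (F z) (F z) = 1) -> circle_point a0 = F (0, 0) ->
  exists th : plane -> R, [/\ continuous th, th (0, 0) = a0
    & forall z, square z -> circle_point (th z) = F z].
Proof.
move=> cF F1 Fa0; have [N FN] := uniform_dot cF F1.
pose pt (k : nat) (z : plane) : plane :=
  (k%:R / N.+1%:R * clamp z.1, k%:R / N.+1%:R * clamp z.2).
have cc := @clamp_continuous R.
have cpt k : continuous (pt k) by rewrite /pt; apply: cont_atP => z; continuity.
have frac01 k : (k <= N.+1)%N -> 0 <= (k%:R / N.+1%:R : R) <= 1.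
  by move=> kN; rewrite divr_ge0 //= ler_pdivrMr ?ltr0n // mul1r ler_nat.
have sqpt k z : (k <= N.+1)%N -> square (pt k z).
  move=> /frac01/andP[f0 f1].
  have /andP[c0 c1] := clamp_itv z.1; have /andP[c0' c1'] := clamp_itv z.2.
  by split; rewrite /= in_itv /= mulr_ge0 // mulr_ile1.
have stepdist (k : nat) c : 0 <= c <= 1 ->
    `|k%:R / N.+1%:R * c - k.+1%:R / N.+1%:R * c| <= (N.+1%:R^-1 : R).
  move=> /andP[c0 c1]; rewrite -mulrBl -mulrBl -addn1 natrD opprD addNKr.
  rewrite mulN1r mulNr normrN ger0_norm ?mulr_ge0 ?invr_ge0 //.
  by rewrite -[leRHS]mulr1 ler_wpM2l.
have step k z : (k < N.+1)%N -> 0 < dot (F (pt k z)) (F (pt k.+1 z)).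
  move=> kN; apply: FN; first by apply: sqpt; apply: ltnW.
    by apply: stepdist; apply: clamp_itv.
  by apply: stepdist; apply: clamp_itv.
exists (fun z => a0 + \sum_(i < N.+1) asin (cross (F (pt i z)) (F (pt i.+1 z)))).
have pt0 z : pt 0%N z = (0, 0) by rewrite /pt !mul0r.
have ptN z : square z -> pt N.+1 z = z.
  case: z => s t [/=]; rewrite !in_itv /= => hs ht.
  by rewrite /pt divff // !mul1r !clamp_id.
split=> [||z sz].
- have sumc i z : (i < N.+1)%N ->
      cont_at (fun z => asin (cross (F (pt i z)) (F (pt i.+1 z)))) z.
    move=> iN; apply: (cont_at_comp (h := @asin R)).
      by apply: continuous_asin; apply: cross_lt1 => //; apply: step.
    rewrite /cross; have cp := cpt i; have cp' := cpt i.+1; continuity.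
  apply: cont_atP => z; apply: cont_at_add; first exact: cont_at_cst.
  elim: {-2}N.+1 (leqnn N.+1) => [_|k IH kN].
    by apply: (cont_at_ext (U := R) (f := fun=> 0)) => [y|]; rewrite ?big_ord0 //; apply: cont_at_cst.
  apply: (cont_at_ext (U := R) (f := fun z =>
      \sum_(i < k) asin (cross (F (pt i z)) (F (pt i.+1 z)))
      + asin (cross (F (pt k z)) (F (pt k.+1 z))))) => [y|].
    by rewrite big_ord_recr.
  by apply: cont_at_add; [apply: IH; apply: ltnW|apply: sumc].
- rewrite big1 ?addr0 // => i _; rewrite /pt /= !clamp_id ?lexx ?ler01 // !mulr0.
  rewrite /cross mulrC subrr -[X in asin X]sin0 sinK // in_itv /=.
  by have := pi_gt0 R; lra.
- suff : forall k, (k <= N.+1)%N -> circle_point (a0 +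
      \sum_(i < k) asin (cross (F (pt i z)) (F (pt i.+1 z)))) = F (pt k z).
    by move=> /(_ N.+1 (leqnn _)) ->; rewrite ptN.
  elim=> [_|k IH kN]; first by rewrite big_ord0 addr0 pt0.
  rewrite big_ord_recr /= addrA.
  have {}IH := IH (ltnW kN); rewrite -IH circle_point_turn ?IH //.
  exact: step.
Qed.

End circle.

(** * Polar coordinates around the puncture *)

Section polar.
Variables (R : realType) (p : R * R).
Local Notation plane := (R * R)%type.
Hypothesis p_in : open_disk p.

(** The parameter [a] is the angle on the boundary circle, seen from the centre
    of the disk and not from [p]: so boundary vertices and edges keep their
    angles. *)
Definition polar (a l : R) : plane :=
  (l * cos a + (1 - l) * p.1, l * sin a + (1 - l) * p.2).

Definition offset (w : plane) : plane := (w.1 - p.1, w.2 - p.2).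

(** The radius [l] of [w = polar a l], as the positive root of the quadratic
    equation which says that [direction w] has norm 1. *)
Definition gauge (w : plane) : R :=
  let v := offset w in
  (dot p v + Num.sqrt (dot p v ^+ 2 + (1 - dot p p) * dot v v)) / (1 - dot p p).

Definition direction (w : plane) : plane :=
  (p.1 + (w.1 - p.1) / gauge w, p.2 + (w.2 - p.2) / gauge w).

Lemma dotpp_lt1 : dot p p < 1. Proof. by move: p_in; rewrite /open_disk /dot /= -!expr2. Qed.

Lemma dot_ge0 (v : plane) : 0 <= dot v v.
Proof. by rewrite /dot -!expr2 addr_ge0 // sqr_ge0. Qed.

Lemma offset_gt0 w : w != p -> 0 < dot (offset w) (offset w).
Proof.
move=> wp; rewrite lt_def dot_ge0 andbT; apply: contra_neq wp => /eqP.
rewrite /dot paddr_eq0 -?expr2 ?sqr_ge0 // !sqrf_eq0 !subr_eq0 /=.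
by case: w (p) => [w1 w2] [p1 p2] /= /andP[/eqP -> /eqP ->].
Qed.

Lemma dot_circle a : dot p (circle_point a) < 1.
Proof.
have pp := dotpp_lt1.
have : 0 <= dot (offset (circle_point a)) (offset (circle_point a)) := dot_ge0 _.
have := cos2Dsin2 a; rewrite /dot /= in pp *; lra.
Qed.

Lemma gauge_polar a l : 0 <= l -> gauge (polar a l) = l.
Proof.
move=> l0; rewrite /gauge; set v := offset (polar a l).
have pp := dotpp_lt1; have pe := dot_circle a; have cs := cos2Dsin2 a.
have vE : v = (l * (cos a - p.1), l * (sin a - p.2)).
  by rewrite /v /polar /offset; congr (_, _) => /=; ring.
have pv : dot p v = l * (dot p (circle_point a) - dot p p).
  by rewrite vE /dot /=; ring.
have vv : dot v v = l ^+ 2 * (1 - 2 * dot p (circle_point a) + dot p p).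
  transitivity (l ^+ 2 * ((cos a ^+ 2 + sin a ^+ 2) - 2 * dot p (circle_point a) + dot p p)).
    by rewrite vE /dot /=; ring.
  by rewrite cs.
have -> : dot p v ^+ 2 + (1 - dot p p) * dot v v =
    (l * (1 - dot p (circle_point a))) ^+ 2 by rewrite pv vv; ring.
rewrite sqrtr_sqr ger0_norm; last by rewrite mulr_ge0 // subr_ge0 ltW.
rewrite pv -mulrDr; apply/(canLR (mulfK _)); first by rewrite gt_eqF // subr_gt0.
ring.
Qed.

Lemma gauge_gt0 w : w != p -> 0 < gauge w.
Proof.
move=> wp; have pp := dotpp_lt1; rewrite /gauge; set v := offset w.
have v0 : 0 < dot v v by rewrite offset_gt0.
rewrite divr_gt0 ?subr_gt0 //.
have h : 0 < (1 - dot p p) * dot v v by rewrite mulr_gt0 ?subr_gt0.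
have : Num.sqrt (dot p v ^+ 2) < Num.sqrt (dot p v ^+ 2 + (1 - dot p p) * dot v v).
  by rewrite ltr_sqrt; [lra|apply: ltr_wpDl; rewrite ?sqr_ge0].
rewrite sqrtr_sqr; have := ler_norm (- dot p v); rewrite normrN; lra.
Qed.

Lemma gauge_eq w : gauge w ^+ 2 * (1 - dot p p) =
  2 * gauge w * dot p (offset w) + dot (offset w) (offset w).
Proof.
have pp := dotpp_lt1; rewrite /gauge; set v := offset w.
set s := Num.sqrt _.
have sE : s ^+ 2 = dot p v ^+ 2 + (1 - dot p p) * dot v v.
  rewrite sqr_sqrtr // addr_ge0 ?sqr_ge0 // mulr_ge0 ?dot_ge0 // subr_ge0 ltW //.
have u0 : 1 - dot p p != 0 by rewrite gt_eqF // subr_gt0.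
have -> : dot v v = (s ^+ 2 - dot p v ^+ 2) / (1 - dot p p).
  by rewrite sE addrAC subrr add0r mulrAC mulfV // mul1r.
field.
exact: u0.
Qed.

Lemma direction_dot w : w != p -> dot (direction w) (direction w) = 1.
Proof.
move=> wp; have g0 := gauge_gt0 wp; have := gauge_eq w.
have gn : gauge w != 0 by rewrite gt_eqF.
move=> E; apply: (mulfI (expf_neq0 2 gn)); rewrite mulr1.
transitivity (gauge w ^+ 2 * dot p p +
    (2 * gauge w * dot p (offset w) + dot (offset w) (offset w))).
  rewrite /dot /direction /=; field; exact: gn.
by rewrite -E; ring.
Qed.

Lemma directionE w : w != p ->
  w = (gauge w * (direction w).1 + (1 - gauge w) * p.1,
       gauge w * (direction w).2 + (1 - gauge w) * p.2).
Proof.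
move=> wp; have gn : gauge w != 0 by rewrite gt_eqF // gauge_gt0.
rewrite /direction /= [LHS]surjective_pairing; congr (_, _); field; exact: gn.
Qed.

Lemma gauge_le1 w : w != p -> closed_disk w -> gauge w <= 1.
Proof.
move=> wp; rewrite /closed_disk /= => w1; have g0 := gauge_gt0 wp; have E := gauge_eq w.
have pp := dotpp_lt1.
have v0 := dot_ge0 (offset w).
have q1 : 0 <= 1 - dot p p - 2 * dot p (offset w) - dot (offset w) (offset w).
  by move: w1; rewrite /dot /=; lra.
rewrite leNgt; apply/negP => g1.
have h : 0 <= gauge w * (1 - dot p p) - 2 * dot p (offset w).
  rewrite -(pmulr_rge0 _ g0).
  suff -> : gauge w * (gauge w * (1 - dot p p) - 2 * dot p (offset w)) =
     dot (offset w) (offset w) by [].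
  by move: E; rewrite expr2; lra.
have : 0 < (gauge w - 1) * ((1 - dot p p) + (gauge w * (1 - dot p p) - 2 * dot p (offset w))).
  by rewrite mulr_gt0 ?subr_gt0 // ltr_pwDl // subr_gt0.
move: E q1; rewrite expr2; lra.
Qed.

Lemma polar1 a : polar a 1 = circle_point a.
Proof. by rewrite /polar subrr !mul1r !mul0r !addr0. Qed.

Lemma polar0 a : polar a 0 = p.
Proof. by rewrite /polar subr0 !mul1r !mul0r !add0r -surjective_pairing. Qed.

Lemma polar_closed a l : 0 <= l <= 1 -> closed_disk (polar a l).
Proof.
move=> /andP[l0 l1]; rewrite /closed_disk /=.
have pp := dotpp_lt1; have pe := dot_circle a; have cs := cos2Dsin2 a.
have -> : (l * cos a + (1 - l) * p.1) ^+ 2 + (l * sin a + (1 - l) * p.2) ^+ 2 =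
  l ^+ 2 * (cos a ^+ 2 + sin a ^+ 2)
    + 2 * (l * (1 - l)) * dot p (circle_point a) + (1 - l) ^+ 2 * dot p p.
  by rewrite /dot /=; ring.
have h1 : 0 <= l * (1 - l) * (1 - dot p (circle_point a)).
  by rewrite !mulr_ge0 ?subr_ge0 // ltW.
have h2 : 0 <= (1 - l) ^+ 2 * (1 - dot p p) by rewrite mulr_ge0 ?sqr_ge0 // subr_ge0 ltW.
rewrite cs; move: h1 h2; rewrite !expr2; lra.
Qed.

Lemma polar_open a l : 0 <= l < 1 -> open_disk (polar a l).
Proof.
move=> /andP[l0 l1]; rewrite /open_disk /=.
have pp := dotpp_lt1; have pe := dot_circle a; have cs := cos2Dsin2 a.
have -> : (l * cos a + (1 - l) * p.1) ^+ 2 + (l * sin a + (1 - l) * p.2) ^+ 2 =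
  l ^+ 2 * (cos a ^+ 2 + sin a ^+ 2)
    + 2 * (l * (1 - l)) * dot p (circle_point a) + (1 - l) ^+ 2 * dot p p.
  by rewrite /dot /=; ring.
have h1 : 0 <= l * (1 - l) * (1 - dot p (circle_point a)).
  by rewrite !mulr_ge0 ?subr_ge0 // ltW.
have h2 : 0 < (1 - l) ^+ 2 * (1 - dot p p) by rewrite mulr_gt0 ?exprn_gt0 ?subr_gt0.
rewrite cs; move: h1 h2; rewrite !expr2; lra.
Qed.

Lemma circle_not_open a : ~ open_disk (circle_point a : plane).
Proof. by rewrite /open_disk /= cos2Dsin2 ltxx. Qed.

Lemma polar_inj a b l m : 0 < l -> 0 <= m -> polar a l = polar b m ->
  l = m /\ cos (a - b) = 1.
Proof.
move=> l0 m0 E; have lm : l = m by rewrite -(gauge_polar a (ltW l0)) E gauge_polar.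
have ln : l != 0 by rewrite gt_eqF.
by split=> //; move: E; rewrite -lm => -[/addIr/(mulfI ln) c /addIr/(mulfI ln) s];
  apply: cosB1.
Qed.

Lemma polar_neq a l : 0 < l -> polar a l != p.
Proof.
move=> l0; apply/eqP; rewrite -[RHS](polar0 a) => /polar_inj[] // le _.
by rewrite le ltxx in l0.
Qed.

Lemma polar_congr a b l : cos (a - b) = 1 -> polar a l = polar b l.
Proof. by move=> /cosB1P[ca sa]; rewrite /polar ca sa. Qed.

Lemma gauge_continuous : continuous gauge.
Proof.
have n0 : 1 - dot p p != 0 by have := dotpp_lt1; rewrite gt_eqF // subr_gt0.
rewrite /gauge /dot /offset; apply: cont_atP => w /=; continuity.
Qed.

Lemma direction_continuous w : w != p -> cont_at direction w.
Proof.
move=> wp; have cg := gauge_continuous; rewrite /direction.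
by apply: cont_at_pair; (apply: cont_at_add; [continuity|apply: cont_at_mul; [continuity|]]);
  apply: cont_at_inv; [rewrite gt_eqF // gauge_gt0|continuity|rewrite gt_eqF // gauge_gt0|continuity].
Qed.

Lemma polar_continuous (T : topologicalType) (f g : T -> R) :
  continuous f -> continuous g -> continuous (fun x => polar (f x) (g x)).
Proof. by move=> cf cg; rewrite /polar; apply: cont_atP => x; continuity. Qed.

(** The direction from the puncture is a map to the circle, which
    [circle_lift] lifts; the radius is a function of the point. *)
Theorem polar_lift (H : plane -> plane) (a0 l0 : R) : continuous H ->
  (forall z, square z -> closed_disk (H z) /\ H z != p) ->
  H (0, 0) = polar a0 l0 -> 0 < l0 ->
  exists th la : plane -> R, [/\ continuous th, continuous la, th (0, 0) = a0,
    forall z, square z -> 0 < la z <= 1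
    & forall z, square z -> H z = polar (th z) (la z)].
Proof.
move=> cH Hsq H0 l0p; have cc2 := @clamp2_continuous R.
have sqc z : square (clamp2 z : plane) by split; rewrite /= in_itv /= clamp_itv.
pose F z := direction (H (clamp2 z)).
have cF : continuous F.
  apply: cont_atP => z; rewrite /F; apply: (cont_at_comp (h := direction)).
    by apply: direction_continuous; apply: (Hsq _ (sqc z)).2.
  continuity.
have F1 z : dot (F z) (F z) = 1 by apply: direction_dot; apply: (Hsq _ (sqc z)).2.
have Fa0 : circle_point a0 = F (0, 0).
  rewrite /F clamp2_id /= ?lexx ?ler01 // H0.
  have gn : l0 != 0 by rewrite gt_eqF.
  rewrite /direction gauge_polar ?ltW // /polar /circle_point /=.
  by congr (_, _); field; exact: gn.
have [th [cth th0 thF]] := circle_lift cF F1 Fa0.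
exists th, (fun z => gauge (H (clamp2 z))); split=> //.
- by apply: cont_atP => z; have cg := gauge_continuous; continuity.
- move=> z _; have [h1 h2] := Hsq _ (sqc z).
  by rewrite gauge_gt0 // gauge_le1.
- move=> z [z1 z2].
  have cz : clamp2 z = z by apply: clamp2_id; move: z1 z2; rewrite /= !in_itv.
  have [_ h2] := Hsq z (conj z1 z2).
  have E := thF z (conj z1 z2).
  rewrite cz {1}(directionE h2) /polar; move: E; rewrite /F cz => <-.
  by [].
Qed.

End polar.

(** * Lifted paths and their homotopies *)

Section paths.
Variables (R : realType) (n : nat) (C : crown R n).
Local Notation plane := (R * R)%type.
Local Notation p := (puncture C).
Local Notation pin := (puncture_interior C).
Implicit Types (g h : R -> plane) (th la ps mu : R -> R).

Lemma angle_ltn j k : (j < k)%N -> angle C j < angle C k.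
Proof.
elim: k => // k IH; rewrite ltnS leq_eqVlt => /orP[/eqP ->|/IH h].
  exact: angle_lt.
exact: lt_trans h (angle_lt C k).
Qed.

Lemma angle_leq j k : (j <= k)%N -> angle C j <= angle C k.
Proof. by rewrite leq_eqVlt => /orP[/eqP ->//|/angle_ltn/ltW]. Qed.

Lemma lt_angle j k : (angle C j < angle C k) = (j < k)%N.
Proof.
by have [/angle_ltn//|/angle_leq] := ltnP j k; rewrite leNgt => /negbTE.
Qed.

Lemma angle_inj : injective (angle C).
Proof.
move=> j k E; have := lt_angle j k; have := lt_angle k j; rewrite E ltxx; lia.
Qed.

Lemma angleD k m : angle C (k + m * n) = angle C k + 2 * pi * m%:R.
Proof.
elim: m => [|m IH]; first by rewrite mul0n addn0 mulr0 addr0.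
by rewrite mulSnr addnA angle_period IH -[in RHS]addn1 natrD; ring.
Qed.

(** Boundary vertices coincide only if their indices are congruent modulo
    [n], since the angles increase by [2 * pi] exactly every [n] steps. *)
Lemma angle_congr j k : cos (angle C j - angle C k) = 1 ->
  exists m, j = (k + m * n)%N \/ k = (j + m * n)%N.
Proof.
wlog kj : j k / (k <= j)%N.
  move=> H; have [/H//|/ltnW/H h] := leqP k j.
  by rewrite -cosN opprB => /h [m [->|->]]; exists m; [right|left].
move=> /cos_eq1_ge0[]; first by rewrite subr_ge0 angle_leq.
move=> m E; exists m; left; apply: angle_inj; rewrite angleD -E; ring.
Qed.

(** A lift of [g] to the strip of angles and positive radii. *)
Definition strip_path g th la : Prop :=
  [/\ continuous th, continuous la, forall t, 0 <= t <= 1 -> 0 < la t <= 1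
    & forall t, 0 <= t <= 1 -> g t = polar p (th t) (la t)].

(** The indices [j] and [k] are not reduced modulo [n]: their difference
    records the turn of [g] around the puncture. *)
Definition chord_path (j k : nat) g : Prop :=
  exists th la, [/\ strip_path g th la, th 0 = angle C j, th 1 = angle C k,
    la 0 = 1 /\ la 1 = 1 & forall t, 0 < t < 1 -> la t < 1].

Let itv0 : 0 <= (0 : R) <= 1. Proof. by rewrite lexx ler01. Qed.
Let itv1 : 0 <= (1 : R) <= 1. Proof. by rewrite lexx ler01. Qed.

Lemma vertices_polar a l : 0 < l < 1 -> ~ vertices C (polar p a l).
Proof.
move=> /andP[l0 l1] [E|[k _ E]].
  by move/eqP: (polar_neq pin a l0); apply.
apply: (@circle_not_open R (angle C k)); rewrite -/(boundary_vertex C k) E.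
by apply: (polar_open pin); rewrite ltW.
Qed.

(** The strip is convex, so the lifts are joined by straight segments.  The
    target may touch the boundary, as edges and constant paths do. *)
Lemma strip_homotopic g h th la ps mu :
  strip_path g th la -> strip_path h ps mu ->
  la 0 = 1 /\ la 1 = 1 -> (forall t, 0 < t < 1 -> la t < 1) ->
  mu 0 = 1 /\ mu 1 = 1 -> th 0 = ps 0 -> th 1 = ps 1 ->
  homotopic C g h.
Proof.
move=> [cth cla la01 gE] [cps cmu mu01 hE] [l0 l1] lt1 [m0 m1] e0 e1.
pose H (z : plane) := polar p ((1 - z.1) * th z.2 + z.1 * ps z.2)
                              ((1 - z.1) * la z.2 + z.1 * mu z.2).
have HE s t : H (s, t) = polar p ((1 - s) * th t + s * ps t)
   ((1 - s) * la t + s * mu t) by [].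
exists H; split.
- apply: continuous_subspaceT; apply: polar_continuous; apply: cont_atP => z; continuity.
- move=> t t01; rewrite !HE subr0 subrr !mul1r !mul0r !addr0 !add0r.
  by rewrite gE // hE.
- move=> s s01; rewrite !HE gE // gE // e0 e1 l0 l1 m0 m1 -!mulrDl.
  by rewrite subrK !mul1r.
- move=> s t s01 t01; rewrite HE; apply: (polar_closed pin).
  have := la01 _ t01; have := mu01 _ t01; move: s01.
  move=> /andP[s0 s1] /andP[h1 h2] /andP[h3 h4]; apply/andP; split.
    by rewrite addr_ge0 // mulr_ge0 ?subr_ge0 // ltW.
  have : 0 <= (1 - s) * (1 - la t) + s * (1 - mu t).
    by rewrite addr_ge0 // mulr_ge0 ?subr_ge0.
  lra.
move=> s t /andP[s0 s1] t01; rewrite HE; apply: vertices_polar.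
have t01' : 0 <= t <= 1 by move: t01 => /andP[/ltW -> /ltW ->].
have lt := lt1 _ t01; have := la01 _ t01'; have := mu01 _ t01'.
move=> /andP[h1 h2] /andP[h3 h4]; apply/andP; split.
  by rewrite ltr_pwDl ?mulr_gt0 ?subr_gt0 // mulr_ge0 // ltW.
have : 0 < (1 - s) * (1 - la t) + s * (1 - mu t).
  by rewrite ltr_pwDl ?mulr_gt0 ?subr_gt0 // mulr_ge0 // subr_ge0.
lra.
Qed.

Lemma strip_neq g th la t : strip_path g th la -> 0 <= t <= 1 -> g t != p.
Proof.
by move=> [_ _ la01 gE] t01; rewrite gE //; apply: (polar_neq pin); case/andP: (la01 _ t01).
Qed.

Lemma strip_lift_unique g th la ps mu : strip_path g th la -> strip_path g ps mu ->
  th 1 - th 0 = ps 1 - ps 0.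
Proof.
move=> [cth cla la01 gE] [cps cmu mu01 gE'].
have cd : continuous (fun t => th t - ps t) by apply: cont_atP => t; continuity.
have : th 1 - ps 1 = th 0 - ps 0; last lra.
apply: (cos1_constant cd) => t t01.
have /andP[l0 _] := la01 _ t01; have /andP[m0 _] := mu01 _ t01.
have E : polar p (th t) (la t) = polar p (ps t) (mu t) by rewrite -gE // -gE'.
by have [] := polar_inj pin l0 (ltW m0) E.
Qed.

(** The homotopy itself lifts to the strip, and the angle of the lift is
    constant on the two sides where the homotopy is constant. *)
Lemma homotopic_turn g h th la ps mu : homotopic C g h ->
  strip_path g th la -> strip_path h ps mu -> th 1 - th 0 = ps 1 - ps 0.
Proof.
move=> [H [cH H01 He Hc Hv]] sg sh.
have cH2 := within_clamp2 cH.
have Hsq z : square z -> closed_disk (H (clamp2 z)) /\ H (clamp2 z) != p.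
  case: z => s t [/=]; rewrite !in_itv /= => s01 t01.
  rewrite clamp2_id //; split; first exact: Hc.
  have [->|s1] := eqVneq s 1; first by rewrite (H01 _ t01).2; apply: strip_neq sh _.
  have [->|t0] := eqVneq t 0; first by rewrite (He _ s01).1; apply: strip_neq sg _.
  have [->|t1] := eqVneq t 1; first by rewrite (He _ s01).2; apply: strip_neq sg _.
  move: s01 t01 => /andP[s0 s1'] /andP[t0' t1'].
  have hs : 0 <= s < 1 by rewrite s0 lt_def eq_sym s1.
  have ht : 0 < t < 1 by rewrite !lt_def t0 t0' (eq_sym 1) t1.
  by apply/eqP => E; apply: (Hv _ _ hs ht); left.
have [cth cla la01 gE] := sg; have [cps cmu mu01 hE] := sh.
have /andP[l0 _] := la01 _ itv0.
have HP t : 0 <= t <= 1 -> H (clamp2 (0, t)) = g t.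
  by move=> t01; rewrite clamp2_id //= (H01 _ t01).1.
have HQ t : 0 <= t <= 1 -> H (clamp2 (1, t)) = h t.
  by move=> t01; rewrite clamp2_id //= (H01 _ t01).2.
have H0 : H (clamp2 (0, 0)) = polar p (th 0) (la 0) by rewrite HP // gE.
have [TH [LA [cTH cLA _ LA01 HE]]] := polar_lift pin cH2 Hsq H0 l0.
have sqI (s t : R) : 0 <= s <= 1 -> 0 <= t <= 1 -> square (s, t).
  by move=> *; split; rewrite /= in_itv.
have sg' : strip_path g (fun t => TH (0, t)) (fun t => LA (0, t)).
  split=> [||t t01|t t01].
  - by apply: cont_atP => t; continuity.
  - by apply: cont_atP => t; continuity.
  - by apply: LA01; apply: sqI.
  - by rewrite -HP // HE //; apply: sqI.
have sh' : strip_path h (fun t => TH (1, t)) (fun t => LA (1, t)).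
  split=> [||t t01|t t01].
  - by apply: cont_atP => t; continuity.
  - by apply: cont_atP => t; continuity.
  - by apply: LA01; apply: sqI.
  - by rewrite -HQ // HE //; apply: sqI.
rewrite (strip_lift_unique sg sg') (strip_lift_unique sh sh').
have side (t : R) : t = 0 \/ t = 1 -> TH (1, t) = TH (0, t).
  move=> t_end; have t01 : 0 <= t <= 1 by case: t_end => ->.
  have cd : continuous (fun s => TH (s, t) - TH (0, t)) by apply: cont_atP => s; continuity.
  have : TH (1, t) - TH (0, t) = TH (0, t) - TH (0, t); last lra.
  apply: (cos1_constant cd) => s s01.
  have E : polar p (TH (s, t)) (LA (s, t)) = polar p (TH (0, t)) (LA (0, t)).
    rewrite -!HE ?clamp2_id //; [|exact: sqI..].
    by have [h1 h2] := He _ s01; have [h3 h4] := He _ itv0; case: t_end => ->;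
      rewrite ?h1 ?h2 ?h3 ?h4.
  have /andP[h1 _] := LA01 _ (sqI _ _ s01 t01).
  have /andP[h2 _] := LA01 _ (sqI _ _ itv0 t01).
  by have [] := polar_inj pin h1 (ltW h2) E.
by rewrite (side 0 (or_introl erefl)) (side 1 (or_intror erefl)).
Qed.

Lemma chord_homotopic j k g h : chord_path j k g -> chord_path j k h ->
  homotopic C g h.
Proof.
move=> [th [la [sg t0 t1 l01 lt]]] [ps [mu [sh p0 p1 m01 _]]].
by apply: strip_homotopic sg sh l01 lt m01 _ _; rewrite ?t0 ?p0 ?t1 ?p1.
Qed.

Lemma edge_strip k :
  strip_path (edge C k) (fun t => (1 - t) * angle C k + t * angle C k.+1) (fun=> 1).
Proof.
split=> [|||t _]; last by rewrite polar1.
- by apply: cont_atP => t; continuity.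
- by apply: cont_atP => t; continuity.
- by move=> t _; rewrite ltr01 lexx.
Qed.

Lemma chord_edge k g : chord_path k k.+1 g -> homotopic C g (edge C k).
Proof.
move=> [th [la [sg t0 t1 l01 lt]]].
apply: strip_homotopic sg (edge_strip k) l01 lt _ _ _ => //.
  by rewrite t0 subr0 mul1r mul0r addr0.
by rewrite t1 subrr mul1r mul0r add0r.
Qed.

Lemma chord_const k g : chord_path k k g -> homotopic C g (fun=> boundary_vertex C k).
Proof.
move=> [th [la [sg t0 t1 l01 lt]]].
apply: (strip_homotopic (ps := fun=> angle C k) (mu := fun=> 1) sg) => //.
split=> [|||t _]; last by rewrite polar1.
- by apply: cont_atP => t; continuity.
- by apply: cont_atP => t; continuity.
- by move=> t _; rewrite ltr01 lexx.
Qed.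

Lemma const_strip k :
  strip_path (fun=> boundary_vertex C k) (fun=> angle C k) (fun=> 1).
Proof.
split=> [|||t _]; last by rewrite polar1.
- by apply: cont_atP => t; continuity.
- by apply: cont_atP => t; continuity.
- by move=> t _; rewrite ltr01 lexx.
Qed.

Lemma chord_reverse j k g : chord_path j k g -> chord_path k j (reverse g).
Proof.
move=> [th [la [[cth cla la01 gE] t0 t1 [l0 l1] lt]]].
exists (fun t => th (1 - t)), (fun t => la (1 - t)).
split; rewrite ?subr0 ?subrr //; last by move=> t t01; apply: lt; lra.
split=> [||t t01|t t01].
- by apply: cont_atP => t; continuity.
- by apply: cont_atP => t; continuity.
- by apply: la01; lra.
- by rewrite /reverse gE //; lra.
Qed.

Lemma chord_shift j k m g :
  chord_path (j + m * n) (k + m * n) g <-> chord_path j k g.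
Proof.
split=> -[th [la [[cth cla la01 gE] t0 t1 l01 lt]]].
  exists (fun t => th t - 2 * pi * m%:R), la; split=> //.
  - split=> // [|t t01]; first by apply: cont_atP => t; continuity.
    rewrite gE //; apply: polar_congr.
    by rewrite opprD opprK addNKr -[X in cos X]add0r cosD2pin cos0.
  - by rewrite t0 angleD addrK.
  - by rewrite t1 angleD addrK.
exists (fun t => th t + 2 * pi * m%:R), la; split=> //.
- split=> // [|t t01]; first by apply: cont_atP => t; continuity.
  rewrite gE //; apply: polar_congr.
  by rewrite opprD addrA subrr add0r cosN -[X in cos X]add0r cosD2pin cos0.
- by rewrite t0 angleD.
- by rewrite t1 angleD.
Qed.

(** Unlike in [chord_path], the radius may be 1 throughout: edges and constant
    paths at boundary vertices are included. *)
Definition winds (j k : nat) g : Prop :=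
  exists th la, [/\ strip_path g th la, th 0 = angle C j, th 1 = angle C k,
    la 0 = 1 & la 1 = 1].

Lemma chord_winds j k g : chord_path j k g -> winds j k g.
Proof. by move=> [th [la [sg t0 t1 [l0 l1] _]]]; exists th, la. Qed.

Lemma edge_winds k : winds k k.+1 (edge C k).
Proof.
exists (fun t => (1 - t) * angle C k + t * angle C k.+1), (fun=> 1).
split=> //; first exact: edge_strip; first by rewrite subr0 mul1r mul0r addr0.
by rewrite subrr mul1r mul0r add0r.
Qed.

Lemma const_winds k : winds k k (fun=> boundary_vertex C k).
Proof. by exists (fun=> angle C k), (fun=> 1); split=> //; apply: const_strip. Qed.

Lemma winds_reverse j k g : winds j k g -> winds k j (reverse g).
Proof.
move=> [th [la [[cth cla la01 gE] t0 t1 l0 l1]]].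
exists (fun t => th (1 - t)), (fun t => la (1 - t)).
split; rewrite ?subr0 ?subrr //; split=> [||t t01|t t01].
- by apply: cont_atP => t; continuity.
- by apply: cont_atP => t; continuity.
- by apply: la01; lra.
- by rewrite /reverse gE //; lra.
Qed.

Lemma winds_homotopic_inv j k j' k' g h : winds j k g -> winds j' k' h ->
  homotopic C g h ->
  exists m, (j = j' + m * n /\ k = k' + m * n)%N \/ (j' = j + m * n /\ k' = k + m * n)%N.
Proof.
move=> [th [la [sg t0 t1 l0 _]]] [ps [mu [sh p0 p1 m0 _]]] gh.
have T := homotopic_turn gh sg sh; rewrite t0 t1 p0 p1 in T.
have [H [_ H01 He _ _]] := gh.
have gh0 : g 0 = h 0 by rewrite -(He 1 itv1).1 (H01 _ itv0).2.
have c : cos (angle C j - angle C j') = 1.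
  have [_ _ _ gE] := sg; have [_ _ _ hE] := sh.
  move: gh0; rewrite gE // hE // t0 p0 l0 m0 => E.
  by have [] := polar_inj pin ltr01 ler01 E.
have [m [jE|jE]] := angle_congr c; exists m; [left|right]; split=> //.
  by apply: angle_inj; rewrite angleD; move: T; rewrite jE angleD; lra.
by apply: angle_inj; rewrite angleD; move: T; rewrite jE angleD; lra.
Qed.

End paths.

(** * A winding number argument *)

Section winding.
Variable R : realType.
Local Notation plane := (R * R)%type.

(** To get beyond [b], [f] would have to take a value just above it. *)
Lemma barrier_le (f : R -> R) b : continuous f -> f 0 <= b ->
  (forall t, 0 <= t <= 1 -> ~ b < f t < b + pi) -> f 1 <= b.
Proof.
move=> cf f0 no; have p0 := pi_gt0 R; rewrite leNgt; apply/negP => f1.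
have lt01 : f 0 <= f 1 by lra.
pose v := Num.min (f 1) (b + pi / 2).
have v1 : b < v <= f 1 by rewrite lt_min f1 ge_min lexx /=; lra.
have v2 : v <= b + pi / 2 by rewrite ge_min lexx orbT.
have [|t] := @IVT R f 0 1 v ler01 (continuous_subspaceT cf).
  by rewrite min_l // max_r //; lra.
by rewrite in_itv /= => t01 ft; apply: (no _ t01); rewrite ft; lra.
Qed.

Lemma barrier_ge (f : R -> R) b : continuous f -> b <= f 0 ->
  (forall t, 0 <= t <= 1 -> ~ b - pi < f t < b) -> b <= f 1.
Proof.
move=> cf f0 no; have cn : continuous (fun t => - f t) by apply: cont_atP => t; continuity.
suff : - f 1 <= - b by rewrite lerN2.
apply: (barrier_le cn) => [|t t01]; first by rewrite lerN2.
by move=> h; apply: (no _ t01); lra.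
Qed.

Lemma barrier_lt (f : R -> R) b : continuous f -> f 0 < b ->
  (forall t, 0 <= t <= 1 -> f t <> b) -> f 1 < b.
Proof.
move=> cf f0 no; rewrite ltNge; apply/negP => f1.
have lt01 : f 0 <= f 1 by lra.
have [|t] := @IVT R f 0 1 b ler01 (continuous_subspaceT cf).
  by rewrite min_l // max_r //; lra.
by rewrite in_itv /= => t01 ft; apply: (no _ t01).
Qed.

Lemma sin_lt0 (x : R) : - pi < x < 0 -> sin x < 0.
Proof. by move=> h; rewrite -oppr_gt0 -sinN sin_gt0_pi //; lra. Qed.

Lemma sin_lt0' (x : R) : pi < x < 2 * pi -> sin x < 0.
Proof.
move=> h; rewrite -(subrK pi x) sinDpi oppr_lt0 sin_gt0_pi //; lra.
Qed.

(** Without a zero, [F] has a continuous angle on the square, which may be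
    taken to be 0 at the corner [(0, 0)].  Along the side [s = 0] the vector
    stays in the upper half plane and ends on the negative axis, so the angle
    becomes [pi]; continuing along [t = 1] in the lower half plane, it is at
    least [pi] at the opposite corner.  The other way round, it becomes at most
    0 along [t = 0], then negative, and along [s = 1] it cannot return to 0,
    because the positive axis is avoided there. *)
Theorem square_zero (F : plane -> plane) : continuous F ->
  (forall t, 0 <= t <= 1 -> 0 <= (F (0, t)).2) ->
  (forall s, 0 <= s <= 1 -> (F (s, 0)).2 <= 0) ->
  (forall s, 0 <= s <= 1 -> (F (s, 1)).2 <= 0) ->
  0 < (F (0, 0)).1 -> (F (0, 1)).1 < 0 ->
  (forall t, 0 <= t <= 1 -> (F (1, t)).2 = 0 -> (F (1, t)).1 < 0) ->
  exists s t, [/\ 0 <= s <= 1, 0 <= t <= 1 & F (s, t) = (0, 0)].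
Proof.
move=> cF top left right c00 c01 bot; apply: contrapT => noz.
have p0 := pi_gt0 R.
have i0 : 0 <= (0 : R) <= 1 by rewrite lexx ler01.
have i1 : 0 <= (1 : R) <= 1 by rewrite lexx ler01.
have cc2 := @clamp2_continuous R.
pose N (z : plane) := Num.sqrt (dot (F (clamp2 z)) (F (clamp2 z))).
have Nsq z : 0 < dot (F (clamp2 z)) (F (clamp2 z)).
  rewrite lt_def dot_ge0 andbT; apply/eqP => E; apply: noz.
  exists (clamp z.1), (clamp z.2); rewrite !clamp_itv; split=> //.
  move/eqP: E; rewrite /dot paddr_eq0 -?expr2 ?sqr_ge0 // !sqrf_eq0.
  rewrite -/(clamp2 z); case: (F _) => x y /= /andP[/eqP -> /eqP ->] //.
have Np z : 0 < N z by rewrite sqrtr_gt0.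
have Nn z : N z != 0 by rewrite gt_eqF.
pose U z : plane := ((F (clamp2 z)).1 / N z, (F (clamp2 z)).2 / N z).
have cU : continuous U.
  have cN : continuous N by rewrite /N /dot; apply: cont_atP => z; continuity.
  by rewrite /U; apply: cont_atP => z; continuity; apply: cont_at_inv => //; continuity.
have U1 z : dot (U z) (U z) = 1.
  apply: (mulfI (expf_neq0 2 (Nn z))); rewrite mulr1 [RHS]sqr_sqrtr ?ltW //.
  by rewrite /U /dot /=; field; apply: Nn.
have F00 : (F (0, 0)).2 = 0 by apply/eqP; rewrite eq_le left // top.
have F01 : (F (0, 1)).2 = 0 by apply/eqP; rewrite eq_le right // top.
have U0 : circle_point 0 = U (0, 0).
  have N0 : N (0, 0) = (F (0, 0)).1.
    by rewrite /N clamp2_id // /dot F00 mulr0 addr0 -expr2 sqrtr_sqr gtr0_norm.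
  rewrite /U N0 clamp2_id // F00 mul0r divff ?gt_eqF //.
  by rewrite /circle_point cos0 sin0.
have [th [cth th0 thU]] := circle_lift cU U1 U0.
have csE s t : 0 <= s <= 1 -> 0 <= t <= 1 ->
    cos (th (s, t)) = (F (s, t)).1 / N (s, t) /\ sin (th (s, t)) = (F (s, t)).2 / N (s, t).
  move=> s01 t01; have := thU (s, t); rewrite /U clamp2_id // => E.
  have sq : square (s, t) by split; rewrite /= in_itv.
  by move: (E sq); rewrite /circle_point => -[-> ->].
have ctop : continuous (fun t => th (0, t)) by apply: cont_atP => t; continuity.
have cleft : continuous (fun s => th (s, 0)) by apply: cont_atP => t; continuity.
have cright : continuous (fun s => th (s, 1)) by apply: cont_atP => t; continuity.
have cbot : continuous (fun t => th (1, t)) by apply: cont_atP => t; continuity.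
have top_ge : 0 <= th (0, 1).
  apply: (barrier_ge ctop); rewrite ?th0 // => t t01; rewrite sub0r => /sin_lt0.
  by rewrite (csE _ _ i0 t01).2 pmulr_llt0 ?invr_gt0 // ltNge top.
have top_le : th (0, 1) <= pi.
  apply: (barrier_le ctop); rewrite ?th0 ?ltW // => t t01 h.
  have /sin_lt0' : pi < th (0, t) < 2 * pi by lra.
  by rewrite (csE _ _ i0 t01).2 pmulr_llt0 ?invr_gt0 // ltNge top.
have th01 : th (0, 1) = pi.
  have [cE sE] := csE _ _ i0 i1; rewrite F01 mul0r in sE.
  have [lt|gt|//] := ltgtP (th (0, 1)) pi; last by lra.
  have [E|/eqP ne] := eqVneq (th (0, 1)) 0.
    move: cE; rewrite E cos0 => /esym E1.
    have : (F (0, 1)).1 / N (0, 1) < 0 by rewrite pmulr_llt0 ?invr_gt0.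
    by rewrite E1; lra.
  have : 0 < sin (th (0, 1)) by apply: sin_gt0_pi; rewrite lt andbT lt_def top_ge andbT; apply/eqP.
  by rewrite sE ltxx.
have left_le : th (1, 0) <= 0.
  apply: (barrier_le cleft); rewrite ?th0 // => s s01; rewrite add0r => /sin_gt0_pi.
  by rewrite (csE _ _ s01 i0).2 pmulr_lgt0 ?invr_gt0 // ltNge left.
have bot_ne t : 0 <= t <= 1 -> th (1, t) <> 0.
  move=> t01 E; have [cE sE] := csE _ _ i1 t01.
  move: sE; rewrite E sin0 => /esym/eqP; rewrite mulf_eq0 invr_eq0 (negbTE (Nn _)) orbF.
  move=> /eqP/(bot _ t01) lt; move: cE; rewrite E cos0 => E1.
  have : (F (1, t)).1 / N (1, t) < 0 by rewrite pmulr_llt0 ?invr_gt0.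
  by rewrite -E1; lra.
have bot_lt : th (1, 1) < 0.
  apply: (barrier_lt cbot) => //; rewrite lt_def left_le andbT eq_sym; exact/eqP/bot_ne.
have : pi <= th (1, 1).
  apply: (barrier_ge cright); rewrite ?th01 // => s s01; rewrite subrr => /sin_gt0_pi.
  by rewrite (csE _ _ s01 i1).2 pmulr_lgt0 ?invr_gt0 // ltNge right.
lra.
Qed.

End winding.

(** * Crossing of lifted paths *)

(** A zero of the difference of the two lifts is sought, with the first one
    run backwards so as to match the sides in [square_zero]. *)
Lemma strip_crossing (R : realType) (th la ps mu : R -> R) :
  continuous th -> continuous la -> continuous ps -> continuous mu ->
  (forall s, 0 <= s <= 1 -> la s <= 1) -> la 1 = 1 ->
  (forall s, 0 <= s <= 1 -> la s = 1 -> s = 0 \/ s = 1) ->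
  (forall t, 0 <= t <= 1 -> mu t <= 1) -> mu 0 = 1 -> mu 1 = 1 ->
  (forall t, 0 < t < 1 -> mu t < 1) ->
  (forall t, 0 <= t <= 1 -> la 0 = mu t -> th 0 < ps t) ->
  ps 0 < th 1 < ps 1 ->
  exists s t, [/\ 0 < s < 1, 0 < t < 1, th s = ps t & la s = mu t].
Proof.
move=> cth cla cps cmu la1 l1 lend mu1 m0 m1 mlt bot /andP[c0 c1].
pose F (z : R * R) := (th (1 - z.1) - ps z.2, la (1 - z.1) - mu z.2).
have cF : continuous F by rewrite /F; apply: cont_atP => z; continuity.
have [t t01|s s01|s s01||||s [t [s01 t01 [thE laE]]]] := square_zero cF.
- by rewrite /= subr0 l1 subr_ge0 mu1.
- by rewrite /= m0 subr_le0 la1 //; lra.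
- by rewrite /= m1 subr_le0 la1 //; lra.
- by rewrite /= subr0 subr_gt0.
- by rewrite /= subr0 subr_lt0.
- move=> t t01 /= /eqP; rewrite subrr subr_eq0 subr_lt0 => /eqP; exact: bot.
have {thE}thE : th (1 - s) = ps t by lra.
have {laE}laE : la (1 - s) = mu t by lra.
have {s01} : 0 <= 1 - s <= 1 by lra.
move: (1 - s) thE laE => u thE laE u01.
have tend : mu t = 1 -> t = 0 \/ t = 1.
  move=> E; have [->|t0] := eqVneq t 0; first by left.
  have [->|t1] := eqVneq t 1; first by right.
  by have := mlt t; rewrite E ltxx !lt_def t0 (eq_sym 1) t1 => /(_ t01).
have u0 : u <> 0 by move=> E; move: laE thE; rewrite E => /(bot _ t01) lt E'; lra.
have u1 : u <> 1.
  by move=> E; move: laE thE; rewrite E l1 => /esym/tend[->|->] E'; lra.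
have mt : mu t <> 1.
  by rewrite -laE => /(lend _ u01)[].
exists u, t; split=> //; first by rewrite !lt_def; move: u01 => /andP[-> ->];
  rewrite !andbT (eq_sym 1); apply/andP; split; apply/eqP.
rewrite !lt_def; move: t01 => /andP[-> ->]; rewrite !andbT (eq_sym 1).
by apply/andP; split; apply/eqP => E; apply: mt; rewrite E.
Qed.

Section arcs.
Variables (R : realType) (n : nat) (C : crown R n).
Local Notation plane := (R * R)%type.
Local Notation p := (puncture C).
Local Notation pin := (puncture_interior C).
Implicit Types (g h : R -> plane).

Lemma itv_cc (t : R) : 0 < t < 1 -> 0 <= t <= 1.
Proof. by move=> /andP[/ltW -> /ltW ->]. Qed.

Lemma itv_end (t : R) : 0 <= t <= 1 -> [\/ t = 0, t = 1 | 0 < t < 1].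
Proof.
move=> /andP[t0 t1]; have [->|n0] := eqVneq t 0; first by constructor 1.
have [->|n1] := eqVneq t 1; first by constructor 2.
by constructor 3; rewrite !lt_def n0 t0 eq_sym n1.
Qed.

Lemma open_closed (z : plane) : open_disk z -> closed_disk z.
Proof. exact: ltW. Qed.

Lemma vertices_closed z : vertices C z -> closed_disk z.
Proof.
move=> [->|[k _ <-]]; first exact/open_closed/pin.
by rewrite /closed_disk /= cos2Dsin2.
Qed.

Lemma simple_arc_closed g t : simple_arc C g -> 0 <= t <= 1 -> closed_disk (g t).
Proof.
move=> [_ [v0 v1] gi _] /itv_end[->|->|/gi[h _]].
- exact: vertices_closed.
- exact: vertices_closed.
- exact: open_closed.
Qed.

Lemma simple_arc_neq g t : simple_arc C g -> 0 < t < 1 -> g t <> p.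
Proof. by move=> [_ _ gi _] /gi[_ h] E; apply: h; left. Qed.

(** The lift is taken backwards from the end [g 1]: so [g] may start at the
    puncture, and the angle at [g 1] can be prescribed. *)
Lemma arc_tail_lift g k e : simple_arc C g -> g 1 = boundary_vertex C k ->
  0 <= e < 1 -> g e <> p ->
  exists th la : R -> R, [/\ continuous th, continuous la, th 1 = angle C k, la 1 = 1
    & forall t, 0 <= t <= 1 -> [/\ 0 < la t <= 1, la t = 1 -> t = 0 \/ t = 1
       & g (e + (1 - e) * t) = polar p (th t) (la t)]].
Proof.
move=> sg g1 /andP[e0 e1] gep; have [cg v gi _] := sg.
have cgc := within_clamp cg.
have par (t : R) : 0 <= t <= 1 -> 0 <= e + (1 - e) * t <= 1.
  move=> /andP[t0 t1]; rewrite addr_ge0 ?mulr_ge0 ?subr_ge0 //=; last exact: ltW.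
  have : 0 <= (1 - e) * (1 - t) by rewrite mulr_ge0 ?subr_ge0 // ltW.
  lra.
have par1 (t : R) : 0 < t < 1 -> 0 < e + (1 - e) * t < 1.
  move=> /andP[t0 t1]; rewrite ltr_wpDl ?mulr_gt0 ?subr_gt0 //=.
  have : 0 < (1 - e) * (1 - t) by rewrite mulr_gt0 ?subr_gt0.
  lra.
pose H (z : plane) := g (clamp (e + (1 - e) * (1 - z.2))).
have cH : continuous H.
  apply: cont_atP => z.
  apply: (cont_at_comp (h := fun t => g (clamp t)) (f := fun z : plane => e + (1 - e) * (1 - z.2))).
    exact: cgc.
  by continuity.
have Hsq z : square z -> closed_disk (H z) /\ H z != p.
  case: z => s t [_]; rewrite /= in_itv /= => t01.
  have u01 : 0 <= 1 - t <= 1 by lra.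
  rewrite /H /= clamp_id ?par //; split; first exact: simple_arc_closed (par _ u01).
  apply/eqP; case: (itv_end u01) => [->|->|/par1/(simple_arc_neq sg)//].
    by rewrite mulr0 addr0.
  rewrite mulr1 subrKC g1 /boundary_vertex -(polar1 p) => E; move: (polar_neq pin (angle C k) ltr01).
  by rewrite E eqxx.
have H0 : H (0, 0) = polar p (angle C k) 1.
  rewrite /H /= subr0 mulr1 subrKC clamp_id ?lexx ?ler01 // g1.
  by rewrite polar1.
have [TH [LA [cTH cLA TH0 LA01 HE]]] := polar_lift pin cH Hsq H0 ltr01.
have sq (t : R) : 0 <= t <= 1 -> square ((0, 1 - t) : plane).
  by move=> t01; split; rewrite /= in_itv /= ?lexx ?ler01 //; lra.
have HE' (t : R) : 0 <= t <= 1 ->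
    g (e + (1 - e) * t) = polar p (TH (0, 1 - t)) (LA (0, 1 - t)).
  move=> t01; rewrite -HE; last exact: sq.
  by rewrite /H /= opprB subrKC clamp_id // par.
exists (fun t => TH (0, 1 - t)), (fun t => LA (0, 1 - t)).
have l1 : LA (0, 1 - 1) = 1.
  have i1 : 0 <= (1 : R) <= 1 by rewrite lexx ler01.
  have /andP[h _] := LA01 _ (sq _ i1).
  have := HE' _ i1; rewrite mulr1 subrKC g1 /boundary_vertex -(polar1 p).
  by move=> /(polar_inj pin ltr01 (ltW h))[].
split=> //.
- by apply: cont_atP => t; continuity.
- by apply: cont_atP => t; continuity.
- by rewrite subrr.
move=> t t01; split; [exact: LA01 (sq _ t01)| |exact: HE'].
case: (itv_end t01) => [|| /par1 u01 E]; [by left|by right|].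
have [+ _] := gi _ u01; rewrite HE' // E polar1 => /circle_not_open; case.
Qed.

(** Cut off the beginning of [g], up to a point which is closer to the
    puncture than all of [h].  The rest climbs from below [h] to a boundary
    point between the ends of [h]. *)
Lemma radial_crossing k a b g h : simple_arc C g -> g 0 = p ->
  g 1 = boundary_vertex C k -> chord_path C a b h -> (a < k < b)%N ->
  exists s t, [/\ 0 < s < 1, 0 < t < 1 & g s = h t].
Proof.
move=> sg g0 g1 [ps [mu [[cps cmu mu01 hE] p0 p1 [m0 m1] mlt]]] akb.
have [cg v gi _] := sg; have cgc := within_clamp cg.
have [c] := EVT_min ler01 (continuous_subspaceT cmu).
rewrite in_itv /= => c01 cmin; have /andP[mc0 _] := mu01 _ c01.
pose G t := gauge p (g (clamp t)).
have cG : continuous G.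
  by have cga := gauge_continuous pin; apply: cont_atP => t; rewrite /G; continuity.
have G0 : G 0 = 0.
  by rewrite /G clamp_id ?lexx ?ler01 // g0 -[X in gauge p X](polar0 p 0) (gauge_polar pin).
have [e [/andP[e0 e1] eG]] : exists e, 0 < e < 1 /\ G e < mu c.
  have : nbhs (G 0) [set x | x < mu c].
    by apply: open_nbhs_nbhs; split=> /=; [exact: open_lt|rewrite G0].
  move=> /cG /nbhs_ballP[d /= d0 dG].
  exists (Num.min d 1 / 2); split.
    rewrite divr_gt0 ?lt_min ?d0 ?ltr01 //=.
    have : Num.min d 1 <= 1 by rewrite ge_min lexx orbT.
    lra.
  apply: dG; rewrite /ball /= sub0r normrN gtr0_norm ?divr_gt0 ?lt_min ?d0 ?ltr01 //.
  have : Num.min d 1 <= d by rewrite ge_min lexx.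
  lra.
have [] := arc_tail_lift sg g1 (e := e).
- by rewrite (ltW e0).
- by apply: (simple_arc_neq sg); rewrite e0.
move=> th [la [cth cla th1 la1 spec]].
have l0 : la 0 = G e.
  have [|/andP[h1 _] _] := spec 0; first by rewrite lexx ler01.
  rewrite mulr0 addr0 /G clamp_id ?ltW // => ->.
  by rewrite (gauge_polar pin) // ltW.
have [|||t t01 E||s [t [s01 t01 thE laE]]] := strip_crossing cth cla cps cmu _ la1 _ _ m0 m1 mlt.
- by move=> s /spec[/andP[_ ->]].
- by move=> s /spec[].
- by move=> t /mu01/andP[_ ->].
- have : mu c <= mu t by apply: cmin; rewrite in_itv.
  by rewrite -E l0; lra.
- by rewrite p0 p1 th1 !lt_angle.
exists (e + (1 - e) * s), t; split=> //.
  move: s01 => /andP[s0 s1]; rewrite addr_gt0 ?mulr_gt0 ?subr_gt0 //=.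
  have : 0 < (1 - e) * (1 - s) by rewrite mulr_gt0 ?subr_gt0.
  lra.
have [_ _ ->] := spec _ (itv_cc s01).
by rewrite hE ?thE ?laE //; apply: itv_cc.
Qed.

End arcs.

(** * Simple arcs *)

Section arcs.
Variables (R : realType) (n : nat) (C : crown R n).
Local Notation plane := (R * R)%type.
Local Notation p := (puncture C).
Local Notation pin := (puncture_interior C).
Implicit Types (g h : R -> plane).

Let i0 : 0 <= (0 : R) <= 1. Proof. by rewrite lexx ler01. Qed.
Let i1 : 0 <= (1 : R) <= 1. Proof. by rewrite lexx ler01. Qed.

Lemma chord_strip_crossing g h th la ps mu :
  strip_path C g th la -> strip_path C h ps mu ->
  la 0 = 1 -> la 1 = 1 -> (forall t, 0 < t < 1 -> la t < 1) ->
  mu 0 = 1 -> mu 1 = 1 -> (forall t, 0 < t < 1 -> mu t < 1) ->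
  th 0 < ps 0 -> ps 0 < th 1 -> th 1 < ps 1 ->
  exists s t, [/\ 0 < s < 1, 0 < t < 1, th s = ps t & la s = mu t].
Proof.
move=> [cth cla la01 _] [cps cmu mu01 _] l0 l1 llt m0 m1 mlt o1 o2 o3.
apply: strip_crossing => //.
- by move=> s /la01/andP[].
- move=> s /itv_end[->|->|/llt lt E]; [by left|by right|].
  by rewrite E ltxx in lt.
- by move=> s /mu01/andP[].
- move=> t /itv_end[->|->|/mlt lt E] //; first by move=> _; lra.
  by rewrite -E l0 ltxx in lt.
- by rewrite o2.
Qed.

Lemma chord_crossing a b c e g h : chord_path C a b g -> chord_path C c e h ->
  (a < c)%N -> (c < b)%N -> (b < e)%N ->
  exists s t, [/\ 0 < s < 1, 0 < t < 1 & g s = h t].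
Proof.
move=> [th [la [sg t0 t1 [l0 l1] llt]]] [ps [mu [sh p0 p1 [m0 m1] mlt]]] ac cb be.
have [|||s [t [s01 t01 thE laE]]] := chord_strip_crossing sg sh l0 l1 llt m0 m1 mlt.
- by rewrite t0 p0 lt_angle.
- by rewrite t1 p0 lt_angle.
- by rewrite t1 p1 lt_angle.
exists s, t; split=> //.
have [_ _ _ gE] := sg; have [_ _ _ hE] := sh.
by rewrite gE ?hE ?thE ?laE //; apply: itv_cc.
Qed.

(** Otherwise the ends of the lift interlace with those of its translate by
    a full turn, and their crossing is a self-intersection of [g]. *)
Lemma simple_chord_length j k g : simple_arc C g -> chord_path C j k g ->
  (k <= j + n)%N.
Proof.
move=> [_ _ _ inj] [th [la [sg t0 t1 [l0 l1] llt]]].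
rewrite leqNgt; apply/negP => kj.
have pp := pi_gt0 R; have [cth cla la01 gE] := sg.
have sg' : strip_path C g (fun t => th t + 2 * pi) la.
  split=> // [|t t01]; first by apply: cont_atP => t; continuity.
  rewrite gE //; apply: polar_congr.
  by rewrite opprD addrA subrr add0r cosN mulr_natl cos2pi.
have ajn : angle C (j + n) = angle C j + 2 * pi by exact: angle_period.
have akj : angle C (j + n) < angle C k by rewrite lt_angle.
have [|||s [t [s01 t01 thE laE]]] := chord_strip_crossing sg sg' l0 l1 llt l0 l1 llt.
- lra.
- by rewrite t0 t1 -ajn.
- lra.
have E : g s = g t.
  have [_ _ _ gE'] := sg'.
  by rewrite (gE _ (itv_cc s01)) (gE' _ (itv_cc t01)) thE laE.
move: s01 t01 => /andP[s0 s1] /andP[u0 u1].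
have [lt|gt|st] := ltgtP s t.
- by have [s_0 _] := inj _ _ (ltW s0) lt (ltW u1) E; rewrite s_0 ltxx in s0.
- by have [t_0 _] := inj _ _ (ltW u0) gt (ltW s1) (esym E); rewrite t_0 ltxx in u0.
- by move: thE; rewrite st; lra.
Qed.

Lemma simple_arc_chord g : simple_arc C g -> g 0 <> p -> g 1 <> p ->
  exists j k, chord_path C j k g.
Proof.
move=> sg g0p g1p; have [_ [v0 v1] _ _] := sg.
case: v0 => [/g0p//|[j _ jE]]; case: v1 => [/g1p//|[k _ kE]].
have [] := arc_tail_lift sg (esym kE) (e := 0) => //; first by rewrite lexx ltr01.
move=> th [la [cth cla th1 la1 spec]].
have gE t : 0 <= t <= 1 -> g t = polar p (th t) (la t).
  by move=> /spec[_ _]; rewrite subr0 mul1r add0r.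
have lt1 t : 0 < t < 1 -> la t < 1.
  move=> t01; have [/andP[_ le] no _] := spec _ (itv_cc t01).
  rewrite lt_def le andbT eq_sym; apply/eqP => /no[] E;
    by move: t01; rewrite E ltxx // andbF.
have [/andP[la0p _] _ _] := spec _ i0.
have [la0 c0] : la 0 = 1 /\ cos (th 0 - angle C j) = 1.
  by apply: (polar_inj pin la0p ler01); rewrite -gE // -jE polar1.
have mk (f : R -> R) a b : continuous f -> f 0 = angle C a -> f 1 = angle C b ->
    (forall t, polar p (th t) (la t) = polar p (f t) (la t)) -> chord_path C a b g.
  move=> cf f0 f1 fE; exists f, la; split=> //; split=> // t t01.
    by have [] := spec _ t01.
  by rewrite gE.
have [le|lt] := leP (angle C j) (th 0).
  have [|m mE] := cos_eq1_ge0 _ c0; first by rewrite subr_ge0.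
  exists (j + m * n)%N, k; apply: (mk th) => //.
  by rewrite angleD -mE addrC subrK.
have c0' : cos (angle C j - th 0) = 1 by rewrite -cosN opprB.
have [|m mE] := cos_eq1_ge0 _ c0'; first by rewrite subr_ge0 ltW.
exists j, (k + m * n)%N; apply: (mk (fun t => th t + 2 * pi * m%:R)).
- by apply: cont_atP => t; continuity.
- by rewrite -mE addrC subrK.
- by rewrite th1 angleD.
- move=> t; apply: polar_congr.
  by rewrite opprD addrA subrr add0r cosN -[X in cos X]add0r cosD2pin cos0.
Qed.

(** The factor [q] is only required to be bounded. *)
Lemma cont_at_mul_vanish (T : topologicalType) (q f : T -> R) x :
  (forall z, `|q z| <= 1) -> cont_at f x -> f x = 0 ->
  cont_at (fun z => q z * f z) x.
Proof.
move=> q1 cf fx.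
suff h : q z * f z @[z --> x] --> (0 : R).
  by rewrite /cont_at fx mulr0.
have nf : `|f z| @[z --> x] --> (0 : R).
  have : `|f z| @[z --> x] --> `|f x| by apply: cvg_norm.
  by rewrite fx normr0.
have nf' : - `|f z| @[z --> x] --> (0 : R).
  have : - `|f z| @[z --> x] --> - (0 : R) by apply: cvgN.
  by rewrite oppr0.
apply: (squeeze_cvgr _ nf' nf); near=> z.
by rewrite -ler_norml normrM ler_piMl.
Unshelve. all: by end_near.
Qed.

(** The path [g], with its part before the parameter [c] replaced by the
    segment from the puncture to [g c].  This makes sense even if [g] spirals
    around the puncture infinitely often, so that its lift has no limit there. *)
Definition straightened g (c t : R) : plane :=
  let m := Num.max (clamp c) (clamp t) in
  let q := clamp t / m in
  (p.1 + q * ((g (clamp m)).1 - p.1), p.2 + q * ((g (clamp m)).2 - p.2)).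

(** The quotient of the parameters is discontinuous where both vanish, but
    it is bounded, and there [g] tends to the puncture. *)
Lemma straightened_continuous g (a b : plane -> R) : {within `[0, 1], continuous g} ->
  g 0 = p -> continuous a -> continuous b ->
  continuous (fun z => straightened g (a z) (b z)).
Proof.
move=> cg g0 ca cb; have cgc := within_clamp cg; have cc := @clamp_continuous R.
pose m z := Num.max (clamp (a z)) (clamp (b z)).
have cm : continuous m by rewrite /m; apply: cont_atP => z; continuity.
have cG : continuous (fun z => g (clamp (m z))).
  by apply: cont_atP => z; apply: (cont_at_comp (h := fun t => g (clamp t))); [exact: cgc|continuity].
have m0 z : 0 <= m z by rewrite le_max; case/andP: (clamp_itv (a z)) => ->.
have q1 z : `|clamp (b z) / m z| <= 1.
  have /andP[b0 _] := clamp_itv (b z).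
  rewrite ger0_norm; last by rewrite divr_ge0.
  have [->|mn] := eqVneq (m z) 0; first by rewrite invr0 mulr0 ler01.
  have mp : 0 < m z by rewrite lt_def mn m0.
  by rewrite ler_pdivrMr // mul1r le_max lexx orbT.
apply: cont_atP => z; rewrite /straightened.
have key (f : plane -> R) : continuous f -> (m z = 0 -> f z = 0) ->
    cont_at (fun z => clamp (b z) / m z * f z) z.
  move=> cf fz; have [mz|mz] := eqVneq (m z) 0.
    by apply: cont_at_mul_vanish => //; [exact: cf|exact: fz].
  apply: cont_at_mul; last by continuity.
  by apply: cont_at_mul; [continuity|apply: cont_at_inv => //; continuity].
apply: cont_at_pair; apply: cont_at_add; try exact: cont_at_cst; apply: key.
- by apply: cont_atP => y; continuity.
- by rewrite -/(m z) => ->; rewrite clamp_id // g0 subrr.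
- by apply: cont_atP => y; continuity.
- by rewrite -/(m z) => ->; rewrite clamp_id // g0 subrr.
Qed.

Lemma straightened_end g c t : 1 <= c -> 0 <= t <= 1 ->
  straightened g c t = (p.1 + t * ((g 1).1 - p.1), p.2 + t * ((g 1).2 - p.2)).
Proof.
move=> c1 t01; have cE : clamp c = 1 by rewrite /clamp min_r // max_r.
have mE : Num.max 1 t = 1 by rewrite max_l //; case/andP: t01.
by rewrite /straightened cE (clamp_id t01) mE divr1 clamp_id.
Qed.

Lemma straightened_start g t : g 0 = p -> 0 <= t <= 1 -> straightened g 0 t = g t.
Proof.
move=> g0 t01; rewrite /straightened !(clamp_id t01) clamp_id // max_r; last by case/andP: t01.
rewrite (clamp_id t01) [RHS]surjective_pairing.
have [->|t0] := eqVneq t 0; first by rewrite g0 !subrr !mulr0 !addr0.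
by rewrite divff // !mul1r !subrKC.
Qed.

Lemma straightened_0 g c : straightened g c 0 = p.
Proof. by rewrite /straightened (clamp_id i0) !mul0r !addr0 -surjective_pairing. Qed.

Lemma straightened_1 g c : straightened g c 1 = g 1.
Proof.
have /andP[c0 c1] := clamp_itv c.
rewrite /straightened (clamp_id i1) max_r // divr1 !mul1r !subrKC clamp_id //.
by rewrite -surjective_pairing.
Qed.

Lemma open_not_vertex z : open_disk z -> z <> p -> ~ vertices C z.
Proof. by move=> oz zp [//|[k _ E]]; apply: (@circle_not_open R (angle C k)); rewrite -E in oz. Qed.

Lemma segment_open (w : plane) q : closed_disk w -> 0 < q <= 1 ->
  q < 1 \/ open_disk w ->
  open_disk (p.1 + q * (w.1 - p.1), p.2 + q * (w.2 - p.2)).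
Proof.
rewrite /closed_disk /open_disk /= => w1 /andP[q0 q1] strict.
have pp := pin; rewrite /open_disk /= in pp.
have -> : (p.1 + q * (w.1 - p.1)) ^+ 2 + (p.2 + q * (w.2 - p.2)) ^+ 2 =
    (1 - q) * (p.1 ^+ 2 + p.2 ^+ 2) + q * (w.1 ^+ 2 + w.2 ^+ 2)
    - q * (1 - q) * ((w.1 - p.1) ^+ 2 + (w.2 - p.2) ^+ 2) by ring.
have h0 : 0 <= q * (1 - q) * ((w.1 - p.1) ^+ 2 + (w.2 - p.2) ^+ 2).
  by rewrite !mulr_ge0 ?subr_ge0 ?addr_ge0 ?sqr_ge0 // ltW.
have h1 : 0 <= (1 - q) * (1 - (p.1 ^+ 2 + p.2 ^+ 2)).
  by rewrite mulr_ge0 ?subr_ge0 // ltW.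
have h2 : 0 <= q * (1 - (w.1 ^+ 2 + w.2 ^+ 2)) by rewrite mulr_ge0 ?subr_ge0 // ltW.
case: strict => [q1'|w1'].
  have : 0 < (1 - q) * (1 - (p.1 ^+ 2 + p.2 ^+ 2)) by rewrite mulr_gt0 ?subr_gt0.
  lra.
have : 0 < q * (1 - (w.1 ^+ 2 + w.2 ^+ 2)) by rewrite mulr_gt0 ?subr_gt0.
lra.
Qed.

Lemma straightened_avoid g c t : simple_arc C g -> g 1 <> p -> 0 < t < 1 ->
  open_disk (straightened g c t) /\ straightened g c t <> p.
Proof.
move=> sg g1p /[dup] t01 /andP[t0 t1]; rewrite /straightened (clamp_id (itv_cc t01)).
set m := Num.max _ _; have /andP[c0 c1] := clamp_itv c.
have m01 : 0 < m <= 1 by rewrite lt_max t0 orbT ge_max c1 ltW.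
have [m0 m1] := andP m01.
have m01' : 0 <= m <= 1 by rewrite ltW.
rewrite clamp_id //.
have tm : t <= m by rewrite le_max lexx orbT.
have q01 : 0 < t / m <= 1 by rewrite divr_gt0 // ler_pdivrMr // mul1r.
have gm : g m <> p.
  have [->//|ne] := eqVneq m 1.
  by apply: (simple_arc_neq sg); rewrite m0 lt_def eq_sym ne.
split.
  apply: segment_open => //; first exact: simple_arc_closed sg m01'.
  have [mE|ne] := eqVneq m 1; first by left; rewrite mE divr1.
  right; have [_ _ gi _] := sg; apply: (gi m _).1.
  by rewrite m0 lt_def eq_sym ne.
case/andP: q01 => q0 _; move: (t / m) q0 => q q0 E.
have cancel (x y : R) : y + q * (x - y) = y -> x = y.
  move=> xy; have /eqP : q * (x - y) = 0 by lra.
  by rewrite mulf_eq0 gt_eqF //= subr_eq0 => /eqP.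
apply: gm; rewrite [LHS]surjective_pairing [RHS]surjective_pairing.
by rewrite (cancel _ _ (congr1 fst E)) (cancel _ _ (congr1 snd E)).
Qed.

(** Straighten [g] to a segment, and then undo the straightening of [h].  At
    every stage at least one of the two straightened paths is that segment, so
    the concatenation is their sum minus the segment. *)
Lemma radial_homotopic g h : simple_arc C g -> simple_arc C h ->
  g 0 = p -> h 0 = p -> g 1 = h 1 -> g 1 <> p -> homotopic C g h.
Proof.
move=> sg sh g0 h0 gh1 g1p.
have h1p : h 1 <> p by rewrite -gh1.
have [cg _ _ _] := sg; have [ch _ _ _] := sh.
pose H (z : plane) : plane :=
  ((straightened g (2 * z.1) z.2).1 + (straightened h (2 - 2 * z.1) z.2).1
     - (p.1 + clamp z.2 * ((g 1).1 - p.1)),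
   (straightened g (2 * z.1) z.2).2 + (straightened h (2 - 2 * z.1) z.2).2
     - (p.2 + clamp z.2 * ((g 1).2 - p.2))).
have HE s t : 0 <= t <= 1 -> H (s, t) =
  ((straightened g (2 * s) t).1 + (straightened h (2 - 2 * s) t).1
     - (p.1 + t * ((g 1).1 - p.1)),
   (straightened g (2 * s) t).2 + (straightened h (2 - 2 * s) t).2
     - (p.2 + t * ((g 1).2 - p.2))).
  by move=> t01; rewrite /H /= (clamp_id t01).
have HK s t : s <= 1 / 2 -> 0 <= t <= 1 -> H (s, t) = straightened g (2 * s) t.
  move=> s2 t01; rewrite HE // (straightened_end h) //; last lra.
  by rewrite gh1 [RHS]surjective_pairing; congr (_, _); rewrite addrK.
have HL s t : 1 / 2 <= s -> 0 <= t <= 1 -> H (s, t) = straightened h (2 - 2 * s) t.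
  move=> s2 t01; rewrite HE // (straightened_end g) //; last lra.
  by rewrite [RHS]surjective_pairing; congr (_, _); rewrite addrAC subrr add0r.
have H0 s : 0 <= s <= 1 -> H (s, 0) = p.
  move=> _; have [s2|/ltW s2] := leP s (1 / 2).
    by rewrite HK // straightened_0.
  by rewrite HL // straightened_0.
have H1 s : 0 <= s <= 1 -> H (s, 1) = g 1.
  move=> _; have [s2|/ltW s2] := leP s (1 / 2).
    by rewrite HK // straightened_1.
  by rewrite HL // straightened_1.
have Hi s t : 0 < t < 1 -> open_disk (H (s, t)) /\ H (s, t) <> p.
  move=> t01; have [s2|/ltW s2] := leP s (1 / 2).
    by rewrite HK ?itv_cc //; apply: straightened_avoid.
  by rewrite HL ?itv_cc //; apply: straightened_avoid.
exists H; split.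
- apply: continuous_subspaceT.
  have cc := @clamp_continuous R.
  have cK : continuous (fun z : plane => straightened g (2 * z.1) z.2).
    by apply: straightened_continuous => //; apply: cont_atP => z; continuity.
  have cL : continuous (fun z : plane => straightened h (2 - 2 * z.1) z.2).
    by apply: straightened_continuous => //; apply: cont_atP => z; continuity.
  rewrite /H; apply: cont_atP => z.
  by apply: cont_at_pair; (apply: cont_at_add; [apply: cont_at_add; [apply: cont_at_fst || apply: cont_at_snd|
     apply: cont_at_fst || apply: cont_at_snd]; [exact: cK|exact: cL]|continuity]).
- move=> t t01; split.
    by rewrite HK ?mulr0 ?straightened_start //; lra.
  by rewrite HL ?mulr1 ?subrr ?straightened_start //; lra.
- by move=> s s01; rewrite H0 // H1 // g0.
- move=> s t s01 /itv_end[->|->|/(Hi s)[/open_closed//]].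
    by rewrite H0 //; apply: open_closed; apply: pin.
  by rewrite H1 //; apply: simple_arc_closed sg i1.
- by move=> s t _ /(Hi s)[? ?]; apply: open_not_vertex.
Qed.

Lemma homotopic_reverse g h : homotopic C (reverse g) (reverse h) -> homotopic C g h.
Proof.
move=> [H [cH H01 He Hc Hv]].
pose rv (z : plane) : plane := (z.1, 1 - z.2).
have fl (t : R) : 0 <= t <= 1 -> 0 <= 1 - t <= 1 by move=> ?; lra.
have cH2 := within_clamp2 cH; have cc2 := @clamp2_continuous R.
exists (fun z => H (z.1, 1 - z.2)); split => /=.
- apply: (eq_within (g := fun z : plane => H (clamp2 (rv z)))).
    apply: cont_atP => z; apply: (cont_at_comp (h := fun z => H (clamp2 z))); first exact: cH2.
    by rewrite /rv; continuity.
  move=> [s t]; rewrite inE => -[/=]; rewrite !in_itv /= => s01 t01.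
  by rewrite /rv clamp2_id //; apply: fl.
- move=> t /fl t01; have [-> ->] := H01 _ t01.
  by rewrite /reverse opprB !subrKC.
- move=> s s01; have [E0 E1] := He _ s01.
  by rewrite subr0 subrr E0 E1 /reverse subr0 subrr.
- by move=> s t s01 /fl; apply: Hc.
- by move=> s t s01 t01; apply: Hv => //; lra.
Qed.

End arcs.

(** * Standard arcs *)

Section standard.
Variables (R : realType) (n : nat) (C : crown R n).
Local Notation plane := (R * R)%type.
Local Notation p := (puncture C).
Local Notation pin := (puncture_interior C).
Implicit Types (g h : R -> plane).

Definition chord_angle (a b : nat) (t : R) : R :=
  (1 - t) * angle C a + t * angle C b.

(** Up to the factor [(2 * pi) ^- 2], every chord has the same quadratic term
    in the angle, so the radii of two chords differ by a linear function of the
    angle. *)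
Definition chord_radius (a b : nat) (t : R) : R :=
  1 - (chord_angle a b t - angle C a) * (angle C b - chord_angle a b t) / (2 * pi) ^+ 2.

Definition std_chord (a b : nat) (t : R) : plane :=
  polar p (chord_angle a b t) (chord_radius a b t).

Definition std_radial (k : nat) (t : R) : plane := polar p (angle C k) t.

Lemma two_pi_gt0 : 0 < 2 * pi :> R.
Proof. by rewrite mulr_gt0 ?pi_gt0. Qed.

Lemma chord_width a b : (a < b <= a + n)%N ->
  0 < angle C b - angle C a <= 2 * pi.
Proof.
move=> /andP[ab ban]; rewrite subr_gt0 lt_angle ab /= lerBlDl.
by rewrite -(angle_period C) angle_leq.
Qed.

Lemma chord_angle_itv a b t : (a < b)%N -> 0 < t < 1 ->
  angle C a < chord_angle a b t < angle C b.
Proof.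
move=> ab /andP[t0 t1]; have := ab; rewrite -(lt_angle C) => lt.
have h1 : 0 < t * (angle C b - angle C a) by rewrite mulr_gt0 ?subr_gt0.
have h2 : 0 < (1 - t) * (angle C b - angle C a) by rewrite mulr_gt0 ?subr_gt0.
rewrite /chord_angle; lra.
Qed.

Lemma chord_radiusE a b t : chord_radius a b t =
  1 - t * (1 - t) * ((angle C b - angle C a) / (2 * pi)) ^+ 2.
Proof.
have : pi != 0 :> R by rewrite gt_eqF ?pi_gt0.
by rewrite /chord_radius /chord_angle; move: (pi : R) => q qn; field; exact: qn.
Qed.

Lemma chord_radius_itv a b t : (a < b <= a + n)%N -> 0 <= t <= 1 ->
  0 < chord_radius a b t <= 1.
Proof.
move=> /chord_width/andP[w0 w1] /andP[t0 t1]; rewrite chord_radiusE.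
have q0 : 0 <= ((angle C b - angle C a) / (2 * pi)) ^+ 2 by rewrite sqr_ge0.
have q1 : ((angle C b - angle C a) / (2 * pi)) ^+ 2 <= 1.
  by rewrite expr_le1 // ?divr_ge0 ?ler_pdivrMr ?mul1r ?two_pi_gt0 // ltW ?two_pi_gt0.
move: (_ ^+ 2) q0 q1 => q q0 q1.
have h0 : 0 <= t * (1 - t) by rewrite mulr_ge0 ?subr_ge0.
have h1 : 0 <= t * (1 - t) * q by rewrite mulr_ge0.
have h2 : 0 <= t * (1 - t) * (1 - q) by rewrite mulr_ge0 ?subr_ge0.
(* [t * (1 - t) <= 1 / 4] *)
have h3 : 0 <= (2 * t - 1) ^+ 2 by rewrite sqr_ge0.
rewrite expr2 in h3; lra.
Qed.

Lemma chord_radius_lt1 a b t : (a < b)%N -> 0 < t < 1 -> chord_radius a b t < 1.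
Proof.
move=> ab t01; have := chord_angle_itv ab t01; rewrite /chord_radius => h.
rewrite ltrBlDr ltrDl divr_gt0 ?exprn_gt0 ?two_pi_gt0 //.
by rewrite mulr_gt0 // subr_gt0; case/andP: h.
Qed.

Lemma std_chord_path a b : (a < b <= a + n)%N -> chord_path C a b (std_chord a b).
Proof.
move=> ab; have ab' : (a < b)%N by case/andP: ab.
exists (chord_angle a b), (chord_radius a b); split.
- split=> // [||t]; last exact: chord_radius_itv.
    by rewrite /chord_angle; apply: cont_atP => t; continuity.
  by rewrite /chord_radius /chord_angle; apply: cont_atP => t; continuity.
- by rewrite /chord_angle subr0 mul1r mul0r addr0.
- by rewrite /chord_angle subrr mul1r mul0r add0r.
- by rewrite !chord_radiusE subrr !(mul0r, mulr0, subr0).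
- by move=> t; apply: chord_radius_lt1.
Qed.

Lemma chord_path_continuous a b g : chord_path C a b g -> {within `[0, 1], continuous g}.
Proof.
move=> [th [la [[cth cla _ gE] _ _ _ _]]].
apply: (eq_within (g := fun t => polar p (th t) (la t))).
  exact: polar_continuous.
by move=> t; rewrite inE /= in_itv /= => t01; rewrite gE.
Qed.

Lemma chord_path_ends a b g : chord_path C a b g ->
  g 0 = boundary_vertex C a /\ g 1 = boundary_vertex C b.
Proof.
move=> [th [la [[_ _ _ gE] t0 t1 [l0 l1] _]]].
have i0 : 0 <= (0 : R) <= 1 by rewrite lexx ler01.
have i1 : 0 <= (1 : R) <= 1 by rewrite lexx ler01.
by rewrite (gE _ i0) (gE _ i1) t0 t1 l0 l1 !polar1.
Qed.

Lemma boundary_vertex_neq k : boundary_vertex C k <> p.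
Proof.
move=> E; have := polar_neq pin (angle C k) ltr01.
by rewrite polar1 -/(boundary_vertex C k) E eqxx.
Qed.

(** The angle increases by at most [2 * pi], so only the two ends can
    coincide. *)
Lemma std_chord_simple a b : (a < b <= a + n)%N -> simple_arc C (std_chord a b).
Proof.
move=> ab; have cp := std_chord_path ab; have [e0 e1] := chord_path_ends cp.
have ab' : (a < b)%N by case/andP: ab.
split.
- exact: chord_path_continuous cp.
- by rewrite e0 e1; split; right; [exists a|exists b].
- move=> t t01; have /andP[r0 _] := chord_radius_itv ab (itv_cc t01).
  have r1 := chord_radius_lt1 ab' t01.
  by split; [apply: (polar_open pin); rewrite ltW|apply: vertices_polar; rewrite r0].
move=> s t s0 st t1 E.
have s01 : 0 <= s <= 1 by rewrite s0 (le_trans (ltW st) t1).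
have t01 : 0 <= t <= 1 by rewrite t1 (le_trans s0 (ltW st)).
have /andP[r0 _] := chord_radius_itv ab s01; have /andP[r0' _] := chord_radius_itv ab t01.
have [_ c] := polar_inj pin r0 (ltW r0') E.
have /andP[w0 w1] := chord_width ab.
have aE : chord_angle a b t - chord_angle a b s = (t - s) * (angle C b - angle C a).
  by rewrite /chord_angle; ring.
have d0 : 0 < chord_angle a b t - chord_angle a b s by rewrite aE mulr_gt0 // subr_gt0.
have big : 2 * pi <= chord_angle a b t - chord_angle a b s.
  rewrite leNgt; apply/negP => lt.
  have := @cos_eq1_small R (chord_angle a b t - chord_angle a b s).
  by rewrite gtr0_norm // -cosN opprB => /(_ lt c); lra.
have ts : 1 <= t - s.
  have : (t - s) * (angle C b - angle C a) <= (t - s) * (2 * pi).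
    by rewrite ler_wpM2l // subr_ge0 ltW.
  rewrite -aE => h; rewrite -(ler_pM2r two_pi_gt0) mul1r; lra.
by split; lra.
Qed.

Lemma std_radial_simple k : simple_arc C (std_radial k).
Proof.
split.
- apply: continuous_subspaceT; apply: polar_continuous; apply: cont_atP => t; continuity.
- by rewrite /std_radial polar0 polar1; split; [left|right; exists k].
- move=> t t01; split; last exact: vertices_polar.
  by apply: (polar_open pin); move: t01 => /andP[/ltW -> ->].
move=> s t s0 st t1 /esym E.
have [ts _] := polar_inj pin (le_lt_trans s0 st) s0 E.
by rewrite ts ltxx in st.
Qed.

(** Angular intervals which overlap without interlacing are nested, and over
    the smaller one the wider chord lies strictly closer to the puncture. *)
Lemma std_chord_disjoint_lift a b c e (s t : R) :
  (a < b)%N -> (c < e)%N -> ~~ interlaced a b c e -> ~~ interlaced c e a b ->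
  (a, b) <> (c, e) -> 0 < s < 1 -> 0 < t < 1 ->
  chord_angle a b s = chord_angle c e t -> chord_radius a b s <> chord_radius c e t.
Proof.
move=> ab ce n1 n2 ne s01 t01 E.
have /andP[h1 h2] := chord_angle_itv ab s01.
have /andP[h3 h4] := chord_angle_itv ce t01.
have cb : (c < b)%N by rewrite -(lt_angle C); lra.
have ae : (a < e)%N by rewrite -(lt_angle C); lra.
rewrite /chord_radius E => /(addrI _)/oppr_inj/(mulIf _) F.
have {F} : (chord_angle c e t - angle C a) * (angle C b - chord_angle c e t) =
  (chord_angle c e t - angle C c) * (angle C e - chord_angle c e t).
  by apply: F; rewrite invr_eq0 expf_neq0 // gt_eqF // two_pi_gt0.
move: (chord_angle c e t) E h1 h2 h3 h4 => x -> h1 h2 h3 h4.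
have nest a' b' c' e' : (a' <= c')%N -> (e' <= b')%N -> (a', b') <> (c', e') ->
    angle C c' < x < angle C e' ->
    (x - angle C a') * (angle C b' - x) <> (x - angle C c') * (angle C e' - x).
  move=> ac eb ne' /andP[k1 k2] F.
  have ac' := angle_leq C ac; have eb' := angle_leq C eb.
  have u1 : 0 <= (angle C c' - angle C a') * (angle C e' - x).
    by rewrite mulr_ge0 ?subr_ge0 // ltW.
  have u2 : 0 <= (angle C b' - angle C e') * (x - angle C a').
    by rewrite mulr_ge0 ?subr_ge0 // ltW // (le_lt_trans ac').
  have : (a' < c')%N || (e' < b')%N.
    apply: contra_notT ne' => /norP[]; rewrite -!leqNgt => ca be.
    by congr (_, _); apply/eqP; rewrite eqn_leq ?ac ?ca ?eb ?be.
  case/orP => lt; move: (lt); rewrite -(lt_angle C) => lt'.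
    have : 0 < (angle C c' - angle C a') * (angle C e' - x).
      by rewrite mulr_gt0 ?subr_gt0.
    by lra.
  have : 0 < (angle C b' - angle C e') * (x - angle C a').
    by rewrite mulr_gt0 ?subr_gt0 // (le_lt_trans ac').
  by lra.
move: n1 n2; rewrite /interlaced ae cb !andbT => n1 n2.
have [/andP[x1 x2]|nst] : ((a <= c) && (e <= b) \/ (c <= a) && (b <= e))%N.
  move: n1 n2; case: (ltngtP a c) => [_|_|_] /=; rewrite -?leqNgt => n1 n2.
  - by left.
  - by right.
  - by case: (leqP e b) => [|/ltnW]; [left|right].
- by apply: nest; rewrite // h3.
- case/andP: nst => x1 x2 /esym; apply: nest; rewrite // ?h1 //.
by move=> [? ?]; apply: ne; congr (_, _).
Qed.

End standard.

(** * Codes of arcs *)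

Section reversal.
Variables (R : realType) (n : nat) (C : crown R n).
Local Notation plane := (R * R)%type.
Local Notation p := (puncture C).
Local Notation pin := (puncture_interior C).
Implicit Types (g h : R -> plane).

Lemma reverseK g : reverse (reverse g) = g.
Proof. by apply/funext => t; rewrite /reverse opprB subrKC. Qed.

Lemma simple_arc_reverse g : simple_arc C g -> simple_arc C (reverse g).
Proof.
move=> [cg [v0 v1] gi inj]; have cgc := within_clamp cg.
split=> [||t t01|s t s0 st t1 E].
- apply: (@eq_within R plane _ (fun t => g (clamp (1 - t))) (reverse g)).
    by apply: cont_atP => t; apply: (cont_at_comp (h := fun t => g (clamp t))); [exact: cgc|continuity].
  move=> t; rewrite inE /= in_itv /= => t01; rewrite clamp_id //; lra.
- by rewrite /reverse subr0 subrr.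
- by apply: gi; lra.
- by have [] := inj (1 - t) (1 - s) _ _ _ (esym E); try lra; split; lra.
Qed.

Lemma homotopic_reverse_iff g h :
  homotopic C (reverse g) (reverse h) <-> homotopic C g h.
Proof.
split=> H; first exact: homotopic_reverse.
by apply: homotopic_reverse; rewrite !reverseK.
Qed.

Lemma homotopic_ends g h : homotopic C g h -> g 0 = h 0 /\ g 1 = h 1.
Proof.
have i0 : 0 <= (0 : R) <= 1 by rewrite lexx ler01.
have i1 : 0 <= (1 : R) <= 1 by rewrite lexx ler01.
move=> [H [_ H01 He _ _]]; have [<- <-] := He _ i1.
by rewrite (H01 _ i0).2 (H01 _ i1).2.
Qed.

Lemma boundary_vertexD k m : boundary_vertex C (k + m * n) = boundary_vertex C k.
Proof.
by rewrite /boundary_vertex /circle_point angleD cosD2pin sinD2pin.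
Qed.

Lemma boundary_vertex_congr j k : boundary_vertex C j = boundary_vertex C k ->
  exists m, j = (k + m * n)%N \/ k = (j + m * n)%N.
Proof.
by rewrite /boundary_vertex /circle_point => -[c s]; exact: (angle_congr (cosB1 c s)).
Qed.

Lemma chord_path_reverse_inv j k g : chord_path C j k (reverse g) -> chord_path C k j g.
Proof. by move=> /chord_reverse; rewrite reverseK. Qed.

(** The loop contracts along the segments to the puncture. *)
Lemma puncture_loop_trivial g : simple_arc C g -> g 0 = p -> g 1 = p ->
  homotopic C g (fun=> p).
Proof.
move=> sg g0 g1; have [cg _ gi _] := sg; have cgc := within_clamp cg.
pose H (z : plane) : plane := (p.1 + (1 - z.1) * ((g (clamp z.2)).1 - p.1),
                               p.2 + (1 - z.1) * ((g (clamp z.2)).2 - p.2)).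
have HE s t : 0 <= t <= 1 -> H (s, t) =
    (p.1 + (1 - s) * ((g t).1 - p.1), p.2 + (1 - s) * ((g t).2 - p.2)).
  by move=> t01; rewrite /H /= clamp_id.
have i0 : 0 <= (0 : R) <= 1 by rewrite lexx ler01.
have i1 : 0 <= (1 : R) <= 1 by rewrite lexx ler01.
have pE s : (p.1 + (1 - s) * (p.1 - p.1), p.2 + (1 - s) * (p.2 - p.2)) = p.
  by rewrite !subrr !mulr0 !addr0 -surjective_pairing.
exists H; split.
- apply: continuous_subspaceT; rewrite /H.
  have cgz : continuous (fun z : plane => g (clamp z.2)).
    by apply: cont_atP => z; apply: (cont_at_comp (h := fun t => g (clamp t))); [exact: cgc|continuity].
  by apply: cont_atP => z; continuity.
- move=> t t01; rewrite !HE // subrr !mul0r !addr0 subr0 !mul1r !subrKC.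
  by rewrite -!surjective_pairing.
- by move=> s s01; rewrite !HE // g0 g1 pE.
- move=> s t /andP[s0 s1] t01; rewrite HE //.
  have [->|sn] := eqVneq s 1.
    by rewrite subrr !mul0r !addr0 -surjective_pairing; apply: open_closed; apply: pin.
  case: (itv_end t01) => [->|->|t01'].
  + by rewrite g0 pE; apply: open_closed; apply: pin.
  + by rewrite g1 pE; apply: open_closed; apply: pin.
  + apply: open_closed; apply: segment_open.
    * exact: simple_arc_closed sg t01.
    * by rewrite subr_gt0 lt_def eq_sym sn s1 /=; lra.
    * by right; apply: (gi t t01').1.
move=> s t /andP[s0 s1] t01; rewrite HE ?itv_cc //; apply: open_not_vertex.
  apply: segment_open.
  + exact: simple_arc_closed sg (itv_cc t01).
  + by rewrite subr_gt0 s1; lra.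
  + by right; apply: (gi t t01).1.
move=> E; have sn : 1 - s != 0 by rewrite subr_eq0 eq_sym lt_eqF.
have cancel (x y : R) : y + (1 - s) * (x - y) = y -> x = y.
  move=> xy; have /eqP : (1 - s) * (x - y) = 0 by lra.
  by rewrite mulf_eq0 (negbTE sn) /= subr_eq0 => /eqP.
apply: (simple_arc_neq sg t01); rewrite [LHS]surjective_pairing [RHS]surjective_pairing.
by rewrite (cancel _ _ (congr1 fst E)) (cancel _ _ (congr1 snd E)).
Qed.

End reversal.

Section codes.
Variables (R : realType) (d : nat) (C : crown R d.+1).
Local Notation n := d.+1.
Local Notation plane := (R * R)%type.
Local Notation p := (puncture C).
Local Notation code := ('I_n + 'I_n * 'I_d)%type.
Implicit Types (g h : R -> plane) (x y : code).

Definition oriented_code x g : Prop :=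
  match x with
  | inl k => g 0 = p /\ g 1 = boundary_vertex C k
  | inr c => chord_path C (from c) (upto c) g
  end.

(** A code records an arc with one orientation; arcs are unoriented. *)
Definition has_code x g : Prop := oriented_code x g \/ oriented_code x (reverse g).

Definition std_arc x : R -> plane :=
  match x with
  | inl k => std_radial C k
  | inr c => std_chord C (from c) (upto c)
  end.

Lemma code_range (c : 'I_n * 'I_d) : (from c < upto c <= from c + n)%N.
Proof. by have [_] := code_bounds c; lia. Qed.

Lemma std_arc_simple x : simple_arc C (std_arc x).
Proof.
by case: x => [k|c]; [exact: std_radial_simple|apply: std_chord_simple; exact: code_range].
Qed.

Lemma std_arc_code x : oriented_code x (std_arc x).
Proof.
case: x => [k|c] /=; last by apply: std_chord_path; exact: code_range.
by rewrite /std_radial polar0 polar1.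
Qed.

Lemma oriented_code_homotopic x g h : simple_arc C g -> simple_arc C h ->
  oriented_code x g -> oriented_code x h -> homotopic C g h.
Proof.
case: x => [k|c] sg sh /=; last exact: chord_homotopic.
move=> [g0 g1] [h0 h1]; apply: radial_homotopic => //; rewrite g1 //.
exact: boundary_vertex_neq.
Qed.

Lemma has_code_reverse x g : has_code x (reverse g) <-> has_code x g.
Proof. by rewrite /has_code reverseK; split=> -[]; by [left|right]. Qed.

Lemma has_code_homotopic x g h : simple_arc C g -> simple_arc C h ->
  has_code x g -> has_code x h -> arc_homotopic C g h.
Proof.
move=> sg sh; have sg' := simple_arc_reverse sg; have sh' := simple_arc_reverse sh.
case=> xg; case=> xh.
- by left; apply: oriented_code_homotopic xg xh.
- by right; apply: oriented_code_homotopic xg xh.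
- right; apply/homotopic_reverse_iff; rewrite reverseK.
  exact: oriented_code_homotopic xg xh.
- by left; apply/homotopic_reverse_iff; apply: oriented_code_homotopic xg xh.
Qed.

Lemma shift_code_inj (c e : 'I_n * 'I_d) m :
  from c = (from e + m * n)%N -> upto c = (upto e + m * n)%N -> c = e.
Proof.
have [h1 _] := code_bounds c.
case: m => [|m]; last by rewrite mulSn => h; move: h1; rewrite h; lia.
rewrite mul0n !addn0 /from /upto; case: c {h1} e => [j k] [j' k'] /= /val_inj -> /addnI.
by move=> [/val_inj ->].
Qed.

Lemma boundary_vertex_inj (j k : 'I_n) : boundary_vertex C j = boundary_vertex C k -> j = k.
Proof.
move=> /boundary_vertex_congr[m mE]; apply: val_inj => /=.
have := ltn_ord j; have := ltn_ord k; case: m mE => [|m]; rewrite ?mulSn; lia.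
Qed.

Lemma chord_path_neq j k g : chord_path C j k g -> g 0 <> p /\ g 1 <> p.
Proof. by move=> /chord_path_ends[-> ->]; split; apply: boundary_vertex_neq. Qed.

(** The ends and the turn around the puncture are homotopy invariants.  A
    chord and the reverse of a chord turn in opposite directions. *)
Lemma oriented_code_inj x y g h : homotopic C g h -> oriented_code x g ->
  has_code y h -> x = y.
Proof.
move=> gh; have [e0 e1] := homotopic_ends gh.
case: x => [k|c]; case: y => [k'|c'] /=.
- move=> [g0 g1] [[h0 h1]|[h0 h1]].
    by rewrite (boundary_vertex_inj (k := k') (j := k)) // -h1 -e1.
  by case: (@boundary_vertex_neq _ _ C k); rewrite -g1 e1 -h0 /reverse subr0.
- move=> [g0 g1] [/chord_path_neq[]|/chord_path_neq[_]]; first by rewrite -e0.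
  by rewrite /reverse subrr -e0.
- move=> /chord_path_neq[g0 g1] [[h0 _]|[h0 _]]; first by case: g0; rewrite e0.
  by case: g1; rewrite e1 -h0 /reverse subr0.
- move=> wg [wh|/chord_path_reverse_inv wh].
    have [m [[f u]|[f u]]] := winds_homotopic_inv (chord_winds wg) (chord_winds wh) gh.
      by rewrite (shift_code_inj f u).
    by rewrite (shift_code_inj f u).
  have := code_range c; have := code_range c'.
  have [m [[f u]|[f u]]] := winds_homotopic_inv (chord_winds wg) (chord_winds wh) gh;
    move: (from c) (upto c) (from c') (upto c') f u => *; lia.
Qed.

Lemma has_code_inj x y g h : arc_homotopic C g h -> has_code x g -> has_code y h -> x = y.
Proof.
wlog gh : h / homotopic C g h.
  move=> H [gh|gh] xg yh; first by apply: H xg yh => //; left.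
  by apply: (H (reverse h)) => //; [left|apply/has_code_reverse].
move=> _ [xg|xg] yh; first exact: oriented_code_inj gh xg yh.
have {}gh := (homotopic_reverse_iff C g h).2 gh.
by apply: oriented_code_inj gh xg _; apply/has_code_reverse.
Qed.

Lemma has_code_uniq x y g : simple_arc C g -> has_code x g -> has_code y g -> x = y.
Proof.
move=> sg xg yg; apply: (has_code_inj _ xg yg); exact (has_code_homotopic sg sg xg xg).
Qed.

(** Edges and constant paths advance by at most one vertex, while a chord
    advances by at least two. *)
Lemma std_arc_arc x : Defs.arc C (std_arc x).
Proof.
split; first exact: std_arc_simple.
have W (c : 'I_n * 'I_d) j k h : winds C j k h -> (j <= k <= j.+1)%N \/ (k <= j)%N ->
    homotopic C (std_arc (inr c)) h -> False.
  move=> wh jk gh.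
  have [m E] := winds_homotopic_inv (chord_winds (std_arc_code (inr c))) wh gh.
  have [_] := code_bounds c; move: (from c) (upto c) E => a b E.
  have {E} : (a + k = b + j)%N by case: E => -[]; lia.
  by lia.
case=> [[v Cv]|[k]].
  rewrite /arc_homotopic (_ : reverse (fun=> v) = fun=> v) //.
  move=> H; have {H}gh : homotopic C (std_arc x) (fun=> v) by case: H.
  case: x gh => [k|c] gh; have [e0 e1] := homotopic_ends gh.
    have [g0 g1] := std_arc_code (inl k).
    by apply: (@boundary_vertex_neq _ _ C k); rewrite -g1 e1 -e0 g0.
  have [g0 g1] := chord_path_ends (std_arc_code (inr c)).
  have vE : v = boundary_vertex C (from c) by rewrite -g0 e0.
  by apply: W gh; [rewrite vE; exact: const_winds|right].
have eN (t : R) : edge C k t <> p.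
  rewrite /edge -(polar1 p) => E; have := polar_neq (puncture_interior C) 
    ((1 - t) * angle C k + t * angle C k.+1) ltr01.
  by rewrite E eqxx.
case: x => [j|c] [gh|gh].
- by have [g0 _] := std_arc_code (inl j); have [e0 _] := homotopic_ends gh;
    apply: (eN 0); rewrite -e0.
- have [g0 _] := std_arc_code (inl j); have [e0 _] := homotopic_ends gh.
  by apply: (eN (1 - 0)); rewrite -[LHS]e0.
- by apply: W gh; [exact: edge_winds|left; rewrite leqnSn leqnn].
- by apply: W gh; [apply: winds_reverse; exact: edge_winds|right].
Qed.

(** An arc that turns clockwise is reversed.  Nontriviality excludes loops at
    the puncture and chords that advance by less than two vertices. *)
Lemma arc_has_code g : Defs.arc C g -> exists x, has_code x g.
Proof.
move=> [sg ntg].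
have rad h : simple_arc C h -> h 0 = p -> h 1 <> p -> exists x, oriented_code x h.
  move=> sh h0 h1; have [_ [_ v1] _ _] := sh; case: v1 => [/h1//|[k _ kE]].
  exists (inl (inord (k %% n))) => /=; split=> //.
  rewrite inordK; last exact: ltn_pmod.
  by rewrite -(boundary_vertexD C _ (k %/ n)) -kE {1}(divn_eq k n) addnC.
have chd j k h : simple_arc C h -> chord_path C j k h -> (j.+2 <= k)%N ->
    exists x, oriented_code x h.
  move=> sh hjk jk; have kn := simple_chord_length sh hjk.
  have lm : (k - j - 2 < d)%N by lia.
  have lj : (j %% n < n)%N by apply: ltn_pmod.
  exists (inr (Ordinal lj, Ordinal lm)) => /=.
  apply/(chord_shift C _ _ (j %/ n)); rewrite /from /upto /=.
  have jE := divn_eq j n.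
  have <- : (j = j %% n + j %/ n * n)%N by rewrite addnC.
  by have <- : (k = j %% n + (k - j - 2).+2 + j %/ n * n)%N by lia.
have sg' := simple_arc_reverse sg.
have [g0|g0] := eqVneq (g 0) p; have [g1|g1] := eqVneq (g 1) p.
- case: ntg; left; exists p; first by left.
  by left; apply: puncture_loop_trivial.
- by have [x xg] := rad g sg g0 (elimN eqP g1); exists x; left.
- have [||x xg] := rad _ sg'; rewrite ?/reverse ?subr0 ?subrr //; first exact/eqP.
  by exists x; right.
have [j [k gjk]] := simple_arc_chord sg (elimN eqP g0) (elimN eqP g1).
have [jk|kj|jk] := ltngtP j k.
- have [jk'|jk'] := eqVneq k j.+1.
    by case: ntg; right; exists j; left; apply: chord_edge; rewrite -jk'.
  by have [|x xg] := chd _ _ _ sg gjk; [lia|exists x; left].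
- have rkj := chord_reverse gjk.
  have [jk'|jk'] := eqVneq j k.+1.
    case: ntg; right; exists k; right; apply/homotopic_reverse_iff.
    by rewrite reverseK; apply: chord_edge; rewrite -jk'.
  by have [|x xg] := chd _ _ _ sg' rkj; [lia|exists x; right].
- case: ntg; left; exists (boundary_vertex C j); first by right; exists j.
  by left; apply: chord_const; rewrite {2}jk.
Qed.

End codes.

(** * The arc complex *)

Section classes.
Variables (R : realType) (d : nat) (C : crown R d.+1).
Local Notation n := d.+1.
Local Notation plane := (R * R)%type.
Local Notation p := (puncture C).
Local Notation code := ('I_n + 'I_n * 'I_d)%type.
Local Notation code_compat := (rcompat (@inside d) (@noncrossing d)).
Implicit Types (g h : R -> plane) (x y : code).

Definition code_class x : set (R -> plane) := arc_class C (std_arc C x).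

Lemma std_arc_has_code x : has_code C x (std_arc C x).
Proof. by left; apply: std_arc_code. Qed.

(** On arcs, homotopy amounts to equality of codes. *)
Lemma code_classP x g : code_class x g <-> Defs.arc C g /\ has_code C x g.
Proof.
split=> -[ag H]; split=> //.
  have [y yg] := arc_has_code ag.
  by rewrite (has_code_inj H (std_arc_has_code x) yg).
have [sg _] := ag; apply: has_code_homotopic (std_arc_has_code x) H => //.
exact: std_arc_simple.
Qed.

Lemma code_class_inj : injective code_class.
Proof.
move=> x y E; have : code_class x (std_arc C x).
  by apply/code_classP; split; [exact: std_arc_arc|exact: std_arc_has_code].
rewrite E => /code_classP[_ yx].
exact: has_code_uniq (std_arc_simple C x) (std_arc_has_code x) yx.
Qed.

Lemma arc_class_code g : Defs.arc C g -> exists x, arc_class C g = code_class x.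
Proof.
move=> ag; have [x xg] := arc_has_code ag; exists x.
have [sg _] := ag; apply/seteqP; split=> h.
  move=> [ah gh]; apply/code_classP; split=> //.
  by have [y yh] := arc_has_code ah; rewrite (has_code_inj gh xg yh).
move=> /code_classP[ah xh]; split=> //; have [sh _] := ah.
exact: has_code_homotopic xg xh.
Qed.

Definition crossing g h : Prop :=
  exists s t : R, [/\ 0 < s < 1, 0 < t < 1 & g s = h t].

Lemma crossing_sym g h : crossing g h -> crossing h g.
Proof. by move=> [s [t [s01 t01 E]]]; exists t, s. Qed.

Lemma crossing_reverse_l g h : crossing (reverse g) h -> crossing g h.
Proof. by move=> [s [t [s01 t01 E]]]; exists (1 - s), t; split=> //; lra. Qed.

Lemma crossing_reverse_r g h : crossing g (reverse h) -> crossing g h.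
Proof. by move=> /crossing_sym/crossing_reverse_l/crossing_sym. Qed.

Lemma chord_path_shift1 j k g : chord_path C j k g -> chord_path C (j + n) (k + n) g.
Proof. by move=> H; have := (chord_shift C j k 1 g).2 H; rewrite mul1n. Qed.

Lemma incompatible_crossing x y g h : simple_arc C g -> simple_arc C h ->
  oriented_code C x g -> oriented_code C y h -> ~~ code_compat x y -> crossing g h.
Proof.
have rc (k : 'I_n) (c : 'I_n * 'I_d) f1 f2 : simple_arc C f1 ->
    oriented_code C (inl k) f1 -> oriented_code C (inr c) f2 ->
    k \in inside c -> crossing f1 f2.
  move=> s1 [f10 f11] cf2; rewrite inE => /orP[h1|h1].
    exact: radial_crossing s1 f10 f11 cf2 h1.
  have f11' : f1 1 = boundary_vertex C (k + n).
    by rewrite f11 -(boundary_vertexD C k 1) mul1n.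
  exact: radial_crossing s1 f10 f11' cf2 h1.
case: x y => [k|c] [k'|c'] sg sh xg yh //= ncp.
- by move/negPn: ncp => ki; apply: rc sg xg yh ki.
- by move/negPn: ncp => ki; apply/crossing_sym; apply: rc sh yh xg ki.
have xg' := chord_path_shift1 xg; have yh' := chord_path_shift1 yh.
move/negPn: ncp; rewrite /interlaced => /or4P[x|x|x|/or3P[x|x|x]];
  have /andP[/andP[q1 q2] q3] := x.
- exact: chord_crossing xg yh q1 q2 q3.
- by apply/crossing_sym; apply: chord_crossing yh xg q1 q2 q3.
- exact: chord_crossing xg' yh q1 q2 q3.
- by apply/crossing_sym; apply: chord_crossing yh xg' q1 q2 q3.
- exact: chord_crossing xg yh' q1 q2 q3.
- by apply/crossing_sym; apply: chord_crossing yh' xg q1 q2 q3.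
Qed.

Lemma disjoint_compat x y : disjoint_classes (code_class x) (code_class y) ->
  code_compat x y.
Proof.
move=> [g [h [/code_classP[[sg _] xg] /code_classP[[sh _] yh] dis]]].
apply: contraT => ncp; suff : crossing g h.
  by move=> [s [t [s01 t01 E]]]; case: (dis s t s01 t01).
have sg' := simple_arc_reverse sg; have sh' := simple_arc_reverse sh.
case: xg => xg; case: yh => yh.
- exact: incompatible_crossing xg yh ncp.
- by apply: crossing_reverse_r; apply: incompatible_crossing xg yh ncp.
- by apply: crossing_reverse_l; apply: incompatible_crossing xg yh ncp.
- by apply: crossing_reverse_l; apply: crossing_reverse_r;
    apply: incompatible_crossing xg yh ncp.
Qed.

Lemma polar_meet a l b m : 0 < l -> 0 < m -> polar p a l = polar p b m ->
  l = m /\ exists k : nat, a = b + 2 * pi * k%:R \/ b = a + 2 * pi * k%:R.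
Proof.
move=> l0 m0 E; have [lm c] := polar_inj (puncture_interior C) l0 (ltW m0) E.
split=> //; have [ba|/ltW ab] := leP b a.
  have [|k kE] := cos_eq1_ge0 _ c; first by rewrite subr_ge0.
  by exists k; left; rewrite -kE addrC subrK.
have c' : cos (b - a) = 1 by rewrite -cosN opprB.
have [|k kE] := cos_eq1_ge0 _ c'; first by rewrite subr_ge0.
by exists k; right; rewrite -kE addrC subrK.
Qed.

Lemma chord_angleD a b m t :
  chord_angle C (a + m * n) (b + m * n) t = chord_angle C a b t + 2 * pi * m%:R.
Proof. by rewrite /chord_angle !angleD; ring. Qed.

Lemma chord_radiusD a b m t :
  chord_radius C (a + m * n) (b + m * n) t = chord_radius C a b t.
Proof. by rewrite !chord_radiusE !angleD opprD addrACA subrr addr0. Qed.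

(** The angular intervals of [c] and of the shifted [e] overlap only for
    [m <= 1], which are shifts that [noncrossing] takes into account. *)
Lemma std_chord_disjoint_shift (c e : 'I_n * 'I_d) m (s t : R) :
  noncrossing c e -> c <> e -> 0 < s < 1 -> 0 < t < 1 ->
  chord_radius C (from c) (upto c) s = chord_radius C (from e) (upto e) t ->
  chord_angle C (from c) (upto c) s = chord_angle C (from e) (upto e) t + 2 * pi * m%:R ->
  False.
Proof.
move=> nc ne s01 t01 rE aE.
have /andP[c1 c2] := code_range c; have /andP[e1 e2] := code_range e.
have [cn _] := code_bounds c.
rewrite -chord_angleD in aE; rewrite -(chord_radiusD (from e) _ m) in rE.
have e1' : (from e + m * n < upto e + m * n)%N by rewrite ltn_add2r.
have /andP[a1 a2] := chord_angle_itv C c1 s01.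
have /andP[a3 a4] := chord_angle_itv C e1' t01.
have o1 : (from c < upto e + m * n)%N by rewrite -(lt_angle C); lra.
have o2 : (from e + m * n < upto c)%N by rewrite -(lt_angle C); lra.
have m1 : (m = 0 \/ m = 1)%N.
  clear -o2 c2 cn; move: (from e) (from c) (upto c) o2 c2 cn => x y z.
  by case: m => [|[|m]]; [left|right|rewrite !mulSn; lia].
have [n1 n2] : ~~ interlaced (from c) (upto c) (from e + m * n) (upto e + m * n) /\
    ~~ interlaced (from e + m * n) (upto e + m * n) (from c) (upto c).
  move: nc; rewrite /noncrossing !negb_or => /and5P[k1 k2 k3 k4 /andP[k5 k6]].
  by case: m1 => ->; rewrite ?mul0n ?mul1n ?addn0.
have ne' : (from c, upto c) <> (from e + m * n, upto e + m * n)%N.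
  by move=> [f u]; apply/ne/(shift_code_inj f u).
exact (std_chord_disjoint_lift c1 e1' n1 n2 ne' s01 t01 aE rE).
Qed.

Lemma std_chord_disjoint (c e : 'I_n * 'I_d) : noncrossing c e -> c <> e ->
  ~ crossing (std_arc C (inr c)) (std_arc C (inr e)).
Proof.
move=> nc ne [s [t [s01 t01 E]]].
have /andP[r0 _] := chord_radius_itv C (code_range c) (itv_cc s01).
have /andP[r0' _] := chord_radius_itv C (code_range e) (itv_cc t01).
have [rE [m [aE|aE]]] := polar_meet r0 r0' E.
  exact: std_chord_disjoint_shift nc ne s01 t01 rE aE.
apply: (std_chord_disjoint_shift (c := e) (e := c) _ _ t01 s01 (esym rE) aE).
  by rewrite noncrossing_sym.
by move=> /esym.
Qed.

Lemma std_radial_chord_disjoint (k : 'I_n) (c : 'I_n * 'I_d) : k \notin inside c ->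
  ~ crossing (std_arc C (inl k)) (std_arc C (inr c)).
Proof.
move=> ki [s [t [/[dup] s01 /andP[s0 _] t01 E]]]; case/negP: ki.
have /andP[r0 _] := chord_radius_itv C (code_range c) (itv_cc t01).
have /andP[c1 c2] := code_range c; have [cn _] := code_bounds c; have kn := ltn_ord k.
have [_ [m [aE|aE]]] := polar_meet s0 r0 E; rewrite inE.
  rewrite -chord_angleD in aE.
  have c1' : (from c + m * n < upto c + m * n)%N by rewrite ltn_add2r.
  have := chord_angle_itv C c1' t01; rewrite -aE !lt_angle => km.
  case: m {aE c1'} km => [|m]; first by rewrite mul0n !addn0 => ->.
  by rewrite mulSn => /andP[+ _]; clear -kn; move: (from c) (k : nat) kn => x y; lia.
have := chord_angle_itv C c1 t01; rewrite aE -angleD !lt_angle.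
case: m {aE} => [|[|m]]; first by rewrite mul0n !addn0 => ->.
  by rewrite mul1n => ->; rewrite orbT.
rewrite !mulSn => /andP[_]; clear -cn c2.
by move: (from c) (upto c) (k : nat) cn c2 => x y z; lia.
Qed.

Lemma std_radial_disjoint (j k : 'I_n) : j <> k ->
  ~ crossing (std_arc C (inl j)) (std_arc C (inl k)).
Proof.
move=> jk [s [t [/andP[s0 _] /andP[t0 _] E]]]; apply: jk.
have [_ c] := polar_inj (puncture_interior C) s0 (ltW t0) E.
apply: (@boundary_vertex_inj R d C).
by rewrite /boundary_vertex /circle_point; have [-> ->] := cosB1P c.
Qed.

Lemma compat_disjoint x y : code_compat x y -> x <> y ->
  disjoint_classes (code_class x) (code_class y).
Proof.
move=> cp xy; have cl z : code_class z (std_arc C z).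
  by apply/code_classP; split; [exact: std_arc_arc|exact: std_arc_has_code].
exists (std_arc C x), (std_arc C y); split=> // s t s01 t01 E.
have : crossing (std_arc C x) (std_arc C y) by exists s, t.
case: x y cp xy {E cl} => [j|c] [k|e] /= cp xy.
- by apply: std_radial_disjoint => jk; apply: xy; rewrite jk.
- exact: std_radial_chord_disjoint.
- by move=> /crossing_sym; apply: std_radial_chord_disjoint.
- by apply: std_chord_disjoint => // ce; apply: xy; rewrite ce.
Qed.

Lemma arc_complex_faces s : faces (arc_complex C) s <->
  exists A : {set code}, [/\ A != finset.set0, face (@inside d) (@noncrossing d) A
    & s = [fset code_class x | x in A]%fset].
Proof.
split=> [[s0 sc sd]|[A [/finset.set0Pn[x xA] FA ->]]].
  have sE c : c \in s -> exists x, c = code_class x.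
    by move=> /sc[g ag <-]; apply: arc_class_code.
  exists [set x | code_class x \in s]%SET; split.
  - case/fset0Pn: s0 => c cs; have [x xE] := sE _ cs.
    by apply/finset.set0Pn; exists x; rewrite inE -xE.
  - move=> x y; rewrite !inE => xs ys.
    have [->|/eqP xy] := eqVneq x y.
      apply: (@face1 _ _ (@inside d) (@ends d) _ (@ends_inside d) (@crossing_ends d) y);
        by rewrite inE.
    apply: disjoint_compat; apply: sd => //.
    by move=> /code_class_inj.
  - apply/fsetP => c; apply/idP/imfsetP => [cs|[/= x + ->]]; last by rewrite inE.
    by have [x xE] := sE _ cs; exists x => //=; rewrite inE -xE.
split.
- by apply/fset0Pn; exists (code_class x); apply/imfsetP; exists x.
- move=> c /imfsetP[/= y _ ->]; exists (std_arc C y) => //; exact: std_arc_arc.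
- move=> c e /imfsetP[/= y yA ->] /imfsetP[/= z zA ->] yz.
  by apply: compat_disjoint; [exact: FA|move=> E; apply: yz; rewrite E].
Qed.

End classes.

Theorem corollary4p2 (R : realType) (n : nat) (hn : (1 <= n)%N)
    (C : crown R n) :
  combinatorial_ball R (n - 1)%N (arc_complex C).
Proof.
case: n hn C => // d _ C; rewrite subn1 /=.
apply: (triangulation_pl_homeomorphic (F := face (@inside d) (@noncrossing d))
  (cls := code_class C) (phi := ray R (@inside d))).
- exact: face_sub.
- exact: (face1 (@ends_inside d) (@crossing_ends d)).
- exact: code_class_inj.
- exact: arc_complex_faces.
- exact: ray_ge0 (@inside_neq0 d).
- exact: ray_sum (@inside_neq0 d).
- exact: (ray_uniq (@inside_inj d) (@inside_neq0 d) (@ends_neq0 d) (@ends_inside d)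
    (@inside_connected d) (@noncrossing_nested d) (@noncrossing_ends d) ord0).
- exact: (ray_onto (@inside_neq0 d) (@ends_inside d) (@noncrossing_sym d)
    (@crossing_ends d) (@inside_component d) ord0).
Qed.
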